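(* Let $k\ge 0$ be an integer. The Dirac operator $\mathcal{D}$ maps $V_k$ to $V_k$. There is an isometry of right $\mathbb{H}$-vector spaces $\Phi: V_k\to \mathbb{H}\otimes_{\mathbb{C}}(\mathbb{H}_k\otimes_{\mathbb{C}}\mathbb{H}_k)$ which intertwines the actions $\beta$ and $\gamma$ of $\mathrm{Sp}(1)\times \mathrm{Sp}(1)$. Under such an identification, the operator $\mathcal{D}|_{V_k}$ (that is, $\Phi\circ\mathcal{D}|_{V_k}\circ\Phi^{-1}$) has exactly the eigenvectors listed below as a complex orthogonal eigenbasis of $\mathbb{H}\otimes_{\mathbb{C}}(\mathbb{H}_k\otimes_{\mathbb{C}}\mathbb{H}_k)$. For the eigenvalue $k+\frac12$: $$e_0\otimes|p\rangle|q\rangle - e_2\otimes|p-1\rangle|q\rangle,\qquad p=1,\dots,k,\quad q=0,\dots,k.$$ For the eigenvalue $-k-\frac32$: $$(p-k-1)\,e_0\otimes|p\rangle|q\rangle - p\,e_2\otimes|p-1\rangle|q\rangle,\qquad p=1,\dots,k,\quad q=0,\dots,k,$$ $$e_0\otimes|0\rangle|q\rangle,\qquad e_2\otimes|k\rangle|q\rangle,\qquad q=0,\dots,k.$$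
   Context: Quaternions: $\mathbb{H}$ has the standard real basis $e_0=1,e_1,e_2,e_3$ with $e_1e_2=e_3$, etc.; $\mathbb{C}\subset\mathbb{H}$ via $\mathtt{i}=e_1$, and $\mathbb{H}$ is a complex vector space by left multiplication, with basis $e_0,e_2$ (so $\mathbb{H}\cong\mathbb{C}^2$ with its standard Hermitian metric). $S^3=\mathrm{Sp}(1)\subset\mathbb{H}$ is the group of unit quaternions with the metric induced from $\mathbb{H}\cong\mathbb{R}^4$. Its Lie algebra $\mathrm{sp}(1)$ consists of the imaginary quaternions, with basis $e_1,e_2,e_3$; $\mathbf{e}_1,\mathbf{e}_2,\mathbf{e}_3$ are the corresponding left-invariant vector fields. Dirac operator: The spin bundle of $\mathrm{Sp}(1)$ is trivialised, using the left-invariant frame, as $\mathrm{Sp}(1)\times\mathbb{H}$, so that spinors are functions $\sigma\in\mathcal{C}^\infty(\mathrm{Sp}(1);\mathbb{H})$. Clifford multiplication is $c_{\mathbf{e}_i}\sigma=-\sigma\cdot e_i$, and the spin connection induced by the Levi-Civita connection is $\tilde\nabla_{\mathbf{e}_i}\sigma=d\sigma(\mathbf{e}_i)-\frac12\sigma\cdot e_i$. The Dirac operator is $\mathcal{D}\sigma=\sum_{i=1}^3c_{\mathbf{e}_i}\tilde\nabla_{\mathbf{e}_i}\sigma$, i.e. $$\mathcal{D}\sigma=-\sum_{i=1}^3(l_{\mathbf{e}_i}\sigma)\cdot e_i-\tfrac32\sigma,\qquad (l_{\mathbf{e}_i}\sigma)(x)=\frac{d}{dt}\Big|_{t=0}\sigma(x\exp(te_i)).$$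 Spaces: $H^4_k$ is the real vector space of (restrictions to $S^3$ of) harmonic homogeneous polynomials of degree $k$ on $\mathbb{R}^4$, and $V_k=\mathbb{H}\otimes_{\mathbb{R}}H^4_k\subset\mathcal{C}^\infty(\mathrm{Sp}(1);\mathbb{H})$, a right $\mathbb{H}$-vector space (multiplication on the first factor) with the $\mathbb{H}$-valued $L^2$ product $\langle\sigma_1,\sigma_2\rangle=\int_{\mathrm{Sp}(1)}\overline{\sigma_1}\sigma_2\,d\nu$. The action $\beta$ on it is $(\beta(s,t)\sigma)(x)=\sigma(t^{-1}xs)$. Let $\mathbb{H}_1=\mathbb{H}$ with the complex structure above and the $\mathrm{Sp}(1)$-representation $s\cdot x=xs^{-1}$. $\mathbb{H}_k$ is the $k$-fold complex symmetric tensor power of $\mathbb{H}_1$ with the induced representation and the metric induced from $\mathbb{C}^2$ (and $\mathbb{H}_0=\mathbb{C}$ is the trivial representation). For $0\le d\le k$, $|d\rangle\in\mathbb{H}_k$ denotes the symmetric product (normalised symmetrisation, i.e. average over permutations) of $k-d$ copies of $e_0$ and $d$ copies of $e_2$; these form an orthogonal basis with $\langle |d\rangle,|d\rangle\rangle=\binom{k}{d}^{-1}$. Write $|p\rangle|q\rangle=|p\rangle\otimes|q\rangle\in\mathbb{H}_k\otimes_{\mathbb{C}}\mathbb{H}_k$. In $\mathbb{H}\otimes_{\mathbb{C}}(\mathbb{H}_k\otimes_{\mathbb{C}}\mathbb{H}_k)$ the first factor $\mathbb{H}$ is a complex space by left multiplication (so $ch\otimes u=h\otimes cu$ for $c\in\mathbb{C}$),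 which also gives the complex structure of the tensor product; it is a right $\mathbb{H}$-vector space by right multiplication on the first factor, with $\mathbb{H}$-valued product $\langle h\otimes u,h'\otimes u'\rangle=\bar h\langle u,u'\rangle h'$ (where $\langle u,u'\rangle$ is conjugate-linear in $u$). Complex orthogonality refers to the tensor product Hermitian metric for which $e_0,e_2$ are orthonormal in $\mathbb{H}$. The action $\gamma(s,t)$ acts trivially on the first factor $\mathbb{H}$, by $s$ on the first $\mathbb{H}_k$ and by $t$ on the second $\mathbb{H}_k$. *)

(* Defs.v *)
From HB Require Import structures.
From mathcomp Require Import all_boot all_order all_algebra all_fingroup.
From mathcomp Require Import ring.
From mathcomp Require mpoly.
(* The notations of mpoly clash with those of the analysis library. *)
Import -(notations) mpoly.
From mathcomp Require Import all_classical all_reals all_analysis.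
From mathcomp Require Import complex.

Set Implicit Arguments.
Unset Strict Implicit.
Unset Printing Implicit Defensive.

Import Order.TTheory GRing.Theory Num.Theory.
Import numFieldNormedType.Exports.

Local Open Scope classical_set_scope.
Local Open Scope ring_scope.

(* Quaternions: [Quat a b c d] is a + b e1 + c e2 + d e3. *)

Record quat (R : Type) := Quat { q0 : R; q1 : R; q2 : R; q3 : R }.
Arguments q0 {R} _.
Arguments q1 {R} _.
Arguments q2 {R} _.
Arguments q3 {R} _.

Lemma quat_eqP (R : Type) (x y : quat R) :
  q0 x = q0 y -> q1 x = q1 y -> q2 x = q2 y -> q3 x = q3 y -> x = y.
Proof. by case: x y => ???? [????] /= -> -> -> ->. Qed.

Definition tuple_of_quat (R : Type) (x : quat R) : R * R * R * R :=
  (q0 x, q1 x, q2 x, q3 x).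

Definition quat_of_tuple (R : Type) (t : R * R * R * R) : quat R :=
  Quat t.1.1.1 t.1.1.2 t.1.2 t.2.

Lemma tuple_of_quatK (R : Type) :
  cancel (@tuple_of_quat R) (@quat_of_tuple R).
Proof. by case. Qed.

HB.instance Definition _ (R : realType) :=
  Choice.copy (quat R) (can_type (@tuple_of_quatK R)).

Section QuatRing.
Variable R : realType.
Implicit Types x y z : quat R.

Definition qzero : quat R := Quat 0 0 0 0.
Definition qone : quat R := Quat 1 0 0 0.
Definition qadd x y : quat R :=
  Quat (q0 x + q0 y) (q1 x + q1 y) (q2 x + q2 y) (q3 x + q3 y).
Definition qopp x : quat R := Quat (- q0 x) (- q1 x) (- q2 x) (- q3 x).
Definition qmul x y : quat R := Quat
  (q0 x * q0 y - q1 x * q1 y - q2 x * q2 y - q3 x * q3 y)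
  (q0 x * q1 y + q1 x * q0 y + q2 x * q3 y - q3 x * q2 y)
  (q0 x * q2 y - q1 x * q3 y + q2 x * q0 y + q3 x * q1 y)
  (q0 x * q3 y + q1 x * q2 y - q2 x * q1 y + q3 x * q0 y).

Fact qaddA : associative qadd.
Proof. by move=> x y z; apply: quat_eqP => /=; ring. Qed.
Fact qaddC : commutative qadd.
Proof. by move=> x y; apply: quat_eqP => /=; ring. Qed.
Fact qadd0 : left_id qzero qadd.
Proof. by move=> x; apply: quat_eqP => /=; ring. Qed.
Fact qaddN : left_inverse qzero qopp qadd.
Proof. by move=> x; apply: quat_eqP => /=; ring. Qed.

HB.instance Definition _ :=
  GRing.isZmodule.Build (quat R) qaddA qaddC qadd0 qaddN.

Fact qmulA : associative qmul.
Proof. by move=> x y z; apply: quat_eqP => /=; ring. Qed.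
Fact qmul1l : left_id qone qmul.
Proof. by move=> x; apply: quat_eqP => /=; ring. Qed.
Fact qmul1r : right_id qone qmul.
Proof. by move=> x; apply: quat_eqP => /=; ring. Qed.
Fact qmulDl : left_distributive qmul +%R.
Proof. by move=> x y z; apply: quat_eqP => /=; ring. Qed.
Fact qmulDr : right_distributive qmul +%R.
Proof. by move=> x y z; apply: quat_eqP => /=; ring. Qed.
Fact qone_neq0 : qone != 0.
Proof. by apply/eqP => -[] /eqP; rewrite oner_eq0. Qed.

HB.instance Definition _ := GRing.Zmodule_isNzRing.Build (quat R)
  qmulA qmul1l qmul1r qmulDl qmulDr qone_neq0.

(* R and C = R + R e1 inside H *)
Definition qreal (r : R) : quat R := Quat r 0 0 0.
Definition qcplx (c : R[i]) : quat R := Quat (complex.Re c) (complex.Im c) 0 0.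

(* H is a complex vector space by left multiplication. *)
Definition qscale (c : R[i]) x : quat R := qcplx c * x.

Fact qscaleA a b x : qscale a (qscale b x) = qscale (a * b) x.
Proof. by case: a b => ? ? [? ?]; apply: quat_eqP => /=; ring. Qed.
Fact qscale1 : left_id 1 qscale.
Proof. by move=> x; apply: quat_eqP => /=; ring. Qed.
Fact qscaleDr : right_distributive qscale +%R.
Proof. by move=> c x y; rewrite /qscale mulrDr. Qed.
Fact qscaleDl x : {morph qscale^~ x : a b / a + b}.
Proof. by case=> ? ? [? ?]; apply: quat_eqP => /=; ring. Qed.

HB.instance Definition _ := GRing.Zmodule_isLmodule.Build R[i] (quat R)
  qscaleA qscale1 qscaleDr qscaleDl.

(* Complex coordinates with respect to the basis e0 (false), e2 (true). *)
Definition hcoord x (b : bool) : R[i] :=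
  if b then (q2 x +i* q3 x)%C else (q0 x +i* q1 x)%C.

Fact quat_vect_axiom : Vector.axiom 2 (quat R).
Proof.
exists (fun x => \row_j hcoord x (j == 1)).
  by move=> [a b] x y; apply/rowP => j; rewrite !mxE /hcoord;
     case: (j == 1); simpc; congr (_ +i* _)%C => /=; ring.
exists (fun v : 'rV[R[i]]_2 => Quat (complex.Re (v 0 0)) (complex.Im (v 0 0))
                      (complex.Re (v 0 1)) (complex.Im (v 0 1))).
  by move=> x; apply: quat_eqP; rewrite !mxE.
move=> v; apply/rowP => j; rewrite mxE /hcoord.
have [->|->] : j = 0 \/ j = 1.
  by case: j => -[|[|//]] lj; [left|right]; apply: val_inj.
- by case: (v 0 0).
- by case: (v 0 1).
Qed.

HB.instance Definition _ := Lmodule_hasFinDim.Build R[i] (quat R)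
  quat_vect_axiom.

Definition qconj x : quat R := Quat (q0 x) (- q1 x) (- q2 x) (- q3 x).

Definition qdot x y : R :=
  q0 x * q0 y + q1 x * q1 y + q2 x * q2 y + q3 x * q3 y.

Definition qe (i : nat) : quat R :=
  Quat (i == 0)%:R (i == 1)%:R (i == 2)%:R (i == 3)%:R.

Definition qcoord x (i : 'I_4) : R := tnth [tuple q0 x; q1 x; q2 x; q3 x] i.

(* Coordinatewise extension of an operator on real-valued functions
   (derivative, limit, integral) to quaternion-valued ones. *)
Definition coordwise (T : Type) (L : (T -> R) -> R) (g : T -> quat R) : quat R :=
  Quat (L (q0 \o g)) (L (q1 \o g)) (L (q2 \o g)) (L (q3 \o g)).

Definition qderive (g : R -> quat R) (t : R) : quat R :=
  coordwise (fun f => f^`()%classic t) g.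

Definition qexp x : quat R :=
  coordwise (fun f => limn (series f)) (fun n => qreal (n`!%:R^-1) * x ^+ n).

End QuatRing.

Section Sp1.
Variable R : realType.

Record Sp1 := MkSp1 { spval :> quat R; _ : qdot spval spval == 1 }.

HB.instance Definition _ := [isSub for spval].
HB.instance Definition _ := [Choice of Sp1 by <:].

Implicit Types x y : Sp1.

Lemma qdotM (x y : quat R) : qdot (x * y) (x * y) = qdot x x * qdot y y.
Proof. by rewrite /qdot /=; ring. Qed.

Lemma spP x : qdot (spval x) (spval x) = 1.
Proof. exact/eqP/(valP x). Qed.

Fact sp_one_subproof : qdot (1 : quat R) 1 == 1.
Proof. by apply/eqP; rewrite /qdot /=; ring. Qed.
Fact sp_mul_subproof x y : qdot (spval x * spval y) (spval x * spval y) == 1.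
Proof. by rewrite qdotM !spP mulr1. Qed.
Fact sp_inv_subproof x : qdot (qconj x) (qconj x) == 1.
Proof. by rewrite -(spP x) /qdot /=; apply/eqP; ring. Qed.

Definition sp_one := MkSp1 sp_one_subproof.
Definition sp_mul x y := MkSp1 (sp_mul_subproof x y).
Definition sp_inv x := MkSp1 (sp_inv_subproof x).

Fact sp_mulA : associative sp_mul.
Proof. by move=> x y z; apply: val_inj; rewrite /= mulrA. Qed.
Fact sp_mul1 : left_id sp_one sp_mul.
Proof. by move=> x; apply: val_inj; rewrite /= mul1r. Qed.
Fact sp_1mul : right_id sp_one sp_mul.
Proof. by move=> x; apply: val_inj; rewrite /= mulr1. Qed.
Fact sp_mulV : left_inverse sp_one sp_inv sp_mul.
Proof.
move=> x; apply: val_inj; have := spP x; rewrite /qdot => hx.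
by apply: quat_eqP => /=; rewrite -?hx; ring.
Qed.
Fact sp_Vmul : right_inverse sp_one sp_inv sp_mul.
Proof.
move=> x; apply: val_inj; have := spP x; rewrite /qdot => hx.
by apply: quat_eqP => /=; rewrite -?hx; ring.
Qed.

HB.instance Definition _ := isGroup.Build Sp1
  sp_mulA sp_mul1 sp_1mul sp_mulV sp_Vmul.

Lemma spvalM x y : spval (x * y)%g = spval x * spval y.
Proof. by []. Qed.
Lemma spvalV x : spval x^-1%g = qconj x.
Proof. by []. Qed.

Lemma qexpE (t : R) (i : 'I_3) :
  qexp (qreal t * qe R i.+1) = qreal (cos t) + qreal (sin t) * qe R i.+1.
Proof.
have sqe : qe R i.+1 * qe R i.+1 = -1.
  by case: i => -[|[|[|//]]] ?; apply: quat_eqP => /=; ring.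
have qrM a b : qreal (a * b) = qreal a * qreal b :> quat R.
  by apply: quat_eqP => /=; ring.
have qrC a (x : quat R) : x * qreal a = qreal a * x :> quat R.
  by apply: quat_eqP => /=; ring.
set u := qe R i.+1 in sqe *.
have powE n : qreal (n`!%:R^-1) * (qreal t * u) ^+ n =
    qreal (cos_coeff t n) + qreal (sin_coeff t n) * u.
  have even m : (qreal t * u) ^+ m.*2 = qreal ((-1) ^+ m * t ^+ m.*2).
    elim: m => [|m IH]; first by rewrite !expr0 mulr1.
    have sq : (qreal t * u) ^+ 2 = - qreal (t ^+ 2).
      rewrite expr2 -mulrA (mulrA u) qrC -(mulrA _ u) sqe !mulrN1 mulrN.
      by rewrite -qrM.
    rewrite doubleS -addn2 !exprD IH sq (exprS (-1) m).
    by apply: quat_eqP => /=; ring.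
  have cE : cos_coeff t n = n`!%:R^-1 * ((~~ odd n)%:R * (-1) ^+ n./2 * t ^+ n).
    by rewrite /cos_coeff mulrC.
  have sE : sin_coeff t n = n`!%:R^-1 * ((odd n)%:R * (-1) ^+ n.-1./2 * t ^+ n).
    by rewrite /sin_coeff mulrC.
  rewrite cE sE !(qrM n`!%:R^-1) -(mulrA (qreal _)) -mulrDr; congr (_ * _).
  rewrite -{1}(odd_double_half n); case: (boolP (odd n)) => on /=.
    have nE : n = n./2.*2.+1 by rewrite -{1}(odd_double_half n) on.
    have -> : n.-1./2 = n./2 by rewrite [in LHS]nE /= doubleK.
    have tn : t ^+ n = t ^+ n./2.*2.+1 by rewrite -nE.
    rewrite add1n exprS even tn exprS; move: n./2 => m.
    by apply: quat_eqP => /=; ring.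
  have nE : n = n./2.*2 by rewrite -{1}(odd_double_half n) (negbTE on).
  have tn : t ^+ n = t ^+ n./2.*2 by rewrite -nE.
  rewrite add0n even tn; move: n./2 => m.
  by apply: quat_eqP => /=; ring.
have serE (f g : R ^nat) : f =1 g -> limn (series f) = limn (series g).
  by move=> /funext ->.
have ser0 (f : R ^nat) : f =1 (fun=> 0) -> limn (series f) = 0.
  move=> /serE ->; rewrite (_ : series _ = fun=> 0) ?lim_cst//.
  by apply/funext => n; rewrite /series /= big1.
rewrite /qexp /coordwise cos.unlock sin.unlock.
case: i @u sqe powE => -[|[|[|//]]] ? u _ powE.
- rewrite (serE (q0 \o _) (cos_coeff t)) ?(serE (q1 \o _) (sin_coeff t));
    rewrite ?(ser0 (q2 \o _)) ?(ser0 (q3 \o _));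
    first by apply: quat_eqP => /=; ring.
  + by move=> n; apply: (etrans (congr1 q3 (powE n))) => /=; ring.
  + by move=> n; apply: (etrans (congr1 q2 (powE n))) => /=; ring.
  + by move=> n; apply: (etrans (congr1 q1 (powE n))) => /=; ring.
  + by move=> n; apply: (etrans (congr1 q0 (powE n))) => /=; ring.
- rewrite (serE (q0 \o _) (cos_coeff t)) ?(serE (q2 \o _) (sin_coeff t));
    rewrite ?(ser0 (q1 \o _)) ?(ser0 (q3 \o _));
    first by apply: quat_eqP => /=; ring.
  + by move=> n; apply: (etrans (congr1 q3 (powE n))) => /=; ring.
  + by move=> n; apply: (etrans (congr1 q1 (powE n))) => /=; ring.
  + by move=> n; apply: (etrans (congr1 q2 (powE n))) => /=; ring.
  + by move=> n; apply: (etrans (congr1 q0 (powE n))) => /=; ring.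
- rewrite (serE (q0 \o _) (cos_coeff t)) ?(serE (q3 \o _) (sin_coeff t));
    rewrite ?(ser0 (q1 \o _)) ?(ser0 (q2 \o _));
    first by apply: quat_eqP => /=; ring.
  + by move=> n; apply: (etrans (congr1 q2 (powE n))) => /=; ring.
  + by move=> n; apply: (etrans (congr1 q1 (powE n))) => /=; ring.
  + by move=> n; apply: (etrans (congr1 q3 (powE n))) => /=; ring.
  + by move=> n; apply: (etrans (congr1 q0 (powE n))) => /=; ring.
Qed.

Fact sp_exp_subproof (i : 'I_3) (t : R) :
  let x := qexp (qreal t * qe R i.+1) in qdot x x == 1.
Proof.
apply/eqP; rewrite /= qexpE -(cos2Dsin2 t) !expr2.
by case: i => -[|[|[|//]]] ?; rewrite /qdot /=; ring.
Qed.

(* exp (t e_(i+1)), for i = 0, 1, 2 *)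
Definition sp_exp (i : 'I_3) (t : R) : Sp1 := MkSp1 (sp_exp_subproof i t).

(* Hopf coordinates on S^3.  They restrict to a chart on
   ]0, pi/2[ * ]0, 2 pi[ * ]0, 2 pi[ whose image has a complement of
   measure zero. *)
Definition hopf_quat (a b c : R) : quat R :=
  Quat (cos a * cos b) (cos a * sin b) (sin a * cos c) (sin a * sin c).

Fact hopf_subproof a b c : qdot (hopf_quat a b c) (hopf_quat a b c) == 1.
Proof.
apply/eqP; rewrite /qdot /=.
rewrite [LHS](_ : _ = cos a ^+ 2 * (cos b ^+ 2 + sin b ^+ 2) +
  sin a ^+ 2 * (cos c ^+ 2 + sin c ^+ 2)); last by ring.
by rewrite !cos2Dsin2 !mulr1 cos2Dsin2.
Qed.

Definition hopf a b c : Sp1 := MkSp1 (hopf_subproof a b c).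

Definition hopf_tangent a b c (i : 'I_3) : quat R :=
  tnth [tuple qderive (fun a' => hopf_quat a' b c) a;
              qderive (fun b' => hopf_quat a b' c) b;
              qderive (fun c' => hopf_quat a b c') c] i.

(* Riemannian volume density of the metric induced from H = R^4 *)
Definition hopf_density a b c : R :=
  Num.sqrt (\det (\matrix_(i, j)
    qdot (hopf_tangent a b c i) (hopf_tangent a b c j))).

(* Integral against the Riemannian volume, computed in the Hopf chart; the
   iterated form is legitimate for the continuous integrands used here. *)
Definition sp_int (f : Sp1 -> R) : R :=
  \int[@lebesgue_measure R]_(a in `[0, pi / 2])
    \int[@lebesgue_measure R]_(b in `[0, pi *+ 2])
      \int[@lebesgue_measure R]_(c in `[0, pi *+ 2])
        (f (hopf a b c) * hopf_density a b c).

Implicit Types (s t : Sp1) (sigma tau : Sp1 -> quat R).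

Definition L2prod sigma tau : quat R :=
  coordwise sp_int (fun x => qconj (sigma x) * tau x).

Definition act_beta s t sigma : Sp1 -> quat R := fun x => sigma (t^-1 * x * s)%g.

(* The index i : 'I_3 stands for the left-invariant field of e_(i+1);
   this is d sigma applied to that field. *)
Definition left_deriv (i : 'I_3) sigma : Sp1 -> quat R :=
  fun x => qderive (fun r : R => sigma (x * sp_exp i r)%g) 0.

Definition clifford (i : 'I_3) sigma : Sp1 -> quat R :=
  fun x => - (sigma x * qe R i.+1).

Definition spin_connection (i : 'I_3) sigma : Sp1 -> quat R :=
  fun x => left_deriv i sigma x - qreal (1 / 2) * (sigma x * qe R i.+1).

Definition dirac_op sigma : Sp1 -> quat R :=
  fun x => \sum_(i < 3) clifford i (spin_connection i sigma) x.

Lemma diracE sigma x :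
  dirac_op sigma x = - (\sum_(i < 3) left_deriv i sigma x * qe R i.+1)
                  - qreal (3 / 2) * sigma x.
Proof.
have sqe (i : 'I_3) : qe R i.+1 * qe R i.+1 = -1.
  by case: i => -[|[|[|//]]] ?; apply: quat_eqP => /=; ring.
have cE i : clifford i (spin_connection i sigma) x =
    - (left_deriv i sigma x * qe R i.+1) - qreal (1 / 2) * sigma x.
  rewrite /clifford /spin_connection mulrBl -mulrA -(mulrA (sigma x)) sqe.
  by rewrite mulrN1 mulrN opprB addrC.
rewrite /dirac_op; under eq_bigr => i _ do rewrite cE.
rewrite sumrB sumrN sumr_const card_ord -mulrnAl; congr (_ - _ * _).
by apply: quat_eqP => /=; field.
Qed.

(* H^4_k: restrictions to S^3 of harmonic homogeneous polynomials *)
Definition harmonic_poly (k : nat) : set (Sp1 -> R) :=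
  [set f | exists p : mpoly 4 R,
    [/\ p \is ishomog1 k mdeg,
        \sum_(i < 4) mderiv i (mderiv i p) = 0 &
        forall x : Sp1, f x = meval (qcoord x) p]].

(* V_k, with h (x) f in H (x)_R H^4_k seen as the function x |-> f(x) h *)
Definition Vspace (k : nat) : set (Sp1 -> quat R) :=
  [set sigma | exists n (h : 'I_n -> quat R) (f : 'I_n -> Sp1 -> R),
    (forall j, harmonic_poly k (f j)) /\
    (forall x, sigma x = \sum_j qreal (f j x) * h j)].

End Sp1.

(* Tensor powers of H_1 in coordinates: [tpow k] is the space of coordinates
   of k-tensors with respect to the basis made of the products of e0's
   (false) and e2's (true). *)

Section Tensors.
Variables (R : realType) (k : nat).

Definition midx := {ffun 'I_k -> bool}.
Definition tpow := {ffun midx -> R[i]}.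

Definition hbasis (b : bool) : quat R := if b then qe R 2 else qe R 0.

Definition pure (x : 'I_k -> quat R) : tpow :=
  [ffun J : midx => \prod_i hcoord (x i) (J i)].

Definition pure_basis (J : midx) : tpow := pure (fun i => hbasis (J i)).

Lemma pure_basisE (J I : midx) : pure_basis J I = (I == J)%:R.
Proof.
have hb b c : hcoord (hbasis b) c = (b == c)%:R.
  by case: b; case: c.
rewrite ffunE; case: eqP => [->|/eqP neq].
  by rewrite big1 // => i _; rewrite hb eqxx.
have [i /negPf di] : exists i, J i != I i.
  apply/existsP; rewrite -negb_forall; apply: contra neq => /forallP e.
  by apply/eqP/ffunP => i; rewrite (eqP (e i)).
by rewrite (bigD1 i) //= hb di mul0r.
Qed.

(* H_k *)
Definition sym_tensor : set tpow :=
  [set w | forall (pi : 'S_k) (J : midx), w [ffun i => J (pi i)] = w J].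

(* s . (x_1 (x) ... (x) x_k) = x_1 s^-1 (x) ... (x) x_k s^-1,
   extended complex linearly from the basis *)
Definition rep (s : Sp1 R) (w : tpow) : tpow :=
  \sum_J w J *: pure (fun i => hbasis (J i) * spval s^-1%g).

(* |d> *)
Definition ket (d : nat) : tpow :=
  k`!%:R^-1 *: \sum_(pi : 'S_k)
    pure (fun i => if (pi i < k - d)%N then qe R 0 else qe R 2).

Definition tens2 (u v : tpow) : {ffun midx * midx -> R[i]} :=
  [ffun K => u K.1 * v K.2].

(* The space H (x)_C (tpow (x)_C tpow): a tensor is written uniquely as the
   sum over the basis tensors w_K of f(K) (x) w_K, with f(K) in H. *)
Definition htens := {ffun midx * midx -> quat R}.

Definition tens (h : quat R) (w : {ffun midx * midx -> R[i]}) : htens :=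
  [ffun K => w K *: h].

(* H (x)_C (H_k (x)_C H_k) inside H (x)_C (tpow (x)_C tpow): finite sums of
   h (x) (u (x) v) with u, v in H_k *)
Definition Wspace : set htens :=
  [set f | exists n (h : 'I_n -> quat R) (u v : 'I_n -> tpow),
    [/\ forall j, sym_tensor (u j), forall j, sym_tensor (v j) &
        f = \sum_j tens (h j) (tens2 (u j) (v j))]].

Definition hmulr (f : htens) (h : quat R) : htens := [ffun K => f K * h].

Definition hprod (f g : htens) : quat R := \sum_K qconj (f K) * g K.

Definition hermitian (I : finType) (u v : {ffun I -> R[i]}) : R[i] :=
  \sum_i (u i)^*%C * v i.

(* complex Hermitian metric for which e0, e2 are orthonormal in H *)
Definition hdot (f g : htens) : R[i] :=
  \sum_K \sum_b (hcoord (f K) b)^*%C * hcoord (g K) b.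

(* extended from the basis tensors; see act_gamma_tens *)
Definition act_gamma (s t : Sp1 R) (f : htens) : htens :=
  \sum_K tens (f K)
    (tens2 (rep s (pure_basis K.1)) (rep t (pure_basis K.2))).

Lemma tens_balanced (c : R[i]) h w : tens (c *: h) w = tens h (c *: w).
Proof.
by apply/ffunP => K; rewrite !ffunE scalerA mulrC; congr (_ *: _).
Qed.

Lemma hmulr_tens h h' w : hmulr (tens h w) h' = tens (h * h') w.
Proof. by apply/ffunP => K; rewrite !ffunE; exact/esym/qmulA. Qed.

Lemma hprod_tens h w h' w' :
  hprod (tens h w) (tens h' w') = qconj h * qcplx (hermitian w w') * h'.
Proof.
rewrite /hprod /hermitian.
have cD : {morph @qcplx R : x y / x + y}.
  by move=> [a b] [c d]; apply: quat_eqP => /=; ring.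
have c0 : qcplx 0 = 0 :> quat R by apply: quat_eqP.
rewrite (big_morph _ cD c0) mulr_sumr mulr_suml; apply: eq_bigr => K _.
rewrite !ffunE; case: (w K) (w' K) => [a b] [c d].
by apply: quat_eqP => /=; ring.
Qed.

Lemma hdot_tens h w h' w' :
  hdot (tens h w) (tens h' w') =
  (\sum_b (hcoord h b)^*%C * hcoord h' b) * hermitian w w'.
Proof.
rewrite /hdot /hermitian mulr_sumr; apply: eq_bigr => K _.
rewrite mulr_suml; apply: eq_bigr => b _; rewrite !ffunE.
case: (w K) (w' K) => [x y] [z t].
by case: b; rewrite /hcoord /=; simpc; congr (_ +i* _)%C; ring.
Qed.

Lemma act_gamma_tens s t h u v :
  act_gamma s t (tens h (tens2 u v)) = tens h (tens2 (rep s u) (rep t v)).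
Proof.
have repb r J : rep r (pure_basis J) =
    pure (fun i => hbasis (J i) * spval r^-1%g).
  rewrite /rep (bigD1 J) //= pure_basisE eqxx scale1r big1 ?addr0 //.
  by move=> I /negPf neq; rewrite pure_basisE neq scale0r.
rewrite /act_gamma; apply/ffunP => L; rewrite sum_ffunE !ffunE.
under eq_bigr => K _ do rewrite !ffunE !repb scalerA.
rewrite -scaler_suml; congr (_ *: _).
rewrite /rep !sum_ffunE mulr_suml; under [RHS]eq_bigr => I _ do rewrite mulr_sumr.
rewrite pair_bigA /=; apply: eq_bigr => K _; rewrite !ffunE.
by rewrite mulrC mulrACA.
Qed.

Definition ket_tens (h : quat R) (p q : nat) : htens :=
  tens h (tens2 (ket p) (ket q)).

Definition upper_eigenvectors : seq htens :=
  [seq ket_tens (qe R 0) p q - ket_tens (qe R 2) p.-1 q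
     | p <- iota 1 k, q <- iota 0 k.+1].

Definition lower_eigenvectors : seq htens :=
  [seq (p%:R - k%:R - 1) *: ket_tens (qe R 0) p q -
       p%:R *: ket_tens (qe R 2) p.-1 q
     | p <- iota 1 k, q <- iota 0 k.+1] ++
  [seq ket_tens (qe R 0) 0 q | q <- iota 0 k.+1] ++
  [seq ket_tens (qe R 2) k q | q <- iota 0 k.+1].

(* Phi : V_k -> H (x)_C (H_k (x)_C H_k); only its values on V_k matter. *)
Record intertwining_isometry (Phi : (Sp1 R -> quat R) -> htens) : Prop := {
  phi_bij : set_bij (@Vspace R k) Wspace Phi;
  phi_add : forall sigma tau, Vspace k sigma -> Vspace k tau ->
    Phi (fun x => sigma x + tau x) = Phi sigma + Phi tau;
  phi_mulr : forall sigma h, Vspace k sigma ->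
    Phi (fun x => sigma x * h) = hmulr (Phi sigma) h;
  phi_isometry : forall sigma tau, Vspace k sigma -> Vspace k tau ->
    hprod (Phi sigma) (Phi tau) = L2prod sigma tau;
  phi_equivariant : forall s t sigma, Vspace k sigma ->
    Phi (act_beta s t sigma) = act_gamma s t (Phi sigma) }.

(* Phi o D o Phi^-1 *)
Definition dirac_transport (Phi : (Sp1 R -> quat R) -> htens) (w : htens) : htens :=
  Phi (dirac_op (pinv_ (fun=> (fun=> 0)) (@Vspace R k) Phi w)).

End Tensors.

(* Main.v *)
From HB Require Import structures.
Require Import Defs.
From mathcomp Require Import all_boot all_order all_algebra all_fingroup.
From mathcomp Require Import ring lra zify.
From mathcomp Require mpoly.
(* The notations of mpoly clash with those of the analysis library. *)
Import -(notations) mpoly.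
From mathcomp Require Import all_classical all_reals all_analysis.
From mathcomp Require Import complex.

(** The spinors in V_k are matrix coefficients. Let omega be the symplectic form
    of H = C^2 that Sp(1) preserves. The Peter-Weyl map Psi sends
    h (x) u (x) v, with u and v symmetric tensors of degree k, to the spinor
    x |-> omega (u x^-1, v) h; it is right H-linear and intertwines gamma with
    beta by the invariance of omega (Psi_act).

    A pair of symmetric tensors has coefficients g p q that depend only on the two
    weights, the numbers of factors e2. On such tensors Psi is the evaluation of
    a polynomial hpoly k g, a sum of products of k linear forms in the real
    coordinates of x. It is harmonic (laplacian_hpoly), because the forms are
    isotropic and the tensor is symmetric. Conversely every harmonic homogeneous
    polynomial of degree k is of this form (harmonic_hpoly): such a polynomial is
    determined by (k + 1)^2 of its coefficients, and hpoly k is injective on a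
    space of that dimension. Hence Psi maps onto V_k (VspaceP).

    Up to a positive factor Psi is an isometry (L2prod_Psi). Instead of Schur
    orthogonality, the proof uses the divergence theorem on the unit ball as a
    recursion on the moments of the sphere (sphere_moment_rec), read off from
    trigonometric integrals in Hopf coordinates. For products of harmonic
    polynomials it lowers the degree (moment_harmonic), and an induction gives
    the L2 product (moment_hpoly). Rescaling the inverse of Psi yields Phi.

    Now let Phi be any intertwining isometry. By right H-linearity its inverse is
    given by finitely many fixed spinors (Phi_inverse), so its equivariance can be
    differentiated along one-parameter subgroups: the left-invariant derivatives
    correspond to the infinitesimal action on the first factor H_k
    (Phi_left_deriv). Thus Phi transports the Dirac operator to an explicit
    operator that preserves the span of e0 (x) |p>|q> and e2 (x) |p-1>|q>
    (Phi_dirac), a plane for 0 < p <= k and a line for p = 0 and p = k + 1. The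
    listed vectors are the eigenvectors of these blocks (blockv_eigen). They are
    orthogonal for binomial reasons (kappa_rel, eigvec_orthogonal), hence free,
    and they span every block (span_eigenvectors). *)

Set Implicit Arguments.
Unset Strict Implicit.
Unset Printing Implicit Defensive.

Import Order.TTheory GRing.Theory Num.Theory.
Import numFieldNormedType.Exports.

Local Open Scope classical_set_scope.
Local Open Scope ring_scope.

(** * Linear functionals on polynomials given by their moments *)

(* If g lists the coefficients of a tensor by its two weights, then wshift g a b
   does so for the part whose first factors are the basis vectors a and b. *)
Local Notation wshift g a b := (fun p q => g (nat_of_bool a + p)%N (nat_of_bool b + q)%N).

(* Locked, so that unification does not unfold the support of a polynomial. *)
HB.lock Definition momentf n (C : fieldType) (mu : multinom n -> C)
  (p : mpoly n C) : C := \sum_(m <- msupp p) mcoeff m p * mu m.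

Section Moments.
Variables (n : nat) (C : fieldType) (mu : multinom n -> C).
Implicit Types p q : mpoly n C.
Local Notation momentf := (momentf mu).

Lemma momentf_wide (s : seq (multinom n)) p : uniq s -> {subset msupp p <= s} ->
  momentf p = \sum_(m <- s) mcoeff m p * mu m.
Proof.
move=> us sub; rewrite momentf.unlock [RHS](bigID (fun m => m \in msupp p)) /=.
rewrite [X in _ + X]big1 ?addr0; last first.
  by move=> m /memN_msupp_eq0 ->; rewrite mul0r.
rewrite -[RHS]big_filter; apply: perm_big; apply: uniq_perm.
- exact: msupp_uniq.
- exact: filter_uniq.
- move=> m; rewrite mem_filter; case: (boolP (m \in msupp p)) => //= /sub.
  by move->.
Qed.

Lemma momentf_is_linear : linear_for *%R momentf.
Proof.
move=> c p q.
pose s := undup (msupp p ++ msupp q ++ msupp (c *: p + q)).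
have us : uniq s by exact: undup_uniq.
rewrite !(@momentf_wide s) //; try by
  move=> m mp; rewrite mem_undup !mem_cat mp ?orbT.
rewrite mulr_sumr -big_split /=; apply: eq_bigr => m _.
by rewrite mcoeffD mcoeffZ mulrDl mulrA.
Qed.

HB.instance Definition _ :=
  GRing.isLinear.Build C (mpoly n C) C *%R momentf momentf_is_linear.

Lemma momentfX m : momentf (mpolyX C m) = mu m.
Proof.
by rewrite momentf.unlock msuppX big_seq1 mcoeffX eqxx mul1r.
Qed.

Lemma momentfD p q : momentf (p + q) = momentf p + momentf q.
Proof. exact: raddfD. Qed.

Lemma momentfB p q : momentf (p - q) = momentf p - momentf q.
Proof. exact: raddfB. Qed.

Lemma momentf_sum (J : Type) (r : seq J) (F : J -> mpoly n C) :
  momentf (\sum_(j <- r) F j) = \sum_(j <- r) momentf (F j).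
Proof. exact: raddf_sum. Qed.

End Moments.

(** The recursion on the moments is the divergence theorem: for integration
    over the unit sphere of R^n the constant is d0 = n - 1, and it is used below
    with n = 4. *)
Section Divergence.
Variables (n : nat) (C : fieldType) (mu : multinom n -> C) (d0 : nat).
Hypothesis mu_rec : forall i m,
  (mdeg m + d0)%:R * mu (mnm_add (mnm1 i) m) = (m i)%:R * mu (mnm_sub m (mnm1 i)).
Local Notation I := (momentf mu).
Local Notation "'homog' d" := (@ishomog1 n C d (@mdeg n)) (at level 10).
Local Notation X i := (mpolyX C (mnm1 i)).
Implicit Types p q : mpoly n C.

Lemma mpoly_homog_ind d (K : mpoly n C -> Prop) :
  K 0 -> (forall c p q, K p -> K q -> K (c *: p + q)) ->
  (forall m, mdeg m = d -> K (mpolyX C m)) ->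
  forall p, p \is homog d -> K p.
Proof.
move=> K0 KD KX p /dhomogP hp; rewrite (mpolyE p) big_seq.
apply: (big_ind K) => //.
- by move=> x y Kx Ky; rewrite -(scale1r x); apply: KD.
- by move=> m /hp hm; rewrite -[_ *: _]addr0; apply: KD => //; apply: KX.
Qed.

Lemma mderiv_homog d i p : p \is homog d.+1 -> mderiv i p \is homog d.
Proof.
move=> hp; apply/dhomogP => m; rewrite mcoeff_msupp mcoeff_mderiv => nz.
have : mdeg (mnm_add m (mnm1 i)) = d.+1.
  apply: (dhomog_mf hp); rewrite mcoeff_msupp.
  by apply: contra nz => /eqP ->; rewrite mul0rn.
by rewrite mdegD mdeg1 addn1 => -[].
Qed.

Lemma euler d p : p \is homog d -> \sum_i X i * mderiv i p = d%:R *: p.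
Proof.
move: p; apply: mpoly_homog_ind.
- by rewrite scaler0 big1 // => i _; rewrite linear0 mulr0.
- move=> c p q hp hq.
  rewrite (eq_bigr (fun i => c *: (X i * mderiv i p) + X i * mderiv i q)).
    by rewrite big_split /= -scaler_sumr hp hq scalerDr !scalerA mulrC.
  by move=> i _; rewrite linearP /= mulrDr scalerAr.
move=> m <-; rewrite (eq_bigr (fun i => (m i)%:R *: mpolyX C m)); last first.
  move=> i _; rewrite mderivX -scalerAr -mpolyXD.
  have [->|mi] := posnP (m i); first by rewrite !scale0r.
  congr (_ *: mpolyX C _); apply/mnmP => j; rewrite mnmDE mnmBE mnm1E.
  by case: eqP => [<-|_]; rewrite ?subnKC// add0n subn0.
by rewrite -scaler_suml -natr_sum mdegE.
Qed.

Lemma moment_divergence d i p : p \is homog d ->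
  (d + d0)%:R * I (X i * p) = I (mderiv i p).
Proof.
move: p; apply: mpoly_homog_ind.
- by rewrite mulr0 !linear0 mulr0.
- move=> c p q hp hq; rewrite mulrDr -scalerAr !linearP /= -hp -hq.
  by rewrite mulrDr mulrCA.
move=> m <-; rewrite -mpolyXD momentfX mu_rec mderivX linearZ /=.
by rewrite momentfX.
Qed.

Definition laplacian p := \sum_i mderiv i (mderiv i p).

(** Apply Euler to p, then integrate by parts the products of the variables with
    the derivatives of p: the second derivatives of p add up to its Laplacian. *)
Lemma moment_harmonic d p q : p \is homog d.+1 -> q \is homog d.+1 ->
  laplacian p = 0 ->
  (d.+1 * (d + d.+1 + d0))%:R * I (p * q) = \sum_i I (mderiv i p * mderiv i q).
Proof.
move=> hp hq Lp; have hpi i := mderiv_homog i hp.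
have -> : (d.+1 * (d + d.+1 + d0))%:R * I (p * q) =
    I ((d.+1%:R *: p) * q) * (d + d.+1 + d0)%:R.
  by rewrite -scalerAl linearZ /= natrM mulrAC.
rewrite -(euler hp).
rewrite [_ * q]mulr_suml raddf_sum /= mulr_suml.
under [LHS]eq_bigr => i _.
  rewrite -mulrA mulrC (moment_divergence _ (dhomogM (hpi i) hq)).
  rewrite mderivM linearD /=; over.
rewrite big_split /= -raddf_sum -mulr_suml -/(laplacian p) Lp mul0r.
rewrite raddf0.
by rewrite add0r.
Qed.
End Divergence.

(** * The harmonic polynomials attached to pairs of symmetric tensors *)

Lemma mderiv_sum n (K : nzRingType) (i : 'I_n) (J : Type) (r : seq J)
    (Q : pred J) (F : J -> mpoly n K) :
  mderiv i (\sum_(j <- r | Q j) F j) = \sum_(j <- r | Q j) mderiv i (F j).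
Proof. exact: raddf_sum. Qed.

(** Coefficients, in the real coordinates of x, of the linear form
    omega (a x^-1, b), where a and b are basis vectors of C^2 and omega is its
    symplectic form; see meval_mform. *)
HB.lock Definition mform_coef (R : realType) (a b : bool) (i : 'I_4) : R[i] :=
  (nth 0 (if a then (if b then [:: 0; 0; 1; 0] else [:: -1; 0; 0; 0])
          else (if b then [:: 1; 0; 0; 0] else [:: 0; 0; 1; 0])) i +i*
   nth 0 (if a then (if b then [:: 0; 0; 0; -1] else [:: 0; -1; 0; 0])
          else (if b then [:: 0; -1; 0; 0] else [:: 0; 0; 0; 1])) i)%C.

HB.lock Definition conj_mpoly (R : realType) (p : mpoly 4 R[i]) : mpoly 4 R[i] :=
  map_mpoly (@conjc R) p.

Section Harmonics.
Variable R : realType.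
Local Notation C := R[i].
Local Notation "'homog' d" := (@ishomog1 4 C d (@mdeg 4)) (at level 10).
Local Notation xi_ i := (mpolyX C (mnm1 i)).
Implicit Types (g h : nat -> nat -> C).

Local Notation mform_coef := (mform_coef R).

Definition mform a b : mpoly 4 C := \sum_i mform_coef a b i *: xi_ i.

(** The polynomial x |-> omega (u x^-1, v), extended linearly to the tensors with
    coefficients g, by recursion on the number of factors; see sum_weight. *)
Fixpoint hpoly k g : mpoly 4 C :=
  if k is k'.+1 then
    \sum_a \sum_b mform a b * hpoly k' (wshift g a b)
  else mpolyC 4 (g 0 0)%N.

Lemma mderiv_mform a b i : mderiv i (mform a b) = mpolyC 4 (mform_coef a b i).
Proof.
rewrite /mform mderiv_sum (bigD1 i) //= big1 => [|j /negPf ji]; last first.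
  by rewrite mderivZ mderivX mnm1E ji scale0r scaler0.
rewrite addr0 mderivZ mderivX mnm1E eqxx scale1r -mul_mpolyC.
rewrite (_ : mnm_sub _ _ = mnm0) ?mpolyX0 ?mulr1 //.
by apply/mnmP => j; rewrite mnmBE subnn mnm0E.
Qed.

Lemma mform_homog a b : mform a b \is homog 1.
Proof. by apply: rpred_sum => i _; apply: rpredZ; rewrite dhomogX /=; apply/eqP/mdeg1. Qed.

Arguments hpoly : simpl nomatch.

Lemma eq_hpoly k g h : (forall p q, (p <= k)%N -> (q <= k)%N -> g p q = h p q) ->
  hpoly k g = hpoly k h.
Proof.
elim: k g h => [|k IH] g h e /=; first by rewrite e.
apply: eq_bigr => a _; apply: eq_bigr => b _; congr (_ * _); apply: IH => p q hp hq.
by apply: e; [case: a|case: b]; rewrite ?add0n ?add1n // leqW.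
Qed.

Lemma hpolyP k c g h :
  hpoly k (fun p q => c * g p q + h p q) = c *: hpoly k g + hpoly k h.
Proof.
elim: k g h => [|k IH] g h /=; first by rewrite mpolyCD mpolyCM mul_mpolyC.
rewrite scaler_sumr -big_split /=; apply: eq_bigr => a _.
rewrite scaler_sumr -big_split /=; apply: eq_bigr => b _.
by rewrite IH mulrDr scalerAr.
Qed.

Lemma hpoly_homog k g : hpoly k g \is homog k.
Proof.
elim: k g => [|k IH] g /=.
  by rewrite -[mpolyC _ _]mulr1 mul_mpolyC rpredZ // dhomog1.
apply: rpred_sum => a _; apply: rpred_sum => b _.
by rewrite -(add1n k); apply: dhomogM (mform_homog _ _) (IH _).
Qed.

(** By symmetry each of the factors contributes the same term. *)
Lemma mderiv_hpoly k g i : mderiv i (hpoly k.+1 g) =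
  k.+1%:R *: \sum_a \sum_b mform_coef a b i *: hpoly k (wshift g a b).
Proof.
have st j h : mderiv i (hpoly j.+1 h) =
    \sum_a \sum_b mform_coef a b i *: hpoly j (wshift h a b) +
    \sum_a \sum_b mform a b * mderiv i (hpoly j (wshift h a b)).
  rewrite mderiv_sum -big_split /=; apply: eq_bigr => a _.
  rewrite mderiv_sum -big_split /=; apply: eq_bigr => b _.
  by rewrite mderivM mderiv_mform mul_mpolyC.
elim: k g => [|k IH] g; rewrite st.
  rewrite scale1r [X in _ + X]big1 ?addr0 // => a _; rewrite big1 // => b _.
  by rewrite /= mderivC mulr0.
rewrite -[in RHS]natr1 scalerDl scale1r addrC; congr (_ + _).
under eq_bigr => a _ do under eq_bigr => b _ do
  rewrite IH -scalerAr mulr_sumr.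
rewrite scaler_sumr.
under eq_bigr => a _ do rewrite -scaler_sumr exchange_big /=.
rewrite -!scaler_sumr; congr (_ *: _).
rewrite exchange_big /=; apply: eq_bigr => c _.
under eq_bigr => a _ do under eq_bigr => b _ do rewrite mulr_sumr.
under eq_bigr => a _ do rewrite exchange_big /=.
rewrite exchange_big /=; apply: eq_bigr => d _.
rewrite scaler_sumr; apply: eq_bigr => a _.
rewrite scaler_sumr; apply: eq_bigr => b _.
rewrite -scalerAr; congr (_ *: (_ * _)); apply: eq_hpoly => p q _ _.
by rewrite !addnA (addnC c) (addnC d).
Qed.

Lemma big_ord4 (V : nmodType) (F : 'I_4 -> V) :
  \sum_i F i = F 0 + F 1 + F 2 + F 3.
Proof.
rewrite !big_ord_recl big_ord0 addr0 !addrA.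
by congr (F _ + F _ + F _ + F _); apply: val_inj.
Qed.

(** The determinant of the matrix of the forms is the squared norm of R^4; dually,
    the complex bilinear dot product of two of them is twice the product of the
    antisymmetric forms in the two indices. *)
Lemma mform_isotropic a b c d : \sum_i mform_coef a b i * mform_coef c d i =
  ((-1) ^+ (a (+) b) * (a != c)%:R * (b != d)%:R) *+ 2.
Proof.
rewrite big_ord4 mform_coef.unlock /=.
by case: a b c d => [] [] [] [] /=; apply/eqP; rewrite eq_complex;
  apply/andP; split; apply/eqP => /=; ring.
Qed.

Lemma mform_unitary a b c d :
  \sum_i (mform_coef a b i)^*%C * mform_coef c d i =
  ((a == c)%:R * (b == d)%:R) *+ 2.
Proof.
rewrite big_ord4 mform_coef.unlock /=.
by case: a b c d => [] [] [] [] /=; apply/eqP; rewrite eq_complex;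
  apply/andP; split; apply/eqP => /=; ring.
Qed.

(** Only the terms with a <> c and b <> d survive isotropy. They carry the same
    coefficients of g, by symmetry, with signs that cancel. *)
Lemma laplacian_hpoly k g : laplacian (hpoly k g) = 0.
Proof.
case: k => [|[|k]]; rewrite /laplacian.
- by rewrite big1 // => i _; rewrite /= mderivC linear0.
- rewrite big1 // => i _; rewrite mderiv_hpoly mderivZ mderiv_sum big1 ?scaler0 //.
  move=> a _; rewrite mderiv_sum big1 // => b _.
  by rewrite /= mderivZ mderivC scaler0.
have E i : mderiv i (mderiv i (hpoly k.+2 g)) = k.+2%:R *: (k.+1%:R *:
    \sum_a \sum_b \sum_c \sum_d (mform_coef a b i * mform_coef c d i) *:
      hpoly k (fun p q => g (a + (c + p))%N (b + (d + q))%N)).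
  rewrite mderiv_hpoly mderivZ; congr (_ *: _).
  rewrite mderiv_sum scaler_sumr; apply: eq_bigr => a _.
  rewrite mderiv_sum scaler_sumr; apply: eq_bigr => b _.
  rewrite mderivZ mderiv_hpoly scalerA mulrC -scalerA; congr (_ *: _).
  rewrite scaler_sumr; apply: eq_bigr => c _.
  rewrite scaler_sumr; apply: eq_bigr => d _.
  by rewrite scalerA.
under eq_bigr => i _ do rewrite E.
rewrite -!scaler_sumr exchange_big /=.
under eq_bigr => a _ do rewrite exchange_big /=.
under eq_bigr => a _ do under eq_bigr => b _ do rewrite exchange_big /=.
pose u := hpoly k (fun p q => g p.+1 q.+1).
suff F a b : \sum_c \sum_i \sum_d (mform_coef a b i * mform_coef c d i) *:
    hpoly k (fun p q => g (a + (c + p))%N (b + (d + q))%N) =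
    ((-1) ^+ (a (+) b) *+ 2) *: u.
  under eq_bigr => a _ do under eq_bigr => b _ do rewrite F.
  by rewrite !big_bool /= expr0 expr1 mulNrn !scaleNr subrr addNr addr0 !scaler0.
rewrite (bigD1 (~~ a)) //= [X in _ + X]big1 ?addr0; last first.
  move=> c ca; rewrite exchange_big big1 //= => d _.
  have -> : c = a by case: a c ca => [] [].
  by rewrite -scaler_suml mform_isotropic eqxx mulr0 mul0r mul0rn scale0r.
rewrite exchange_big (bigD1 (~~ b)) //= [X in _ + X]big1 ?addr0; last first.
  move=> d db; have -> : d = b by case: b d db => [] [].
  by rewrite -scaler_suml mform_isotropic eqxx mulr0 mul0rn scale0r.
rewrite -scaler_suml mform_isotropic.
have [-> ->] : (a != ~~ a) /\ (b != ~~ b) by case: (a); case: (b).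
rewrite !mulr1.
by congr (_ *: hpoly _ _); apply/funext => p; apply/funext => q; case: (a); case: (b).
Qed.

Lemma conj_mpolyZ c (p : mpoly 4 C) : conj_mpoly (c *: p) = c^*%C *: conj_mpoly p.
Proof. by rewrite conj_mpoly.unlock; exact: map_mpolyZ. Qed.

Lemma conj_mpoly_sum (J : Type) (r : seq J) (Q : pred J) (F : J -> mpoly 4 C) :
  conj_mpoly (\sum_(j <- r | Q j) F j) = \sum_(j <- r | Q j) conj_mpoly (F j).
Proof. by rewrite conj_mpoly.unlock; exact: raddf_sum. Qed.

Lemma mcoeff_conj m (p : mpoly 4 C) : mcoeff m (conj_mpoly p) = (mcoeff m p)^*%C.
Proof. by rewrite conj_mpoly.unlock mcoeff_map_mpoly. Qed.

Lemma mderiv_conj i (p : mpoly 4 C) : mderiv i (conj_mpoly p) = conj_mpoly (mderiv i p).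
Proof.
by apply/mpolyP => m; rewrite mcoeff_mderiv !mcoeff_conj mcoeff_mderiv raddfMn.
Qed.

Lemma conj_mpoly_homog d (p : mpoly 4 C) : p \is homog d -> conj_mpoly p \is homog d.
Proof.
move=> /dhomogP hp; apply/dhomogP => m; rewrite mcoeff_msupp mcoeff_conj.
by rewrite conjc_eq0 -mcoeff_msupp; apply: hp.
Qed.

(** The Hermitian product of the tensors with coefficients g and h; see cdotE. *)
Fixpoint cdot k g h : C :=
  if k is k'.+1 then \sum_a \sum_b cdot k' (wshift g a b) (wshift h a b)
  else (g 0 0)%N^*%C * h 0%N 0%N.

Section Pairing.
Variable mu : multinom 4 -> C.
Hypothesis mu_rec : forall i m,
  (mdeg m + 3)%:R * mu (mnm_add (mnm1 i) m) = (m i)%:R * mu (mnm_sub m (mnm1 i)).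

Lemma momentf_sesq (u v : bool -> bool -> C) (p q : bool -> bool -> mpoly 4 C) :
  momentf mu (conj_mpoly (\sum_a \sum_b u a b *: p a b) *
              (\sum_c \sum_d v c d *: q c d)) =
  \sum_a \sum_b \sum_c \sum_d
    ((u a b)^*%C * v c d) * momentf mu (conj_mpoly (p a b) * q c d).
Proof.
rewrite conj_mpoly_sum mulr_suml momentf_sum; apply: eq_bigr => a _.
rewrite conj_mpoly_sum mulr_suml momentf_sum; apply: eq_bigr => b _.
rewrite conj_mpolyZ -scalerAl linearZ /=; set x := conj_mpoly _.
rewrite [x * _]mulr_sumr momentf_sum mulr_sumr; apply: eq_bigr => c _.
rewrite [x * _]mulr_sumr momentf_sum mulr_sumr; apply: eq_bigr => d _.
by rewrite -scalerAr linearZ /= mulrA.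
Qed.

(** The substitute for Schur orthogonality. As h gives a harmonic polynomial,
    moment_harmonic reduces the degree; by mform_unitary only the terms with the
    same indices in both factors remain. *)
Lemma moment_hpoly k g h :
  momentf mu (conj_mpoly (hpoly k g) * hpoly k h) = mu mnm0 / k.+1%:R * cdot k g h.
Proof.
elim: k g h => [|k IH] g h.
  rewrite /= divr1 conj_mpoly.unlock map_mpolyC -mpolyCM -[mpolyC _ _]mulr1 mul_mpolyC.
  by rewrite linearZ /= -mpolyX0 momentfX mulrC.
have n0 j : j.+1%:R != 0 :> C by rewrite pnatr_eq0.
have := moment_harmonic mu_rec (hpoly_homog k.+1 h)
  (conj_mpoly_homog (hpoly_homog k.+1 g)) (laplacian_hpoly _ _).
rewrite [hpoly k.+1 h * _]mulrC => E.
have {E} : (k.+1 * (k + k.+1 + 3))%:R *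
  momentf mu (conj_mpoly (hpoly k.+1 g) * hpoly k.+1 h) =
  (k.+1 * k.+1).*2%:R * (mu mnm0 / k.+1%:R * cdot k.+1 g h).
  rewrite E; under eq_bigr => i _ do rewrite mulrC mderiv_conj !mderiv_hpoly
    conj_mpolyZ conjc_nat -scalerAl -scalerAr scalerA linearZ /= momentf_sesq.
  rewrite -mulr_sumr -muln2 natrM natrM -mulrA; congr (_ * _).
  rewrite exchange_big /= mulr_sumr mulr_sumr; apply: eq_bigr => a _.
  rewrite exchange_big /= !mulr_sumr; apply: eq_bigr => b _.
  rewrite exchange_big (bigD1 a) //= [X in _ + X]big1 ?addr0; last first.
    move=> c ca; rewrite exchange_big big1 //= => d _.
    by rewrite -mulr_suml mform_unitary (eq_sym a) (negPf ca) mul0r mul0rn mul0r.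
  rewrite exchange_big (bigD1 b) //= [X in _ + X]big1 ?addr0; last first.
    move=> d db; rewrite -mulr_suml mform_unitary (eq_sym b) (negPf db).
    by rewrite mulr0 mul0rn mul0r.
  by rewrite -mulr_suml mform_unitary !eqxx mulr1 IH.
move=> E; apply: (mulfI (_ : (k.+1 * (k + k.+1 + 3))%:R != 0)).
  by rewrite pnatr_eq0 muln_eq0 addn_eq0 andbF.
rewrite E.
have -> : (k + k.+1 + 3 = k.+2 * 2)%N by rewrite muln2 -addnn; lia.
rewrite -muln2 !natrM; set u := mu _; set v := cdot _ _ _.
have := n0 k.+1; have := n0 k; move: (k.+1%:R) (k.+2%:R) => x y x0 y0.
by field; rewrite x0 y0.
Qed.
End Pairing.

End Harmonics.

Section Completeness.
Variable R : realType.
Local Notation C := R[i].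
Local Notation "'homog' d" := (@ishomog1 4 C d (@mdeg 4)) (at level 10).
Implicit Types (g h : nat -> nat -> C).

(** Combining the partial derivatives with the conjugate coefficients of one
    linear form isolates one shift of g. *)
Lemma hpoly_inj k g : hpoly k g = 0 ->
  forall p q, (p <= k)%N -> (q <= k)%N -> g p q = 0.
Proof.
elim: k g => [|k IH] g hg p q hp hq.
  have := congr1 (mcoeff mnm0) hg.
  rewrite /= mcoeff0 mcoeffC eqxx mulr1.
  by case: p q hp hq => // -[].
have H c d : hpoly k (wshift g c d) = 0.
  have : \sum_i (mform_coef R c d i)^*%C *: mderiv i (hpoly k.+1 g) = 0.
    by rewrite hg big1 // => i _; rewrite mderiv0 scaler0.
  under eq_bigr => i _ do rewrite mderiv_hpoly scalerA mulrC -scalerA scaler_sumr.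
  rewrite -scaler_sumr => /eqP; rewrite scaler_eq0 pnatr_eq0 /= => /eqP.
  rewrite exchange_big /= (bigD1 c) //= [X in _ + X]big1 ?addr0; last first.
    move=> a ac; under eq_bigr => i _ do rewrite scaler_sumr.
    rewrite exchange_big big1 //= => b _.
    under eq_bigr => i _ do rewrite scalerA.
    by rewrite -scaler_suml mform_unitary (eq_sym c) (negPf ac) mul0r mul0rn scale0r.
  under eq_bigr => i _ do rewrite scaler_sumr.
  rewrite exchange_big (bigD1 d) //= [X in _ + X]big1 ?addr0; last first.
    move=> b bd; under eq_bigr => i _ do rewrite scalerA.
    by rewrite -scaler_suml mform_unitary (eq_sym d) (negPf bd) mulr0 mul0rn scale0r.
  under eq_bigr => i _ do rewrite scalerA.
  rewrite -scaler_suml mform_unitary !eqxx mulr1 => /eqP.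
  by rewrite scaler_eq0 pnatr_eq0 /= => /eqP.
have -> : g p q = wshift g (0 < p)%N (0 < q)%N p.-1 q.-1 by case: p q {hp hq} => [|p] [|q].
by apply: (IH _ (H _ _)); [case: p hp|case: q hq].
Qed.

(** The Laplace equation expresses the derivative of order two in the last
    variable by the others. *)
Lemma harmonic_determined d (p : mpoly 4 C) :
  laplacian p = 0 -> p \is homog d ->
  (forall m : multinom 4, mdeg m = d -> (m (inord 3) <= 1)%N -> mcoeff m p = 0) ->
  p = 0.
Proof.
move=> Lp hp h0; apply/mpolyP => m; rewrite mcoeff0.
pose t : 'I_4 := inord 3.
have [N] := ubnP (m t); elim: N m => // N IH m mN.
have [md|md] := eqVneq (mdeg m) d; last by rewrite (dhomog_nemf_coeff hp).
have [m1|m1] := leqP (m t) 1; first exact: h0.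
pose m' := mnm_sub m (mnm_add (mnm1 t) (mnm1 t)).
have /= := congr1 (mcoeff m') Lp.
rewrite mcoeff0 raddf_sum (bigD1 t) //= big1 ?addr0; last first.
  move=> i it; rewrite !mcoeff_mderiv IH ?mul0rn // !mnmDE mnmBE !mnmDE !mnm1E eqxx.
  by rewrite (negPf it) !addn0; rewrite -ltnS in mN; lia.
rewrite !mcoeff_mderiv (_ : mnm_add _ _ = m).
  by move=> /eqP; rewrite !mulrn_eq0 /= => /eqP.
apply/mnmP => i; rewrite !mnmDE mnmBE !mnmDE !mnm1E.
by case: eqP => [<-|_]; lia.
Qed.

Section Data.
Variable k : nat.
Let V := {ffun ('I_k.+1 * 'I_k.+1) -> C^o}.

(** The monomials of degree k in which the last variable has exponent at most 1
    are indexed by pairs p, q <= k: those with exponent 0 by p + q <= k, those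
    with exponent 1 by p + q > k. *)
Definition data_mnm (p q : nat) : multinom 4 := Multinom
  (if (p + q <= k)%N then [tuple p; q; (k - p - q)%N; 0%N]
   else [tuple (k - p)%N; (k - q)%N; (p + q - k.+1)%N; 1%N]).

Lemma data_mnmP (m : multinom 4) : mdeg m = k -> (m (inord 3) <= 1)%N ->
  exists p q : 'I_k.+1, m = data_mnm p q.
Proof.
have o (i : 'I_4) j : nat_of_ord i = j -> i = inord j.
  by move=> <-; rewrite inord_val.
have mE t : m = Multinom t <-> forall j, (j < 4)%N -> m (inord j) = nth 0%N t j.
  split=> [-> j j4|e]; first by rewrite mnm_tnth (tnth_nth 0%N) inordK.
  apply/mnmP => i; rewrite (o i i erefl) e // mnm_tnth (tnth_nth 0%N).
  by rewrite inord_val.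
have -> : mdeg m = (m (inord 0) + m (inord 1) + m (inord 2) + m (inord 3))%N.
  rewrite mdegE !big_ord_recl big_ord0 addn0 !addnA.
  by congr (m _ + m _ + m _ + m _)%N; apply: o.
case E : (m (inord 3)) => [|[|]] // md _.
- have p0 : (m (inord 0) < k.+1)%N by lia.
  have q0 : (m (inord 1) < k.+1)%N by lia.
  exists (Ordinal p0), (Ordinal q0); apply/mE => j.
  rewrite /= (_ : (_ <= k)%N); last by lia.
  by case: j => [|[|[|[|]]]] //= _; lia.
- have p0 : (k - m (inord 0) < k.+1)%N by lia.
  have q0 : (k - m (inord 1) < k.+1)%N by lia.
  exists (Ordinal p0), (Ordinal q0); apply/mE => j.
  rewrite /= ifN; last by lia.
  by case: j => [|[|[|[|]]]] //= _; lia.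
Qed.

Definition ext (c : V) (p q : nat) : C := c (inord p, inord q).

Definition data_map (c : V) : V :=
  [ffun pq : 'I_k.+1 * 'I_k.+1 => mcoeff (data_mnm pq.1 pq.2) (hpoly k (ext c)) : C^o].

Lemma data_map_is_linear : linear data_map.
Proof.
move=> u c d; apply/ffunP => pq; rewrite !ffunE.
have -> : hpoly k (ext (u *: c + d)) = u *: hpoly k (ext c) + hpoly k (ext d).
  by rewrite -hpolyP; apply: eq_hpoly => p q _ _; rewrite /ext !ffunE.
by rewrite mcoeffD mcoeffZ.
Qed.

HB.instance Definition _ :=
  GRing.isLinear.Build C V V *:%R data_map data_map_is_linear.

(** A dimension count: the coefficients on the monomials data_mnm determine a
    harmonic polynomial, and g |-> hpoly k g is injective between two spaces of
    dimension (k + 1)^2, so every choice of these coefficients is reached. *)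
Lemma harmonic_hpoly (p : mpoly 4 C) : laplacian p = 0 -> p \is homog k ->
  exists g, p = hpoly k g.
Proof.
have inj : lker (linfun data_map) == 0%VS.
  apply/lker0P => c d; rewrite !lfunE /= => e.
  suff : hpoly k (fun p q => -1 * ext d p q + ext c p q) = 0.
    move=> /hpoly_inj z; apply/ffunP => -[i j].
    have := z i j (ltn_ord i) (ltn_ord j); rewrite /ext !inord_val mulN1r.
    by rewrite addrC => /eqP; rewrite subr_eq0 => /eqP.
  apply: (@harmonic_determined k); rewrite ?laplacian_hpoly ?hpoly_homog //.
  move=> m md m3; have [i [j ->]] := data_mnmP md m3.
  rewrite hpolyP mcoeffD mcoeffZ mulN1r.
  by have /ffunP/(_ (i, j)) := e; rewrite !ffunE /= => ->; rewrite addNr.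
move=> Lp hp.
pose b : V := [ffun pq : 'I_k.+1 * 'I_k.+1 => mcoeff (data_mnm pq.1 pq.2) p : C^o].
pose c := ((linfun data_map)^-1)%VF b.
have cb : data_map c = b by rewrite -(lfunE data_map) lker0_lfunVK.
exists (ext c); apply/eqP; rewrite -subr_eq0; apply/eqP.
apply: (@harmonic_determined k).
- have -> : laplacian (p - hpoly k (ext c)) = laplacian p - laplacian (hpoly k (ext c)).
    by rewrite /laplacian -sumrB; apply: eq_bigr => i _; rewrite !mderivB.
  by rewrite Lp laplacian_hpoly subr0.
- by rewrite rpredB ?hpoly_homog.
move=> m md m3; have [i [j ->]] := data_mnmP md m3.
rewrite mcoeffB; have /ffunP/(_ (i, j)) := cb; rewrite !ffunE /= => ->.
by rewrite subrr.
Qed.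
End Data.
End Completeness.

(** * Moments of the 3-sphere in Hopf coordinates *)

Section TrigIntegrals.
Variable R : realType.
Implicit Types (a b x : R) (f F : R -> R).
Local Notation Int a b f := (\int[@lebesgue_measure R]_(x in `[a, b]) f x).

Definition trig (m n : nat) x : R := cos x ^+ m * sin x ^+ n.

Lemma is_derive_trig m n x : is_derive x 1 (trig m n)
  (n%:R * trig m.+1 n.-1 x - m%:R * trig m.-1 n.+1 x).
Proof.
have -> : trig m n = (@cos R ^+ m * @sin R ^+ n)%R.
  by apply/funext => y; rewrite /trig fctE !exprfctE.
apply: is_derive_eq; rewrite !exprfctE /GRing.scale /= /trig.
by rewrite !exprS; ring.
Qed.

Lemma continuous_trig m n : continuous (trig m n).
Proof.
move=> x; apply/differentiable_continuous/derivable1_diffP.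
exact: (@ex_derive _ _ _ _ _ _ _ (is_derive_trig m n x)).
Qed.

Lemma continuous_integrable f a b : continuous f ->
  (@lebesgue_measure R).-integrable `[a, b] (EFin \o f).
Proof.
move=> cf; apply: continuous_compact_integrable; first exact: segment_compact.
exact: continuous_subspaceT.
Qed.

Lemma Int_sum (J : Type) (s : seq J) (c : J -> R) (f : J -> R -> R) a b :
  (forall j, continuous (f j)) ->
  Int a b (fun x => \sum_(j <- s) c j * f j x) = \sum_(j <- s) c j * Int a b (f j).
Proof.
move=> cf; elim: s => [|j s IH].
  rewrite big_nil (_ : (fun x => _) = cst 0); last first.
    by apply/funext => x; rewrite big_nil.
  by rewrite Rintegral_cst //= mul0r.
rewrite big_cons -IH -RintegralZl //; last exact: continuous_integrable.
rewrite -RintegralD //.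
- by apply: eq_Rintegral => x _; rewrite big_cons.
- apply: continuous_integrable => x; apply: continuousM; first exact: cst_continuous.
  exact: cf.
- apply: continuous_integrable; elim: s {IH} => [|i s IH].
    rewrite (_ : (fun _ => _) = cst 0); first exact: cst_continuous.
    by apply/funext => y; rewrite big_nil.
  rewrite (_ : (fun _ => _) =
    (fun y => c i * f i y) \+ (fun y => \sum_(j <- s) c j * f j y)).
    move=> x; apply: continuousD; last exact: IH.
    by apply: continuousM; [exact: cst_continuous|exact: cf].
  by apply/funext => y; rewrite big_cons.
Qed.

Lemma Int_derive f F a b : a < b -> continuous f ->
  (forall x, is_derive x 1 F (f x)) -> Int a b f = F b - F a.
Proof.
move=> ab cf dF; have cF : continuous F.
  move=> x; apply/differentiable_continuous/derivable1_diffP.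
  exact: (@ex_derive _ _ _ _ _ _ _ (dF x)).
rewrite /Rintegral (@continuous_FTC2 _ f F) //.
- exact: continuous_subspaceT.
- split=> [x _||]; last by apply: cvg_at_left_filter; apply: cF.
    exact: (@ex_derive _ _ _ _ _ _ _ (dF x)).
  by apply: cvg_at_right_filter; apply: cF.
- by move=> x _; rewrite derive1E (@derive_val _ _ _ _ _ _ _ (dF x)).
Qed.

Let Int2 a b m n m' n' (c d : R) :
  Int a b (fun x => c * trig m n x + d * trig m' n' x) =
  c * Int a b (trig m n) + d * Int a b (trig m' n').
Proof.
have := @Int_sum bool [:: true; false] (fun j => if j then c else d)
  (fun j => if j then trig m n else trig m' n') a b.
rewrite !big_cons big_nil addr0 => <-; last by case; apply: continuous_trig.
by apply: eq_Rintegral => x _; rewrite !big_cons big_nil addr0.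
Qed.

Let continuous2 m n m' n' (c d : R) :
  continuous (fun x => c * trig m n x + d * trig m' n' x).
Proof.
have cZ e i j : continuous (fun x => e * trig i j x).
  by move=> x; apply: continuousM; [exact: cst_continuous|exact: continuous_trig].
by move=> x; exact: continuousD (cZ _ _ _ x) (cZ _ _ _ x).
Qed.

(** Integrating the derivative of a trigonometric monomial that takes the same
    value at both ends. *)
Lemma Int_trig_cos a b m n : a < b -> trig m n.+1 a = trig m n.+1 b ->
  (m + n).+1%:R * Int a b (trig m.+1 n) = m%:R * Int a b (trig m.-1 n).
Proof.
move=> ab e; have d x : is_derive x 1 (trig m n.+1)
    ((m + n).+1%:R * trig m.+1 n x + (- m%:R) * trig m.-1 n x).
  apply: (is_derive_eq (is_derive_trig m n.+1 x)).
  case: m {e} => [|m]; first by rewrite !mul0r oppr0 mul0r !addr0.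
  have -> : trig m.+1.-1 n.+2 x = trig m.+1.-1 n x - trig m.+2 n x.
    have s2 : sin x * sin x = 1 - cos x * cos x.
      by rewrite -!expr2 -(cos2Dsin2 x) addrAC subrr add0r.
    by rewrite /trig /= !exprS (mulrA (sin x)) s2; ring.
  by rewrite -addSn !natrD /= -!natr1; ring.
have := Int_derive ab (@continuous2 _ _ _ _ _ _) d.
rewrite Int2 e subrr => /eqP; rewrite mulNr subr_eq0 => /eqP //.
Qed.

Lemma Int_trig_sin a b m n : a < b -> trig m.+1 n a = trig m.+1 n b ->
  (m + n).+1%:R * Int a b (trig m n.+1) = n%:R * Int a b (trig m n.-1).
Proof.
move=> ab e; have d x : is_derive x 1 (trig m.+1 n)
    ((- (m + n).+1%:R) * trig m n.+1 x + n%:R * trig m n.-1 x).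
  apply: (is_derive_eq (is_derive_trig m.+1 n x)).
  case: n {e} => [|n].
    by rewrite !mul0r addr0 sub0r addn0 mulNr.
  have -> : trig m.+2 n.+1.-1 x = trig m n.+1.-1 x - trig m n.+2 x.
    have c2 : cos x * cos x = 1 - sin x * sin x.
      by rewrite -!expr2 -(cos2Dsin2 x) addrK.
    by rewrite /trig /= !exprS (mulrA (cos x)) c2; ring.
  by rewrite -addSn !natrD /= -!natr1; ring.
have := Int_derive ab (@continuous2 _ _ _ _ _ _) d.
rewrite Int2 e subrr mulNr => /eqP; rewrite addrC subr_eq0 => /eqP //.
Qed.

Definition circle_moment m n : R := Int 0 (pi *+ 2) (trig m n).
Definition quarter_moment m n : R := Int 0 (pi / 2) (trig m n).

Let trig_circle m n : trig m n 0 = trig m n (pi *+ 2).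
Proof. by rewrite /trig cos2pi sin2pi cos0 sin0. Qed.

Let circle_gt0 : 0 < pi *+ 2 :> R. Proof. by rewrite pmulrn_lgt0 // pi_gt0. Qed.
Let quarter_gt0 : 0 < pi / 2 :> R. Proof. by rewrite divr_gt0 // pi_gt0. Qed.

Lemma circle_moment_cos m n :
  (m + n).+1%:R * circle_moment m.+1 n = m%:R * circle_moment m.-1 n.
Proof. exact: Int_trig_cos circle_gt0 (trig_circle _ _). Qed.

Lemma circle_moment_sin m n :
  (m + n).+1%:R * circle_moment m n.+1 = n%:R * circle_moment m n.-1.
Proof. exact: Int_trig_sin circle_gt0 (trig_circle _ _). Qed.

Let trig_quarter m n : trig m.+1 n.+1 0 = trig m.+1 n.+1 (pi / 2).
Proof. by rewrite /trig sin0 cos_pihalf !expr0n !mul0r mulr0. Qed.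

Lemma quarter_moment_cos m n :
  (m + n).+2%:R * quarter_moment m.+2 n = m.+1%:R * quarter_moment m n.
Proof. exact: Int_trig_cos quarter_gt0 (trig_quarter _ _). Qed.

Lemma quarter_moment_sin m n :
  (m + n).+2%:R * quarter_moment m n.+2 = n.+1%:R * quarter_moment m n.
Proof. by rewrite -addnS; exact: Int_trig_sin quarter_gt0 (trig_quarter _ _). Qed.

Lemma circle_moment0 : 0 < circle_moment 0 0.
Proof.
rewrite /circle_moment (_ : trig 0 0 = cst 1); last first.
  by apply/funext => x; rewrite /trig mulr1.
by rewrite (@Int_derive _ id) ?subr0 //; exact: cst_continuous.
Qed.

Lemma quarter_moment11 : 0 < quarter_moment 1 1.
Proof.
have d x : is_derive x 1 (trig 0 2) (2 * trig 1 1 x + 0 * trig 0 0 x).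
  by apply: (is_derive_eq (is_derive_trig 0 2 x)); rewrite !mul0r subr0 addr0.
have := Int_derive quarter_gt0 (@continuous2 _ _ _ _ _ _) d.
rewrite Int2 mul0r addr0 /trig sin_pihalf sin0 !expr1n expr0n /= mulr1 mulr0 subr0.
by rewrite -/(quarter_moment 1 1) => e; rewrite -(pmulr_rgt0 _ (ltr0n R 2)) e.
Qed.
End TrigIntegrals.

Section SphereMoments.
Variable R : realType.
Local Notation C := R[i].
Implicit Types (m : multinom 4) (x : Sp1 R).

Definition sphere_moment m : R :=
  quarter_moment R (m (inord 0) + m (inord 1)).+1 (m (inord 2) + m (inord 3)).+1 *
  circle_moment R (m (inord 0)) (m (inord 1)) *
  circle_moment R (m (inord 2)) (m (inord 3)).

Lemma ord4E (i : 'I_4) :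
  [\/ i = inord 0, i = inord 1, i = inord 2 | i = inord 3].
Proof.
by case: i => -[|[|[|[|//]]]] p; [constructor 1|constructor 2|constructor 3|constructor 4];
  apply: val_inj; rewrite /= inordK.
Qed.

Lemma mdeg4 m : mdeg m =
  (m (inord 0) + m (inord 1) + (m (inord 2) + m (inord 3)))%N.
Proof.
rewrite mdegE !big_ord_recl big_ord0 addn0 !addnA.
by congr (m _ + m _ + m _ + m _)%N; apply: val_inj; rewrite /= inordK.
Qed.

(** The divergence theorem on the unit ball of R^4. In Hopf coordinates it is an
    integration by parts in the angle a followed by one in b or in c. *)
Lemma sphere_moment_rec (i : 'I_4) m :
  (mdeg m + 3)%:R * sphere_moment (mnm_add (mnm1 i) m) =
  (m i)%:R * sphere_moment (mnm_sub m (mnm1 i)).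
Proof.
have nE a b : (a < 4)%N -> (b < 4)%N -> (inord a == inord b :> 'I_4) = (a == b).
  by move=> a4 b4; rewrite -val_eqE /= !inordK.
have comb (N S c K K' T T' U : R) : N * K' = S * K -> S * T' = c * T ->
    N * (K' * T' * U) = c * (K * T * U).
  by move=> e1 e2; rewrite !mulrA e1 [S * K * T']mulrAC e2; ring.
rewrite mdeg4 /sphere_moment !mnmDE !mnmBE !mnm1E.
case: (ord4E i) => ->; rewrite !nE //= ?add0n ?add1n ?subn0 ?subn1;
  move: (m (inord 0)) (m (inord 1)) (m (inord 2)) (m (inord 3)) => a b c d.
- have := circle_moment_cos R a b; have := quarter_moment_cos R (a + b) (c + d).+1.
  have -> : (a + b + (c + d).+1).+2 = (a + b + (c + d) + 3)%N by lia.
  move=> eK eT; rewrite addSn (comb _ _ _ _ _ _ _ _ eK eT).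
  by case: a {eK eT} => [|a]; rewrite ?mul0r //= addSn.
- have := circle_moment_sin R a b; have := quarter_moment_cos R (a + b) (c + d).+1.
  have -> : (a + b + (c + d).+1).+2 = (a + b + (c + d) + 3)%N by lia.
  move=> eK eT; rewrite (addnS a) (comb _ _ _ _ _ _ _ _ eK eT).
  by case: b {eK eT} => [|b]; rewrite ?mul0r //= (addnS a).
- have := circle_moment_cos R c d; have := quarter_moment_sin R (a + b).+1 (c + d).
  have -> : ((a + b).+1 + (c + d)).+2 = (a + b + (c + d) + 3)%N by lia.
  move=> eK eT; rewrite (addSn c) [_ * _ * circle_moment R c.+1 d]mulrAC.
  rewrite (comb _ _ _ _ _ _ _ _ eK eT).
  by case: c {eK eT} => [|c]; rewrite ?mul0r //= (addSn c) mulrAC.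
- have := circle_moment_sin R c d; have := quarter_moment_sin R (a + b).+1 (c + d).
  have -> : ((a + b).+1 + (c + d)).+2 = (a + b + (c + d) + 3)%N by lia.
  move=> eK eT; rewrite (addnS c) [_ * _ * circle_moment R c d.+1]mulrAC.
  rewrite (comb _ _ _ _ _ _ _ _ eK eT).
  by case: d {eK eT} => [|d]; rewrite ?mul0r //= (addnS c) mulrAC.
Qed.

Lemma sphere_moment0 : 0 < sphere_moment mnm0.
Proof.
rewrite /sphere_moment !mnm0E.
by rewrite !mulr_gt0 ?quarter_moment11 ?circle_moment0.
Qed.

Lemma hopf_densityE a b c : hopf_density a b c = `|cos a * sin a| :> R.
Proof.
have dl (f : R -> R) (k t f' : R) : is_derive t 1 f f' ->
    (fun u => f u * k)^`()%classic t = f' * k.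
  move=> df; rewrite derive1E; apply: derive_val.
  apply: (is_derive_eq (is_deriveM df (is_derive_cst k t 1))).
  by rewrite scaler0 add0r /GRing.scale /= mulrC.
have dr (f : R -> R) (k t f' : R) : is_derive t 1 f f' ->
    (fun u => k * f u)^`()%classic t = k * f'.
  move=> df; rewrite (_ : (fun u => k * f u) = fun u => f u * k).
    by rewrite (dl _ _ _ f') // mulrC.
  by apply/funext => u; rewrite mulrC.
have dc := is_derive_cos; have ds := is_derive_sin.
have d0 (k t : R) : (fun _ : R => k)^`()%classic t = 0 :> R by rewrite derive1_cst.
have t0 : hopf_tangent a b c (inord 0) =
    Quat (- sin a * cos b) (- sin a * sin b) (cos a * cos c) (cos a * sin c).
  rewrite /hopf_tangent (tnth_nth 0) inordK //=.
  by apply: quat_eqP => /=; rewrite (dl _ _ _ _ (dc _ _)) || rewrite (dl _ _ _ _ (ds _ _)).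
have t1 : hopf_tangent a b c (inord 1) =
    Quat (cos a * - sin b) (cos a * cos b) 0 0.
  rewrite /hopf_tangent (tnth_nth 0) inordK //=.
  by apply: quat_eqP => /=; rewrite ?(dr _ _ _ _ (dc _ _)) ?(dr _ _ _ _ (ds _ _)) ?d0.
have t2 : hopf_tangent a b c (inord 2) =
    Quat 0 0 (sin a * - sin c) (sin a * cos c).
  rewrite /hopf_tangent (tnth_nth 0) inordK //=.
  by apply: quat_eqP => /=; rewrite ?(dr _ _ _ _ (dc _ _)) ?(dr _ _ _ _ (ds _ _)) ?d0.
rewrite /hopf_density.
have -> : (\matrix_(i, j) qdot (hopf_tangent a b c i) (hopf_tangent a b c j)) =
    diag_mx (\row_i nth 0 [:: 1; cos a ^+ 2; sin a ^+ 2] i).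
  have [cb cc] := (cos2Dsin2 b, cos2Dsin2 c); have ca := cos2Dsin2 a.
  have o (i : 'I_3) : [\/ i = inord 0, i = inord 1 | i = inord 2].
    by case: i => -[|[|[|//]]] p; [constructor 1|constructor 2|constructor 3];
      apply: val_inj; rewrite /= inordK.
  have nE i j : (i < 3)%N -> (j < 3)%N -> (inord i == inord j :> 'I_3) = (i == j).
    by move=> ? ?; rewrite -val_eqE /= !inordK.
  apply/matrixP => i j; rewrite !mxE.
  case: (o i) => ->; case: (o j) => ->; rewrite nE // inordK //= ?t0 ?t1 ?t2 /qdot /=;
    rewrite ?mulr0n ?mulr1n; try by ring.
  - transitivity (sin a ^+ 2 * (cos b ^+ 2 + sin b ^+ 2) +
      cos a ^+ 2 * (cos c ^+ 2 + sin c ^+ 2)); first by ring.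
    by rewrite cb cc !mulr1 addrC.
  - transitivity (cos a ^+ 2 * (cos b ^+ 2 + sin b ^+ 2)); first by ring.
    by rewrite cb mulr1.
  - transitivity (sin a ^+ 2 * (cos c ^+ 2 + sin c ^+ 2)); first by ring.
    by rewrite cc mulr1.
rewrite det_diag !big_ord_recl big_ord0 !mxE /= mulr1 mul1r -exprMn.
exact: sqrtr_sqr.
Qed.

(** On the chart the density is cos a * sin a, without absolute value, so that a
    monomial separates into three one-variable trigonometric integrals. *)
Lemma sp_int_monomials (s : seq (multinom 4)) (w : multinom 4 -> R) :
  sp_int (fun x => \sum_(m <- s) w m * \prod_i qcoord x i ^+ m i) =
  \sum_(m <- s) w m * sphere_moment m.
Proof.
have prodE m (a b c : R) : \prod_i qcoord (hopf a b c) i ^+ m i =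
    trig (m (inord 0) + m (inord 1)) (m (inord 2) + m (inord 3)) a *
    trig (m (inord 0)) (m (inord 1)) b * trig (m (inord 2)) (m (inord 3)) c.
  have -> (F : 'I_4 -> R) :
      \prod_i F i = F (inord 0) * F (inord 1) * F (inord 2) * F (inord 3).
    rewrite !big_ord_recl big_ord0 mulr1 !mulrA.
    by congr (F _ * F _ * F _ * F _); apply: val_inj; rewrite /= inordK.
  by rewrite /qcoord !(tnth_nth 0) !inordK //= /trig !exprMn !exprD; ring.
rewrite /sp_int.
have in3 (a b : R) : \int[@lebesgue_measure R]_(c in `[0, pi *+ 2])
      ((\sum_(m <- s) w m * \prod_i qcoord (hopf a b c) i ^+ m i) *
        hopf_density a b c) =
    \sum_(m <- s) (w m * (`|cos a * sin a| *
       trig (m (inord 0) + m (inord 1)) (m (inord 2) + m (inord 3)) a) *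
       circle_moment R (m (inord 2)) (m (inord 3))) *
       trig (m (inord 0)) (m (inord 1)) b.
  under eq_Rintegral.
    move=> c _; rewrite hopf_densityE mulr_suml.
    under eq_bigr => m _.
      rewrite prodE (_ : _ * _ = w m * (`|cos a * sin a| *
       trig (m (inord 0) + m (inord 1)) (m (inord 2) + m (inord 3)) a) *
       trig (m (inord 0)) (m (inord 1)) b * trig (m (inord 2)) (m (inord 3)) c).
        over.
      by ring.
    over.
  rewrite (Int_sum _ (fun m => w m * (`|cos a * sin a| *
       trig (m (inord 0) + m (inord 1)) (m (inord 2) + m (inord 3)) a) *
       trig (m (inord 0)) (m (inord 1)) b)
     (f := fun m => trig (m (inord 2)) (m (inord 3)))).
    by apply: eq_bigr => m _; rewrite mulrAC.
  by move=> m; apply: continuous_trig.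
have in2 (a : R) : a \in [set` `[0, (pi / 2 : R)]] ->
    \int[@lebesgue_measure R]_(b in `[0, pi *+ 2])
      \int[@lebesgue_measure R]_(c in `[0, pi *+ 2])
        ((\sum_(m <- s) w m * \prod_i qcoord (hopf a b c) i ^+ m i) *
          hopf_density a b c) =
    \sum_(m <- s) (w m * circle_moment R (m (inord 0)) (m (inord 1)) *
       circle_moment R (m (inord 2)) (m (inord 3))) *
       trig (m (inord 0) + m (inord 1)).+1 (m (inord 2) + m (inord 3)).+1 a.
  rewrite inE /= in_itv /= => /andP[a0 a1].
  under eq_Rintegral do rewrite in3.
  rewrite (Int_sum _ (fun m => w m * (`|cos a * sin a| *
       trig (m (inord 0) + m (inord 1)) (m (inord 2) + m (inord 3)) a) *
       circle_moment R (m (inord 2)) (m (inord 3)))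
     (f := fun m => trig (m (inord 0)) (m (inord 1)))); last first.
    by move=> m; apply: continuous_trig.
  apply: eq_bigr => m _; rewrite -/(circle_moment R _ _) ger0_norm.
    by rewrite /trig !exprS; ring.
  have p0 := pi_ge0 R.
  rewrite mulr_ge0 ?cos_ge0_pihalf ?sin_ge0_pi //; first by rewrite a1 andbT; lra.
  by rewrite a0 /=; lra.
under eq_Rintegral => a aD do rewrite (in2 a aD).
rewrite (Int_sum _ (fun m => w m *
    circle_moment R (m (inord 0)) (m (inord 1)) *
    circle_moment R (m (inord 2)) (m (inord 3)))
  (f := fun m => trig (m (inord 0) + m (inord 1)).+1
                      (m (inord 2) + m (inord 3)).+1)); last first.
  by move=> m; apply: continuous_trig.
apply: eq_bigr => m _; rewrite -/(quarter_moment R _ _) /sphere_moment; ring.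
Qed.

Definition cmoment m : C := (sphere_moment m)%:C%C.

Lemma cmoment_rec (i : 'I_4) m :
  (mdeg m + 3)%:R * cmoment (mnm_add (mnm1 i) m) =
  (m i)%:R * cmoment (mnm_sub m (mnm1 i)).
Proof.
rewrite /cmoment -!(rmorph_nat (real_complex R)) -!rmorphM.
by congr (_%:C%C); exact: sphere_moment_rec.
Qed.

Definition qccoord x (i : 'I_4) : C := (qcoord x i)%:C%C.

Lemma sp_int_meval (p : mpoly 4 C) :
  sp_int (fun x => complex.Re (meval (qccoord x) p)) =
    complex.Re (momentf cmoment p) /\
  sp_int (fun x => complex.Im (meval (qccoord x) p)) =
    complex.Im (momentf cmoment p).
Proof.
have H (L : {additive C -> R}) : (forall c (r : R), L (c * r%:C%C) = L c * r) ->
    sp_int (fun x => L (meval (qccoord x) p)) = L (momentf cmoment p).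
  move=> Lr; rewrite momentf.unlock raddf_sum.
  under [RHS]eq_bigr do rewrite Lr.
  rewrite -sp_int_monomials; congr sp_int; apply/funext => x.
  rewrite mevalE raddf_sum; apply: eq_bigr => m _.
  by rewrite -Lr rmorph_prod; congr (L (_ * _)); apply: eq_bigr => i _; rewrite rmorphXn.
split.
- apply: (H (@complex.Re R)) => -[a b] r /=; ring.
- apply: (H (@complex.Im R)) => -[a b] r /=; ring.
Qed.
End SphereMoments.

(** * Symmetric tensors in weight coordinates *)

Section FinfunCons.
Variables (k : nat) (T : finType).

Definition fcons (a : T) (f : {ffun 'I_k -> T}) : {ffun 'I_k.+1 -> T} :=
  [ffun i => if unlift ord0 i is Some j then f j else a].

Lemma fcons0 a f : fcons a f ord0 = a.
Proof. by rewrite ffunE unlift_none. Qed.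

Lemma fconsS a f i : fcons a f (lift ord0 i) = f i.
Proof. by rewrite ffunE liftK. Qed.

Lemma fcons_surj (f : {ffun 'I_k.+1 -> T}) :
  fcons (f ord0) [ffun i => f (lift ord0 i)] = f.
Proof.
by apply/ffunP => i; rewrite !ffunE; case: unliftP => [j|] ->; rewrite ?ffunE.
Qed.

Lemma sum_fcons (V : nmodType) (F : {ffun 'I_k.+1 -> T} -> V) :
  \sum_f F f = \sum_a \sum_f F (fcons a f).
Proof.
rewrite pair_bigA /=.
rewrite (reindex (fun af : T * {ffun 'I_k -> T} => fcons af.1 af.2)) //=.
exists (fun f => (f ord0, [ffun i => f (lift ord0 i)])) => [[a f] _|f _] /=.
  by rewrite fcons0; congr (_, _); apply/ffunP => i; rewrite !ffunE liftK.
exact: fcons_surj.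
Qed.
End FinfunCons.

Section Weights.
Variable k : nat.
Implicit Types I J : {ffun 'I_k -> bool}.

(** The number of factors e2 in an elementary tensor. *)
Definition weight I : nat := (\sum_i I i)%N.

Lemma weight_le I : (weight I <= k)%N.
Proof.
rewrite -[X in (_ <= X)%N](card_ord k) -sum1_card; apply: leq_sum => i _.
exact: leq_b1.
Qed.

Lemma weight_perm I (pi : 'S_k) : weight [ffun i => I (pi i)] = weight I.
Proof.
rewrite /weight [RHS](reindex_inj (@perm_inj _ pi)).
by apply: eq_bigr => i _; rewrite ffunE.
Qed.

Definition first_ones (p : nat) : {ffun 'I_k -> bool} := [ffun i : 'I_k => (i < p)%N].

Lemma weight_first_ones p : (p <= k)%N -> weight (first_ones p) = p.
Proof.
move=> pk; rewrite /weight; under eq_bigr do rewrite ffunE.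
have -> j : (\sum_(i < j) (i < p)%N = minn j p)%N.
  by elim: j => [|j IH]; rewrite ?big_ord0 ?min0n // big_ord_recr /= IH; lia.
exact/minn_idPr.
Qed.

(** Boolean families of the same weight have the same multiset of values. *)
Lemma weight_eq I J : weight I = weight J ->
  exists s : 'S_k, J = [ffun i => I (s i)].
Proof.
have wE (L : {ffun 'I_k -> bool}) : count_mem true [tuple L i | i < k] = weight L.
  rewrite /weight /= count_map -size_filter -sum1_size big_filter big_enum_cond /=.
  by rewrite big_mkcond; apply: eq_bigr => i _ /=; case: (L i).
have cF (t : k.-tuple bool) : count_mem false t = (k - count_mem true t)%N.
  rewrite -[X in (X - _)%N](size_tuple t) -(count_predC (pred1 true)) addKn.
  by apply: eq_count => -[].
move=> e; have : perm_eq [tuple J i | i < k] [tuple I i | i < k].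
  by apply/allP => -[] _; rewrite inE ?cF !wE e.
move=> /tuple_permP[s es]; exists s; apply/ffunP => i.
have := congr1 (fun t => nth false t i) es.
by rewrite -!tnth_nth !tnth_mktuple ffunE.
Qed.
End Weights.

Section TensorSpace.
Variables (R : realType) (k : nat).
Local Notation H := (quat R).
Local Notation htens := (htens R k).
Local Notation W := (@Wspace R k).
Implicit Types (g h : nat -> nat -> H) (f : htens).

(** A pair of symmetric tensors has coefficients that depend only on the weights
    of the two multi-indices. *)
Definition wtens g : htens := [ffun K => g (weight K.1) (weight K.2)].

Lemma wtensP c g h :
  wtens (fun p q => c *: g p q + h p q) = c *: wtens g + wtens h.
Proof. by apply/ffunP => K; rewrite !ffunE. Qed.

Lemma WspaceD f1 f2 : W f1 -> W f2 -> W (f1 + f2).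
Proof.
move=> [n1 [h1 [u1 [v1 [su1 sv1 ->]]]]] [n2 [h2 [u2 [v2 [su2 sv2 ->]]]]].
pose glue T (x : 'I_n1 -> T) (y : 'I_n2 -> T) (i : 'I_(n1 + n2)) :=
  match fintype.split i with inl j => x j | inr j => y j end.
exists (n1 + n2)%N, (glue _ h1 h2), (glue _ u1 u2), (glue _ v1 v2); split.
- by move=> j; rewrite /glue; case: fintype.split.
- by move=> j; rewrite /glue; case: fintype.split.
rewrite big_split_ord /=; congr (_ + _); apply: eq_bigr => j _.
  by rewrite /glue (unsplitK (inl j)).
by rewrite /glue (unsplitK (inr j)).
Qed.

Lemma Wspace0 : W 0.
Proof.
exists 0%N, (fun _ => 0), (fun _ => 0), (fun _ => 0); split; try by case.
by rewrite big_ord0.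
Qed.

Lemma Wspace_sum (J : Type) (r : seq J) (F : J -> htens) :
  (forall j, W (F j)) -> W (\sum_(j <- r) F j).
Proof.
by move=> WF; apply: (big_ind W); [exact: Wspace0|exact: WspaceD|move=> j _; exact: WF].
Qed.

Definition weight_ind (p : nat) : tpow R k := [ffun J => (weight J == p)%:R].

Lemma weight_ind_sym p : sym_tensor (weight_ind p).
Proof. by move=> s J; rewrite !ffunE weight_perm. Qed.

Lemma sym_tensor_weight (u : tpow R k) I J : sym_tensor u ->
  weight I = weight J -> u I = u J.
Proof. by move=> su /weight_eq[s ->]; rewrite su. Qed.

Lemma wtensE g : wtens g =
  \sum_(p < k.+1) \sum_(q < k.+1)
    tens (g p q) (tens2 (weight_ind p) (weight_ind q)).
Proof.
apply/ffunP => K; rewrite !ffunE sum_ffunE.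
have pk (I : midx k) : (weight I < k.+1)%N by rewrite ltnS weight_le.
rewrite (bigD1 (Ordinal (pk K.1))) //= [X in _ + X]big1 ?addr0; last first.
  move=> p pn; rewrite sum_ffunE big1 // => q _; rewrite !ffunE.
  by rewrite (_ : (_ == _) = false) ?mul0r ?scale0r //; apply/negbTE;
     rewrite eq_sym.
rewrite sum_ffunE (bigD1 (Ordinal (pk K.2))) //= [X in _ + X]big1 ?addr0; last first.
  move=> q qn; rewrite !ffunE.
  by rewrite (_ : (weight K.2 == _) = false) ?mulr0 ?scale0r //; apply/negbTE;
     rewrite eq_sym.
by rewrite !ffunE !eqxx mulr1 scale1r.
Qed.

Lemma WspaceP f : W f <-> exists g, f = wtens g.
Proof.
split=> [[n [h [u [v [su sv ->]]]]]|[g ->]].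
  pose o := first_ones k.
  exists (fun p q => (\sum_j tens (h j) (tens2 (u j) (v j))) (o p, o q)).
  apply/ffunP => K; rewrite !ffunE !sum_ffunE; apply: eq_bigr => j _.
  rewrite !ffunE /=; congr (_ * _ *: _); apply: sym_tensor_weight => //;
    by rewrite weight_first_ones ?weight_le.
rewrite wtensE; apply: Wspace_sum => p; apply: Wspace_sum => q.
exists 1%N, (fun=> g p q), (fun=> weight_ind p), (fun=> weight_ind q).
by split=> [_|_|]; rewrite ?big_ord1 //; exact: weight_ind_sym.
Qed.

End TensorSpace.

(** * The Peter-Weyl map *)

Section Coordinates.
Variable R : realType.
Local Notation C := R[i].
Local Notation H := (quat R).
Implicit Types (x y : H) (b : bool) (c : C).

Lemma hcoordP x y : (forall b, hcoord x b = hcoord y b) -> x = y.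
Proof.
by move=> e; case: (e false) (e true) => e0 e1 [e2 e3]; apply: quat_eqP.
Qed.

Lemma hcoordD x y b : hcoord (x + y) b = hcoord x b + hcoord y b.
Proof. by case: b. Qed.

Lemma hcoordZ c x b : hcoord (c *: x) b = c * hcoord x b.
Proof.
by case: b c => [] [c0 c1]; apply/eqP; rewrite eq_complex /=; apply/andP; split;
  apply/eqP => /=; ring.
Qed.

Lemma hcoord_sum b (J : Type) (r : seq J) (F : J -> H) :
  hcoord (\sum_(j <- r) F j) b = \sum_(j <- r) hcoord (F j) b.
Proof.
apply: (big_morph (fun x => hcoord x b)) => [x y|]; first exact: hcoordD.
by case: b.
Qed.

Lemma hcoord_qconjM x y :
  hcoord (qconj x * y) false =
    (hcoord x false)^*%C * hcoord y false + hcoord x true * (hcoord y true)^*%C /\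
  hcoord (qconj x * y) true =
    (hcoord x false)^*%C * hcoord y true - (hcoord y false)^*%C * hcoord x true.
Proof.
by split; apply/eqP; rewrite eq_complex /=; apply/andP; split; apply/eqP => /=; ring.
Qed.

(** The invariant symplectic form of C^2. *)
Definition symplectic x y : C :=
  hcoord x false * hcoord y true - hcoord x true * hcoord y false.

Lemma symplecticM (x y : H) (s : Sp1 R) :
  symplectic (x * spval s) (y * spval s) = symplectic x y.
Proof.
have -> : symplectic (x * spval s) (y * spval s) =
    (qdot (spval s) (spval s))%:C%C * symplectic x y.
  by apply/eqP; rewrite eq_complex /qdot /=; apply/andP; split; apply/eqP => /=; ring.
by rewrite spP mul1r.
Qed.

Lemma symplectic_suml (J : finType) (c : J -> C) (F : J -> H) y :
  symplectic (\sum_j c j *: F j) y = \sum_j c j * symplectic (F j) y.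
Proof.
rewrite /symplectic !hcoord_sum !mulr_suml -sumrB; apply: eq_bigr => j _.
by rewrite !hcoordZ mulrBr !mulrA.
Qed.

Lemma symplectic_sumr (J : finType) (c : J -> C) (F : J -> H) x :
  symplectic x (\sum_j c j *: F j) = \sum_j c j * symplectic x (F j).
Proof.
rewrite /symplectic !hcoord_sum !mulr_sumr -sumrB; apply: eq_bigr => j _.
by rewrite !hcoordZ mulrBr !(mulrCA (c j)).
Qed.

Lemma hbasis_sum x : x = \sum_b hcoord x b *: hbasis R b.
Proof.
rewrite big_bool; apply: hcoordP => b; rewrite hcoordD !hcoordZ.
by case: b; rewrite /hbasis /=; apply/eqP; rewrite eq_complex /=;
   apply/andP; split; apply/eqP => /=; ring.
Qed.

Lemma scale_mulr c x y : c *: (x * y) = (c *: x) * y.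
Proof. exact: mulrA. Qed.

(** Matrix coefficients of the representation on C^2, with the second index
    lowered by the symplectic form. *)
Definition mvalue (x : Sp1 R) (a b : bool) : C :=
  symplectic (hbasis R a * spval x^-1%g) (hbasis R b).

Lemma meval_mform (x : Sp1 R) a b : meval (qccoord x) (mform R a b) = mvalue x a b.
Proof.
rewrite /mform raddf_sum big_ord4 /=.
have E i : meval (qccoord x) (mform_coef R a b i *: mpolyX C (mnm1 i)) =
   mform_coef R a b i * qccoord x i.
  by rewrite mevalZ mevalXU.
rewrite !E {E} mform_coef.unlock /qccoord /qcoord !(tnth_nth 0) /mvalue /symplectic.
by case: a b => [] []; apply/eqP; rewrite eq_complex /=; apply/andP; split;
  apply/eqP => /=; ring.
Qed.

End Coordinates.

Section MidxRecursion.

Lemma weight_fcons k (c : bool) (L : midx k) : weight (fcons c L) = (c + weight L)%N.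
Proof.
rewrite /weight big_ord_recl fcons0; congr addn.
by apply: eq_bigr => i _; rewrite fconsS.
Qed.

Lemma sum_midxS k (V : nmodType) (F : midx k.+1 * midx k.+1 -> V) :
  \sum_K F K = \sum_a \sum_b \sum_(K : midx k * midx k) F (fcons a K.1, fcons b K.2).
Proof.
rewrite (eq_bigr (fun K => F (K.1, K.2))) => [|[]] //.
rewrite -(pair_bigA _ (fun I J => F (I, J))) sum_fcons; apply: eq_bigr => a _.
under eq_bigr => I _ do rewrite sum_fcons.
rewrite exchange_big; apply: eq_bigr => b _.
by rewrite pair_bigA.
Qed.

Lemma sum_midx0 (V : nmodType) (F : midx 0 * midx 0 -> V) :
  \sum_K F K = F ([ffun=> false], [ffun=> false]).
Proof.
have e (K : midx 0 * midx 0) : K = ([ffun=> false], [ffun=> false]).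
  by case: K => I J; congr (_, _); apply/ffunP => -[].
rewrite (bigD1 ([ffun=> false], [ffun=> false])) //= big1 ?addr0 // => K.
by rewrite (e K) eqxx.
Qed.
End MidxRecursion.

Section PeterWeyl.
Variables (R : realType) (k : nat).
Local Notation C := R[i].
Local Notation H := (quat R).
Local Notation htens := (htens R k).
Implicit Types (g h : nat -> nat -> H) (f : htens) (x : Sp1 R).

(** The tensor h (x) u (x) v is sent to the function with values
    omega(u x^-1, v) h, where omega is the invariant form of the tensor power. *)
Definition Psi f x : H := \sum_(K : midx k * midx k) (\prod_i mvalue x (K.1 i) (K.2 i)) *: f K.

Lemma PsiP c f1 f2 x : Psi (c *: f1 + f2) x = c *: Psi f1 x + Psi f2 x.
Proof.
rewrite /Psi scaler_sumr -big_split /=; apply: eq_bigr => K _.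
by rewrite !ffunE scalerDr !scalerA (mulrC c).
Qed.

Lemma Psi_hmulr f (y : H) x : Psi (hmulr f y) x = Psi f x * y.
Proof.
by rewrite /Psi mulr_suml; apply: eq_bigr => K _; rewrite !ffunE -[RHS]scale_mulr.
Qed.

Lemma sum_weight (F : nat -> nat -> C) x :
  \sum_(K : midx k * midx k) (\prod_i mvalue x (K.1 i) (K.2 i)) *
     F (weight K.1) (weight K.2) = meval (qccoord x) (hpoly k F).
Proof.
elim: k F => [|j IH] F.
  by rewrite sum_midx0 big_ord0 mul1r /= mevalC /weight !big_ord0.
rewrite sum_midxS /= raddf_sum; apply: eq_bigr => a _.
rewrite raddf_sum; apply: eq_bigr => b _.
rewrite [RHS]mevalM meval_mform -IH mulr_sumr; apply: eq_bigr => K _ /=.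
rewrite big_ord_recl !fcons0 !weight_fcons -mulrA; congr (_ * (_ * _)).
by apply: eq_bigr => i _; rewrite !fconsS.
Qed.

Lemma hcoord_Psi g x b : hcoord (Psi (wtens k g) x) b =
  meval (qccoord x) (hpoly k (fun p q => hcoord (g p q) b)).
Proof.
rewrite -sum_weight /Psi hcoord_sum; apply: eq_bigr => K _.
by rewrite hcoordZ ffunE.
Qed.

Lemma cdotE (F G : nat -> nat -> C) : cdot k F G =
  \sum_(K : midx k * midx k) (F (weight K.1) (weight K.2))^*%C *
     G (weight K.1) (weight K.2).
Proof.
elim: k F G => [|j IH] F G.
  by rewrite sum_midx0 /weight !big_ord0.
rewrite sum_midxS /=; apply: eq_bigr => a _; apply: eq_bigr => b _.
by rewrite IH; apply: eq_bigr => K _ /=; rewrite !weight_fcons.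
Qed.

End PeterWeyl.

(** * The Peter-Weyl map as a bijection and an isometry up to scale *)

Lemma meval_MD n (K : comNzRingType) v (a b c d : mpoly n K) :
  meval v (a * b + c * d) = meval v a * meval v b + meval v c * meval v d.
Proof. by rewrite mevalD !mevalM. Qed.

Lemma meval_MB n (K : comNzRingType) v (a b c d : mpoly n K) :
  meval v (a * b - c * d) = meval v a * meval v b - meval v c * meval v d.
Proof. by rewrite mevalB !mevalM. Qed.

Lemma meval_wide n (K : comNzRingType) (s : seq (multinom n)) v (q : mpoly n K) :
  uniq s -> {subset msupp q <= s} ->
  meval v q = \sum_(m <- s) mcoeff m q * \prod_i v i ^+ m i.
Proof.
move=> us sub; rewrite mevalE [RHS](bigID (fun m => m \in msupp q)) /=.
rewrite [X in _ + X]big1 ?addr0; last first.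
  by move=> m /memN_msupp_eq0 ->; rewrite mul0r.
rewrite -[RHS]big_filter; apply: perm_big; apply: uniq_perm.
- exact: msupp_uniq.
- exact: filter_uniq.
- by move=> m; rewrite mem_filter; case: (boolP (m \in msupp q)) => //= /sub ->.
Qed.

Lemma meval_map_mpoly n (K K' : comNzRingType) (L : {additive K -> K'}) v w
    (p : mpoly n K) :
  (forall c (m : multinom n),
     L (c * \prod_i v i ^+ m i) = L c * \prod_i w i ^+ m i) ->
  meval w (map_mpoly L p) = L (meval v p).
Proof.
move=> Lm; pose s := undup (msupp p ++ msupp (map_mpoly L p)).
rewrite !(@meval_wide _ _ s) ?undup_uniq //;
  try by move=> m mp; rewrite mem_undup mem_cat mp ?orbT.
rewrite raddf_sum; apply: eq_bigr => m _ /=.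
by rewrite mcoeff_map_mpoly Lm.
Qed.

Section PeterWeylImage.
Variables (R : realType) (k : nat).
Local Notation C := R[i].
Local Notation H := (quat R).
Local Notation htens := (htens R k).
Local Notation V := (@Vspace R k).
Implicit Types (g h : nat -> nat -> H) (f : htens) (x : Sp1 R).

(** L stands for the real or the imaginary part. *)
Lemma harmonic_poly_part (L : {additive C -> R}) (p : mpoly 4 C) :
  (forall (c : C) (r : R), L (c * r%:C%C) = L c * r) ->
  laplacian p = 0 -> p \is @ishomog1 4 C k (@mdeg 4) ->
  harmonic_poly k (fun x => L (meval (qccoord x) p)).
Proof.
move=> Lr Lp /dhomogP hp; exists (map_mpoly L p); split.
- apply/dhomogP => m; rewrite mcoeff_msupp mcoeff_map_mpoly => nz; apply: hp.
  by rewrite mcoeff_msupp; apply: contra nz => /eqP ->; rewrite raddf0.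
- apply/mpolyP => m; rewrite mcoeff0 raddf_sum /=.
  transitivity (L (mcoeff m (laplacian p))); last by rewrite Lp mcoeff0 raddf0.
  rewrite /laplacian !raddf_sum; apply: eq_bigr => i _ /=.
  by rewrite !mcoeff_mderiv mcoeff_map_mpoly !raddfMn.
- move=> x; apply/esym/meval_map_mpoly => c m.
  rewrite -Lr rmorph_prod; congr (L (_ * _)).
  by apply: eq_bigr => i _; rewrite rmorphXn.
Qed.

Lemma Vspace_Psi g : V (Psi (wtens k g)).
Proof.
pose p b := hpoly k (fun p q => hcoord (g p q) b).
exists 4, (fun j : 'I_4 => qe R j), (fun (j : 'I_4) x =>
  nth 0 [:: complex.Re (meval (qccoord x) (p false));
            complex.Im (meval (qccoord x) (p false));
            complex.Re (meval (qccoord x) (p true));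
            complex.Im (meval (qccoord x) (p true))] j).
split.
  have hRe b : harmonic_poly k (fun x => complex.Re (meval (qccoord x) (p b))).
    apply: (@harmonic_poly_part (@complex.Re R)).
    - by move=> [a c] r /=; ring.
    - exact: laplacian_hpoly.
    - exact: hpoly_homog.
  have hIm b : harmonic_poly k (fun x => complex.Im (meval (qccoord x) (p b))).
    apply: (@harmonic_poly_part (@complex.Im R)).
    - by move=> [a c] r /=; ring.
    - exact: laplacian_hpoly.
    - exact: hpoly_homog.
  by case=> -[|[|[|[|//]]]] ? /=.
move=> x; apply: hcoordP => b.
rewrite hcoord_Psi hcoord_sum big_ord4 /= -/(p b).
case: b; rewrite /hcoord /=; case: (meval _ _) => a c; apply/eqP;
  rewrite eq_complex /=; apply/andP; split; apply/eqP => /=; ring.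
Qed.

Lemma hpoly_sum n (F : 'I_n -> nat -> nat -> C) (c : 'I_n -> C) j :
  hpoly j (fun p q => \sum_i c i * F i p q) = \sum_i c i *: hpoly j (F i).
Proof.
elim: n F c => [|n IH] F c.
  rewrite big_ord0; under eq_fun do under eq_fun do rewrite big_ord0.
  have := hpolyP j 0 (fun _ _ => 0) (fun _ _ => 0 : C).
  rewrite scale0r add0r => e.
  have := hpolyP j (-1) (fun _ _ => 0) (fun _ _ => 0 : C).
  rewrite scaleN1r addNr => <-; apply: eq_hpoly => p q _ _.
  by rewrite mulr0 addr0.
rewrite big_ord_recl -IH -hpolyP; apply: eq_hpoly => p q _ _.
by rewrite big_ord_recl.
Qed.

Lemma real_harmonic_hpoly (u : Sp1 R -> R) : harmonic_poly k u ->
  exists F, forall x, (u x)%:C%C = meval (qccoord x) (hpoly k F).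
Proof.
move=> [p [hp Lp up]]; pose pc : mpoly 4 C := map_mpoly (real_complex R) p.
have [||F pF] := @harmonic_hpoly R k pc.
- apply/mpolyP => m; rewrite mcoeff0 raddf_sum /=.
  transitivity (real_complex R (mcoeff m (\sum_i mderiv i (mderiv i p)))); last first.
    by rewrite Lp mcoeff0.
  rewrite !raddf_sum; apply: eq_bigr => i _ /=.
  by rewrite !mcoeff_mderiv mcoeff_map_mpoly !raddfMn.
- move/dhomogP: hp => hp; apply/dhomogP => m.
  rewrite mcoeff_msupp mcoeff_map_mpoly => nz; apply: hp.
  by rewrite mcoeff_msupp; apply: contra nz => /eqP ->.
exists F => x; rewrite up -pF.
apply/esym/(@meval_map_mpoly _ _ _ (real_complex R)) => c m /=.
rewrite (rmorphM (real_complex R)) (rmorph_prod (real_complex R)); congr (_ * _).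
by apply: eq_bigr => i _; rewrite rmorphXn.
Qed.

(** Both inclusions are statements about polynomials: hpoly is harmonic, and
    harmonic polynomials are of this form. *)
Lemma VspaceP (sigma : Sp1 R -> H) : V sigma <-> exists g, sigma = Psi (wtens k g).
Proof.
split=> [[n [y [u [hu su]]]]|[g ->]]; last exact: Vspace_Psi.
have [F uF] := choice (fun j => real_harmonic_hpoly (hu j)).
exists (fun p q => \sum_j F j p q *: y j); apply/funext => x; rewrite su.
apply: hcoordP => b; rewrite hcoord_Psi hcoord_sum.
transitivity (meval (qccoord x)
    (hpoly k (fun p q => \sum_j hcoord (y j) b * F j p q))); last first.
  congr meval; apply: eq_hpoly => p q _ _; rewrite hcoord_sum.
  by apply: eq_bigr => j _; rewrite hcoordZ mulrC.
rewrite hpoly_sum raddf_sum; apply: eq_bigr => j _ /=.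
rewrite mevalZ -uF mulrC -hcoordZ; congr (hcoord _ b).
Qed.

Lemma hcoord_quat (u v : C) b :
  hcoord (Quat (complex.Re u) (complex.Im u) (complex.Re v) (complex.Im v)) b =
  if b then v else u.
Proof. by case: b u v => [] [u0 u1] [v0 v1]. Qed.

Definition isometry_factor : R := sphere_moment R mnm0 / k.+1%:R.

Lemma isometry_factor_gt0 : 0 < isometry_factor.
Proof. by rewrite divr_gt0 ?sphere_moment0. Qed.

(** The complex coordinates of conj(sigma) tau are the values of the polynomials A
    and B below, whose terms are products of a polynomial hpoly and the conjugate
    of another: moment_hpoly integrates them. *)
Lemma L2prod_Psi g h : L2prod (Psi (wtens k g)) (Psi (wtens k h)) =
  qreal isometry_factor * hprod (wtens k g) (wtens k h).
Proof.
pose G b := fun p q => hcoord (g p q) b; pose F b := fun p q => hcoord (h p q) b.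
pose P b := hpoly k (G b); pose Q b := hpoly k (F b).
pose I := momentf (@cmoment R).
have IE S T : I (conj_mpoly (hpoly k S) * hpoly k T) =
    isometry_factor%:C%C * cdot k S T.
  rewrite /I (moment_hpoly (@cmoment_rec R)) /isometry_factor /cmoment.
  move: (sphere_moment R mnm0) => u.
  by rewrite (rmorphM (real_complex R)) (fmorphV (real_complex R))
    (rmorph_nat (real_complex R)).
have ev x S : meval (qccoord x) (conj_mpoly S) = (meval (qccoord x) S)^*%C.
  rewrite conj_mpoly.unlock; apply: (@meval_map_mpoly _ _ _ (@conjc R)) => c m /=.
  rewrite (rmorphM (@conjc R)) (rmorph_prod (@conjc R)); congr (_ * _); apply: eq_bigr => i _.
  by rewrite (rmorphXn (@conjc R)); congr (_ ^+ _); exact: conjc_real.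
pose A := conj_mpoly (P false) * Q false + P true * conj_mpoly (Q true).
pose B := conj_mpoly (P false) * Q true - conj_mpoly (Q false) * P true.
have E x : qconj (Psi (wtens k g) x) * Psi (wtens k h) x =
    Quat (complex.Re (meval (qccoord x) A)) (complex.Im (meval (qccoord x) A))
         (complex.Re (meval (qccoord x) B)) (complex.Im (meval (qccoord x) B)).
  apply: hcoordP => b.
  have [e0 e1] := hcoord_qconjM (Psi (wtens k g) x) (Psi (wtens k h) x).
  have hP c : hcoord (Psi (wtens k g) x) c = meval (qccoord x) (P c).
    exact: hcoord_Psi.
  have hQ c : hcoord (Psi (wtens k h) x) c = meval (qccoord x) (Q c).
    exact: hcoord_Psi.
  rewrite hcoord_quat; case: b.
    by rewrite e1 !hP !hQ [RHS]meval_MB (ev x (P false)) (ev x (Q false)).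
  by rewrite e0 !hP !hQ [RHS]meval_MD (ev x (P false)) (ev x (Q true)).
have [A0 A1] := sp_int_meval A; have [B0 B1] := sp_int_meval B.
apply: hcoordP => b.
have -> : L2prod (Psi (wtens k g)) (Psi (wtens k h)) =
    Quat (complex.Re (I A)) (complex.Im (I A)) (complex.Re (I B)) (complex.Im (I B)).
  by rewrite /L2prod (funext E) -A0 -A1 -B0 -B1.
have -> : qreal isometry_factor * hprod (wtens k g) (wtens k h) =
    isometry_factor%:C%C *: hprod (wtens k g) (wtens k h).
  by [].
rewrite hcoord_quat hcoordZ /hprod hcoord_sum.
have IA : I A = isometry_factor%:C%C * (cdot k (G false) (F false) +
    cdot k (F true) (G true)).
  by rewrite /A /I momentfD [P true * _]mulrC -/I (IE (G false)) (IE (F true)) mulrDr.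
have IB : I B = isometry_factor%:C%C * (cdot k (G false) (F true) -
    cdot k (F false) (G true)).
  by rewrite /B /I momentfB -/I (IE (G false)) (IE (F false)) mulrBr.
case: b; rewrite ?IA ?IB !cdotE -?sumrB -?big_split; congr (_ * _);
  apply: eq_bigr => K _; rewrite !ffunE;
  have [e0 e1] := hcoord_qconjM (g (weight K.1) (weight K.2)) (h (weight K.1) (weight K.2)).
  by rewrite e1.
by rewrite e0 [X in _ + X]mulrC.
Qed.
End PeterWeylImage.

(** * Equivariance, and existence of the intertwining isometry *)

Section Equivariance.
Variables (R : realType) (k : nat).
Local Notation C := R[i].
Local Notation H := (quat R).
Local Notation htens := (htens R k).
Local Notation W := (@Wspace R k).
Implicit Types (f : htens) (s t x : Sp1 R) (u : tpow R k).

Definition rep_coef s (a b : bool) : C := hcoord (hbasis R a * spval s^-1%g) b.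

Lemma repE s u J : rep s u J = \sum_(I : midx k) u I * \prod_i rep_coef s (I i) (J i).
Proof. by rewrite /rep sum_ffunE; apply: eq_bigr => I _; rewrite !ffunE. Qed.

Lemma rep_pure_basis s (I : midx k) J :
  rep s (pure_basis R I) J = \prod_i rep_coef s (I i) (J i).
Proof.
rewrite repE (bigD1 I) //= pure_basisE eqxx mul1r [X in _ + X]big1 ?addr0 // => L /negPf LI.
by rewrite pure_basisE LI mul0r.
Qed.

Lemma tensE h0 (w : {ffun midx k * midx k -> C}) K : tens h0 w K = w K *: h0 :> H.
Proof. exact: ffunE. Qed.

Lemma tens2E u v K : tens2 u v K = u K.1 * v K.2.
Proof. exact: ffunE. Qed.

Lemma act_gammaE s t f N : act_gamma s t f N = \sum_(K : midx k * midx k)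
  ((\prod_i rep_coef s (K.1 i) (N.1 i)) * \prod_i rep_coef t (K.2 i) (N.2 i)) *: f K.
Proof.
rewrite /act_gamma sum_ffunE; apply: eq_bigr => K _.
by rewrite tensE tens2E (rep_pure_basis s K.1) (rep_pure_basis t K.2).
Qed.

Lemma act_gammaP s t c f1 f2 :
  act_gamma s t (c *: f1 + f2) = c *: act_gamma s t f1 + act_gamma s t f2.
Proof.
apply/ffunP => N; rewrite !ffunE !act_gammaE scaler_sumr -big_split.
by apply: eq_bigr => K _; rewrite !ffunE scalerDr !scalerA (mulrC c).
Qed.

Lemma rep_sym s u : sym_tensor u -> sym_tensor (rep s u).
Proof.
move=> su p J; rewrite !repE.
pose sh (I : midx k) : midx k := [ffun i => I (p i)].
have sh_inj : injective sh.
  move=> I L /ffunP e; apply/ffunP => i.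
  by have := e (p^-1%g i); rewrite !ffunE permKV.
rewrite (reindex_inj sh_inj); apply: eq_bigr => I _; rewrite su; congr (_ * _).
rewrite [RHS](reindex_inj (@perm_inj _ p)).
by apply: eq_bigr => i _; rewrite !ffunE.
Qed.

Lemma act_gammaD s t f1 f2 : act_gamma s t (f1 + f2) = act_gamma s t f1 + act_gamma s t f2.
Proof. by rewrite -[f1]scale1r act_gammaP !scale1r. Qed.

Lemma act_gamma0 s t : act_gamma s t (0 : htens) = 0.
Proof. by apply: (addIr (act_gamma s t 0)); rewrite -act_gammaD !add0r. Qed.

Lemma act_gamma_W s t f : W f -> W (act_gamma s t f).
Proof.
move=> [n [h [u [v [su sv ->]]]]].
exists n, h, (fun j => rep s (u j)), (fun j => rep t (v j)).
split; try by move=> j; apply: rep_sym.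
rewrite (big_morph (act_gamma s t) (act_gammaD s t) (act_gamma0 s t)).
by apply: eq_bigr => j _; rewrite act_gamma_tens.
Qed.

(** Move t to the other argument of the symplectic form by its invariance. *)
Lemma mvalue_act s t x a b : mvalue (t^-1 * x * s)%g a b =
  \sum_a' \sum_b' rep_coef s a a' * rep_coef t b b' * mvalue x a' b'.
Proof.
rewrite {1}/mvalue -(symplecticM _ _ t^-1%g).
have -> : hbasis R a * spval (t^-1 * x * s)^-1%g * spval t^-1%g =
    hbasis R a * spval s^-1%g * spval x^-1%g.
  rewrite -!mulrA -!spvalM; congr (_ * spval _).
  by rewrite !invgM invgK -!mulgA mulgV mulg1.
rewrite [hbasis R a * _]hbasis_sum mulr_suml.
under eq_bigr => c _ do rewrite -scale_mulr.
rewrite symplectic_suml; apply: eq_bigr => a' _.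
rewrite [hbasis R b * _]hbasis_sum symplectic_sumr mulr_sumr.
by apply: eq_bigr => b' _; rewrite mulrA.
Qed.

Lemma Psi_act s t f x : Psi (act_gamma s t f) x = Psi f (t^-1 * x * s)%g.
Proof.
rewrite /Psi; under eq_bigr => N _ do rewrite act_gammaE scaler_sumr.
rewrite exchange_big; apply: eq_bigr => K _ /=.
under eq_bigr => N _ do rewrite scalerA.
rewrite -scaler_suml; congr (_ *: _).
under [RHS]eq_bigr => i _ do rewrite mvalue_act.
rewrite bigA_distr_bigA -(pair_bigA _ (fun N1 N2 : midx k =>
  (\prod_i mvalue x (N1 i) (N2 i)) * ((\prod_i rep_coef s (K.1 i) (N1 i)) *
   \prod_i rep_coef t (K.2 i) (N2 i)))).
apply: eq_bigr => N1 _; rewrite bigA_distr_bigA; apply: eq_bigr => N2 _.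
by rewrite -!big_split; apply: eq_bigr => i _; rewrite mulrC.
Qed.
End Equivariance.

Section Isometry.
Variables (R : realType) (k : nat).
Local Notation C := R[i].
Local Notation H := (quat R).
Local Notation htens := (htens R k).
Local Notation W := (@Wspace R k).
Local Notation V := (@Vspace R k).
Implicit Types (f : htens) (s t x : Sp1 R).

Lemma hprod0 f : hprod f f = 0 -> f = 0.
Proof.
move=> /(congr1 (@q0 R)); rewrite /hprod.
have q0D : {morph @q0 R : x y / x + y} by [].
rewrite (big_morph (@q0 R) q0D (erefl _)) => e.
have sq K : 0 <= q0 (qconj (f K) * f K).
  rewrite (_ : q0 _ = q0 (f K) ^+ 2 + q1 (f K) ^+ 2 + q2 (f K) ^+ 2 + q3 (f K) ^+ 2).
    by rewrite !addr_ge0 ?sqr_ge0.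
  by rewrite /=; ring.
apply/ffunP => K; rewrite ffunE; have := psumr_eq0P (fun K _ => sq K) e (i := K) isT.
rewrite (_ : q0 _ = q0 (f K) ^+ 2 + q1 (f K) ^+ 2 + q2 (f K) ^+ 2 + q3 (f K) ^+ 2);
  last by rewrite /=; ring.
move=> /eqP; rewrite !paddr_eq0 ?addr_ge0 ?sqr_ge0 // !sqrf_eq0.
by move=> /andP[/andP[/andP[/eqP a0 /eqP a1] /eqP a2] /eqP a3]; apply: quat_eqP.
Qed.

Lemma Wspace_lin c f1 f2 : W f1 -> W f2 -> W (c *: f1 + f2).
Proof.
move=> /WspaceP[g1 ->] /WspaceP[g2 ->]; apply/WspaceP.
by exists (fun p q => c *: g1 p q + g2 p q); rewrite wtensP.
Qed.

Lemma L2prod_PsiW f1 f2 : W f1 -> W f2 ->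
  L2prod (Psi f1) (Psi f2) = qreal (isometry_factor R k) * hprod f1 f2.
Proof. by move=> /WspaceP[g1 ->] /WspaceP[g2 ->]; exact: L2prod_Psi. Qed.

Lemma Psi_inj f1 f2 : W f1 -> W f2 -> Psi f1 = Psi f2 -> f1 = f2.
Proof.
move=> W1 W2 e; pose d := -1 *: f2 + f1.
have Wd : W d by exact: Wspace_lin.
have d0 : Psi d = Psi (0 : htens).
  apply/funext => x; rewrite PsiP e scaleN1r addNr.
  by rewrite /Psi big1 // => K _; rewrite ffunE scaler0.
have := L2prod_PsiW Wd Wd; rewrite {2}d0 (L2prod_PsiW Wd (Wspace0 R k)).
have -> : hprod d 0 = 0.
  by rewrite /hprod big1 // => K _; rewrite [(0 : htens) K]ffunE mulr0.
rewrite mulr0 => /esym dd; have {}dd : hprod d d = 0.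
  have c0 := isometry_factor_gt0 R k.
  have : qreal (isometry_factor R k)^-1 * (qreal (isometry_factor R k) * hprod d d) = 0.
    by rewrite dd mulr0.
  rewrite mulrA (_ : qreal _ * qreal _ = 1) ?mul1r //.
  by apply: quat_eqP => /=; rewrite ?(mulVf (lt0r_neq0 c0)); ring.
by have /eqP := hprod0 dd; rewrite /d scaleN1r addrC subr_eq0 => /eqP.
Qed.

Definition Psi_inv (sigma : Sp1 R -> H) : htens := xget 0 [set f | W f /\ Psi f = sigma].

Lemma Psi_invP sigma : V sigma -> W (Psi_inv sigma) /\ Psi (Psi_inv sigma) = sigma.
Proof.
move=> /VspaceP[g ->]; apply: (@xgetPex _ 0 [set f | W f /\ Psi f = Psi (wtens k g)]).
by exists (wtens k g); split => //; apply/WspaceP; exists g.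
Qed.

Lemma Psi_invK f : W f -> Psi_inv (Psi f) = f.
Proof.
move=> Wf; have VP : V (Psi f).
  by apply/VspaceP; case/WspaceP: Wf => g ->; exists g.
by have [W' e] := Psi_invP VP; exact: Psi_inj.
Qed.

Lemma hmulr_W f (y : H) : W f -> W (hmulr f y).
Proof.
move=> /WspaceP[g ->]; apply/WspaceP; exists (fun p q => g p q * y).
by apply/ffunP => K; rewrite !ffunE.
Qed.

(** The inverse of Psi, rescaled by the square root of isometry_factor. *)
Lemma exists_intertwining_isometry :
  exists Phi : (Sp1 R -> H) -> htens, intertwining_isometry Phi.
Proof.
pose c := isometry_factor R k; have c0 : 0 < c := isometry_factor_gt0 R k.
pose r : C := (Num.sqrt c)%:C%C.
have rn0 : r != 0 by rewrite fmorph_eq0 sqrtr_eq0 -ltNge.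
have WZ a f : W f -> W (a *: f).
  by move=> Wf; rewrite -[_ *: _]addr0; apply: Wspace_lin => //; exact: Wspace0.
exists (fun sigma => r *: Psi_inv sigma); split.
- split=> [sigma /= Vs|sigma tau|w Ww].
  + by apply: WZ; case: (Psi_invP Vs).
  + rewrite !inE => Vs Vt /(scalerI rn0) e.
    by have [_ <-] := Psi_invP Vs; have [_ <-] := Psi_invP Vt; rewrite e.
  + exists (Psi (r^-1 *: w)).
      by apply/VspaceP; have /WspaceP[g ->] := WZ r^-1 w Ww; exists g.
    by rewrite Psi_invK ?scalerA ?mulfV ?scale1r //; exact: WZ.
- move=> sigma tau Vs Vt; rewrite -scalerDr; congr (_ *: _).
  have [W1 e1] := Psi_invP Vs; have [W2 e2] := Psi_invP Vt.
  have Wd := WspaceD W1 W2; rewrite -[RHS](Psi_invK Wd); congr Psi_inv.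
  by apply/funext => x; rewrite -[Psi_inv sigma]scale1r PsiP scale1r e1 e2.
- move=> sigma y Vs; have [W1 e1] := Psi_invP Vs.
  transitivity (r *: hmulr (Psi_inv sigma) y); last first.
    by apply/ffunP => K; rewrite !ffunE scale_mulr.
  congr (_ *: _); rewrite -[RHS](Psi_invK (hmulr_W y W1)); congr Psi_inv.
  by apply/funext => x; rewrite Psi_hmulr e1.
- move=> sigma tau Vs Vt.
  have [W1 e1] := Psi_invP Vs; have [W2 e2] := Psi_invP Vt.
  rewrite -{2}e1 -{2}e2 (L2prod_PsiW W1 W2) /hprod mulr_sumr.
  apply: eq_bigr => K _; rewrite !ffunE /r -/c.
  transitivity (qreal (Num.sqrt c * Num.sqrt c) *
      (qconj (Psi_inv sigma K) * Psi_inv tau K)).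
    by apply: quat_eqP => /=; ring.
  by rewrite -expr2 sqr_sqrtr // ltW.
- move=> s t sigma Vs; have [W1 e1] := Psi_invP Vs.
  have -> : act_gamma s t (r *: Psi_inv sigma) = r *: act_gamma s t (Psi_inv sigma).
    by rewrite -[r *: Psi_inv _]addr0 act_gammaP act_gamma0 addr0.
  congr (_ *: _); rewrite -[RHS](Psi_invK (act_gamma_W s t W1)); congr Psi_inv.
  by apply/funext => x; rewrite Psi_act e1.
Qed.
End Isometry.

(** * Transport of the left-invariant derivatives *)

Section QuaternionDerivatives.
Variable R : realType.
Local Notation H := (quat R).
Implicit Types (F G : R -> H) (t : R) (x y : H).

Definition is_qder F t x : Prop :=
  [/\ is_derive t 1 (fun r => q0 (F r)) (q0 x), is_derive t 1 (fun r => q1 (F r)) (q1 x),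
      is_derive t 1 (fun r => q2 (F r)) (q2 x) & is_derive t 1 (fun r => q3 (F r)) (q3 x)].

Lemma is_qderE F t x : is_qder F t x -> qderive F t = x.
Proof.
move=> [d0 d1 d2 d3].
by apply: quat_eqP; rewrite /qderive /coordwise /= derive1E derive_val.
Qed.

Lemma is_qder_eq F t x y : is_qder F t x -> x = y -> is_qder F t y.
Proof. by move=> d <-. Qed.

Lemma is_qder_cst x t : is_qder (fun _ => x) t 0.
Proof. by split; exact: is_derive_cst. Qed.

Lemma is_qderD F G t x y : is_qder F t x -> is_qder G t y ->
  is_qder (fun r => F r + G r) t (x + y).
Proof.
by move=> [f0 f1 f2 f3] [g0 g1 g2 g3]; split; exact: is_deriveD.
Qed.

Lemma is_qderM F G t x y : is_qder F t x -> is_qder G t y ->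
  is_qder (fun r => F r * G r) t (x * G t + F t * y).
Proof.
move=> [f0 f1 f2 f3] [g0 g1 g2 g3].
have dM (u v : R -> R) a b : is_derive t 1 u a -> is_derive t 1 v b ->
    is_derive t 1 (fun r => u r * v r) (u t * b + v t * a).
  by move=> du dv; exact: is_deriveM.
have dD (u v : R -> R) a b : is_derive t 1 u a -> is_derive t 1 v b ->
    is_derive t 1 (fun r => u r + v r) (a + b).
  by move=> du dv; exact: is_deriveD.
have dB (u v : R -> R) a b : is_derive t 1 u a -> is_derive t 1 v b ->
    is_derive t 1 (fun r => u r - v r) (a - b).
  by move=> du dv; exact: is_deriveB.
split.
- apply: (is_derive_eq (dB _ _ _ _ (dB _ _ _ _ (dB _ _ _ _ (dM _ _ _ _ f0 g0)
    (dM _ _ _ _ f1 g1)) (dM _ _ _ _ f2 g2)) (dM _ _ _ _ f3 g3))) => /=; ring.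
- apply: (is_derive_eq (dB _ _ _ _ (dD _ _ _ _ (dD _ _ _ _ (dM _ _ _ _ f0 g1)
    (dM _ _ _ _ f1 g0)) (dM _ _ _ _ f2 g3)) (dM _ _ _ _ f3 g2))) => /=; ring.
- apply: (is_derive_eq (dD _ _ _ _ (dD _ _ _ _ (dB _ _ _ _ (dM _ _ _ _ f0 g2)
    (dM _ _ _ _ f1 g3)) (dM _ _ _ _ f2 g0)) (dM _ _ _ _ f3 g1))) => /=; ring.
- apply: (is_derive_eq (dD _ _ _ _ (dB _ _ _ _ (dD _ _ _ _ (dM _ _ _ _ f0 g3)
    (dM _ _ _ _ f1 g2)) (dM _ _ _ _ f2 g1)) (dM _ _ _ _ f3 g0))) => /=; ring.
Qed.

Lemma is_qder_sum (J : Type) (s : seq J) (F : J -> R -> H) (x : J -> H) t :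
  (forall j, is_qder (F j) t (x j)) ->
  is_qder (fun r => \sum_(j <- s) F j r) t (\sum_(j <- s) x j).
Proof.
move=> dF; elim: s => [|j s IH].
  rewrite big_nil (_ : (fun r => _) = fun _ => 0); first exact: is_qder_cst.
  by apply/funext => r; rewrite big_nil.
rewrite big_cons (_ : (fun r => _) = fun r => F j r + \sum_(i <- s) F i r).
  exact: is_qderD.
by apply/funext => r; rewrite big_cons.
Qed.

Lemma is_qder_conj F t x : is_qder F t x -> is_qder (fun r => qconj (F r)) t (qconj x).
Proof. by move=> [f0 f1 f2 f3]; split => //; exact: is_deriveN. Qed.

Lemma is_qder_hcoord F t x b : is_qder F t x ->
  is_qder (fun r => qcplx (hcoord (F r) b)) t (qcplx (hcoord x b)).
Proof.
by move=> [f0 f1 f2 f3]; case: b; split=> //=; exact: is_derive_cst.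
Qed.

Lemma is_qder_exp (i : 'I_3) : is_qder (fun t => spval (sp_exp i t)) 0 (qe R i.+1).
Proof.
rewrite (_ : (fun t => _) = fun t => qreal (cos t) + qreal (sin t) * qe R i.+1); last first.
  by apply/funext => t; rewrite /= qexpE.
have dc : is_qder (fun t : R => qreal (cos t)) 0 0.
  split; try exact: is_derive_cst; apply: (is_derive_eq (is_derive_cos 0)).
  by rewrite sin0 oppr0.
have ds : is_qder (fun t : R => qreal (sin t)) 0 1.
  split; try exact: is_derive_cst; apply: (is_derive_eq (is_derive_sin 0)).
  by rewrite cos0.
apply: is_qder_eq; first by apply: is_qderD dc (is_qderM ds (is_qder_cst _ _)).
by rewrite mulr0 addr0 mul1r add0r.
Qed.
End QuaternionDerivatives.

Section InfinitesimalAction.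
Variables (R : realType).
Local Notation C := R[i].
Local Notation H := (quat R).

(** The tensor power of a matrix c, applied to the symmetric tensor with
    coordinates u. *)
Definition tpow_mx k (c : bool -> bool -> C) (u : nat -> H) (J : midx k) : H :=
  \sum_(I : midx k) (\prod_i c (I i) (J i)) *: u (weight I).

(** Leibniz rule for the coefficient at a multi-index of weight p: the derivative c
    of the matrix acts at one of its k - p entries e0 or of its p entries e2, and
    the other entries are fixed. *)
Definition tpow_diff (k p : nat) (c : bool -> bool -> C) (u : nat -> H) : H :=
  qreal (k%:R - p%:R) * (c false false *: u p + c true false *: u p.+1) +
  qreal p%:R * (c false true *: u p.-1 + c true true *: u p).

Lemma tpow_mxS k c u (a : bool) (J : midx k) :
  tpow_mx c u (fcons a J) = \sum_b c b a *: tpow_mx c (fun p => u (b + p)%N) J.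
Proof.
rewrite /tpow_mx sum_fcons; apply: eq_bigr => b _.
rewrite scaler_sumr; apply: eq_bigr => I _.
rewrite big_ord_recl !fcons0 weight_fcons scalerA; congr (_ * _ *: _).
by apply: eq_bigr => i _; rewrite !fconsS.
Qed.

Lemma tpow_mx1 k (c : bool -> bool -> C) u (J : midx k) :
  (forall a b, c a b = (a == b)%:R) -> tpow_mx c u J = u (weight J).
Proof.
move=> cE; rewrite /tpow_mx (bigD1 J) //= [X in _ + X]big1 ?addr0; last first.
  move=> I IJ; have [i /negPf di] : exists i, I i != J i.
    apply/existsP; rewrite -negb_forall; apply: contra IJ => /forallP e.
    by apply/eqP/ffunP => i; rewrite (eqP (e i)).
  by rewrite (bigD1 i) //= cE di mul0r scale0r.
by rewrite big1 ?scale1r // => i _; rewrite cE eqxx.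
Qed.

(** Induction on the number of factors: the product rule for the first factor,
    the induction hypothesis for the others. *)
Lemma is_qder_tpow k (c : R -> bool -> bool -> C) (c' : bool -> bool -> C) u (J : midx k) :
  (forall a b, c 0 a b = (a == b)%:R) ->
  (forall a b, is_qder (fun t => qcplx (c t a b)) 0 (qcplx (c' a b))) ->
  is_qder (fun t => tpow_mx (c t) u J) 0 (tpow_diff k (weight J) c' u).
Proof.
move=> c0 dc; elim: k u J => [|k IH] u J.
  rewrite (_ : (fun t => _) = fun _ => u 0%N).
    apply: (is_qder_eq (is_qder_cst _ _)).
    rewrite /weight big_ord0 /tpow_diff subrr.
    by apply: quat_eqP => /=; ring.
  apply/funext => t; rewrite /tpow_mx (bigD1 J) //= [X in _ + X]big1 ?addr0.
    by rewrite big_ord0 scale1r /weight big_ord0.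
  by move=> I /eqP; case; apply/ffunP => -[].
rewrite -(fcons_surj J); move: (J ord0) [ffun i => _] => a L.
rewrite (_ : (fun t => _) = fun t =>
   \sum_b qcplx (c t b a) * tpow_mx (c t) (fun p => u (b + p)%N) L); last first.
  by apply/funext => t; rewrite tpow_mxS.
apply: is_qder_eq; first by apply: is_qder_sum => b; apply: is_qderM (dc b a) (IH _ _).
rewrite weight_fcons; under eq_bigr => b _ do rewrite tpow_mx1 // c0.
rewrite big_bool /tpow_diff /=; move: (weight L) => p {IH dc c0 c L J}.
have q1E : qcplx 1 = 1 :> H by apply: quat_eqP.
have q0E : qcplx 0 = 0 :> H by apply: quat_eqP.
have kp : k.+1%:R - p.+1%:R = k%:R - p%:R :> R by rewrite -!natr1; ring.
case: a => /=; rewrite q1E q0E mul1r mul0r addr0 ?add1n ?add0n ?kp.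
- case: p kp => [|p] _ /=; rewrite -?[p.+2%:R]natr1.
    rewrite subr0; move: (k%:R) => r.
    by apply: quat_eqP => /=; ring.
  move: (p.+1%:R) (k%:R) => r r'; apply: quat_eqP => /=; ring.
- rewrite -[k.+1%:R]natr1; move: (k%:R) (p%:R) => r r'.
  by apply: quat_eqP => /=; ring.
Qed.

(** The matrix of minus the right multiplication by e_(i+1) in the basis e0, e2:
    the derivative at 0 of the action of exp (t e_(i+1)) on C^2. *)
Definition rep_diff (i : 'I_3) (a b : bool) : C :=
  hcoord (hbasis R a * qconj (qe R i.+1)) b.

Lemma rep_coef1 (a b : bool) : rep_coef (1 : Sp1 R)%g a b = (a == b)%:R.
Proof.
rewrite /rep_coef invg1 /=.
by case: a b => [] []; apply/eqP; rewrite eq_complex /=; apply/andP; split;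
  apply/eqP => /=; ring.
Qed.

Lemma sp_exp0 (i : 'I_3) : sp_exp i 0 = 1%g :> Sp1 R.
Proof.
apply: val_inj; rewrite /= qexpE cos0 sin0.
by apply: quat_eqP => /=; ring.
Qed.

Lemma is_qder_rep (i : 'I_3) a b :
  is_qder (fun t => qcplx (rep_coef (sp_exp i t : Sp1 R) a b)) 0
    (qcplx (rep_diff i a b)).
Proof.
apply: is_qder_hcoord; apply: is_qder_eq.
  exact: is_qderM (is_qder_cst _ _) (is_qder_conj (is_qder_exp R i)).
by rewrite mul0r add0r.
Qed.

Lemma act_gamma_wtens k (s : Sp1 R) (g : nat -> nat -> H) N :
  act_gamma s 1%g (wtens k g) N =
  tpow_mx (rep_coef s) (fun p => g p (weight N.2)) N.1.
Proof.
rewrite act_gammaE; under eq_bigr => K _ do rewrite [wtens k g K]ffunE.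
rewrite -(pair_bigA _ (fun I J : midx k =>
  ((\prod_i rep_coef s (I i) (N.1 i)) * \prod_i rep_coef 1%g (J i) (N.2 i)) *:
   g (weight I) (weight J))).
apply: eq_bigr => I _.
under eq_bigr => J _ do rewrite -scalerA.
rewrite -scaler_sumr; congr (_ *: _).
exact: (tpow_mx1 (fun q => g (weight I) q) N.2 rep_coef1).
Qed.
End InfinitesimalAction.

Section Transport.
Variables (R : realType) (k : nat).
Local Notation H := (quat R).
Local Notation htens := (htens R k).
Local Notation W := (@Wspace R k).
Local Notation V := (@Vspace R k).
Implicit Types (g : nat -> nat -> H) (sigma : Sp1 R -> H).

Lemma VspaceD sigma tau : V sigma -> V tau -> V (fun x => sigma x + tau x).
Proof.
move=> /VspaceP[g ->] /VspaceP[h ->]; apply/VspaceP.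
exists (fun p q => 1 *: g p q + h p q); apply/funext => x.
by rewrite wtensP PsiP scale1r.
Qed.

Lemma Vspace_mulr sigma y : V sigma -> V (fun x => sigma x * y).
Proof.
move=> /VspaceP[g ->]; apply/VspaceP; exists (fun p q => g p q * y).
apply/funext => x; rewrite -Psi_hmulr; congr (Psi _ x).
by apply/ffunP => K; rewrite !ffunE.
Qed.

Lemma Vspace0 : V (fun _ => 0).
Proof.
apply/VspaceP; exists (fun _ _ => 0); apply/funext => x; rewrite /Psi big1 // => K _.
by rewrite ffunE scaler0.
Qed.

Lemma Vspace_act s t sigma : V sigma -> V (act_beta s t sigma).
Proof.
move=> /VspaceP[g ->]; have /WspaceP[h e] : W (act_gamma s t (wtens k g)).
  by apply: act_gamma_W; apply/WspaceP; exists g.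
by apply/VspaceP; exists h; apply/funext => x; rewrite -e Psi_act.
Qed.

Variable Phi : (Sp1 R -> H) -> htens.
Hypothesis iPhi : intertwining_isometry Phi.

Lemma Phi0 : Phi (fun _ => 0) = 0.
Proof.
have := phi_add iPhi Vspace0 Vspace0.
rewrite (_ : (fun x => _) = fun _ => 0); last by apply/funext => x; rewrite addr0.
by move=> /eqP; rewrite -subr_eq0 opprD addrA subrr sub0r oppr_eq0 => /eqP.
Qed.

Lemma Phi_sum n (S : 'I_n -> Sp1 R -> H) : (forall j, V (S j)) ->
  V (fun x => \sum_j S j x) /\ Phi (fun x => \sum_j S j x) = \sum_j Phi (S j).
Proof.
elim: n S => [|n IH] S VS.
  rewrite big_ord0 (_ : (fun x => _) = fun _ => 0).
    by split; [exact: Vspace0|exact: Phi0].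
  by apply/funext => x; rewrite big_ord0.
have [V' e] := IH _ (fun j => VS (lift ord0 j)).
rewrite (_ : (fun x => _) =
  fun x => S ord0 x + \sum_j S (lift ord0 j) x); last first.
  by apply/funext => x; rewrite big_ord_recl.
by split; [exact: VspaceD|rewrite (phi_add iPhi) // e big_ord_recl].
Qed.

(** The weight tensors are a basis of H (x) (H_k (x) H_k) over H acting on the right,
    so that the inverse of Phi is given by finitely many fixed spinors. *)
Lemma Phi_inverse : exists S : 'I_k.+1 -> 'I_k.+1 -> Sp1 R -> H, forall g,
  V (fun x => \sum_p \sum_q S p q x * g p q) /\
  Phi (fun x => \sum_p \sum_q S p q x * g p q) = wtens k g.
Proof.
pose b p q : htens := tens 1 (tens2 (weight_ind R k p) (weight_ind R k q)).
have [_ _ surj] := phi_bij iPhi.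
have Wb (pq : 'I_k.+1 * 'I_k.+1) : W (b pq.1 pq.2).
  exists 1%N, (fun=> 1), (fun=> weight_ind R k pq.1), (fun=> weight_ind R k pq.2).
  by split=> [_|_|]; rewrite ?big_ord1 //; exact: weight_ind_sym.
have ex (pq : 'I_k.+1 * 'I_k.+1) : exists s, V s /\ Phi s = b pq.1 pq.2.
  by have [s Vs es] := surj _ (Wb pq); exists s.
have [S SP] := choice ex.
exists (fun p q => S (p, q)) => g.
have VS p q : V (fun x => S (p, q) x * g p q).
  by apply: Vspace_mulr; case: (SP (p, q)).
have VS2 p : V (fun x => \sum_q S (p, q) x * g p q).
  by case: (Phi_sum (fun q => VS p q)).
have [VS3 ->] := Phi_sum VS2; split=> //.
rewrite wtensE; apply: eq_bigr => p _.
have [_ ->] := Phi_sum (fun q => VS p q); apply: eq_bigr => q _.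
have [VSpq e] := SP (p, q).
by rewrite (phi_mulr iPhi) // e hmulr_tens mul1r.
Qed.

Lemma Phi_eq sigma tau : V sigma -> V tau -> Phi sigma = Phi tau -> sigma = tau.
Proof.
by have [_ inj _] := phi_bij iPhi; move=> Vs Vt; apply: inj; rewrite inE.
Qed.

(** Differentiate the equivariance of Phi along a one-parameter subgroup. *)
Lemma Phi_left_deriv (i : 'I_3) sigma g : V sigma -> Phi sigma = wtens k g ->
  V (left_deriv i sigma) /\ Phi (left_deriv i sigma) =
    wtens k (fun p q => tpow_diff k p (rep_diff R i) (fun p' => g p' q)).
Proof.
move=> Vs e; have [S SP] := Phi_inverse.
pose G t p q := act_gamma (sp_exp i t) 1%g (wtens k g) (first_ones k p, first_ones k q).
have GE t x : sigma (x * sp_exp i t)%g = \sum_p \sum_q S p q x * G t p q.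
  have [VG eG] := SP (G t).
  have VA := Vspace_act (sp_exp i t) 1%g Vs.
  suff : act_beta (sp_exp i t) 1%g sigma = fun x => \sum_p \sum_q S p q x * G t p q.
    by move=> /(congr1 (fun u => u x)); rewrite /act_beta invg1 mul1g.
  apply: Phi_eq => //; rewrite (phi_equivariant iPhi) // e eG.
  have /WspaceP[h hE] : W (act_gamma (sp_exp i t) 1%g (wtens k g)).
    by apply: act_gamma_W; apply/WspaceP; exists g.
  apply/ffunP => K; rewrite [RHS]ffunE /G hE !ffunE /=.
  by rewrite !weight_first_ones ?weight_le.
pose G' p q := tpow_diff k p (rep_diff R i) (fun p' => g p' q).
have [VG' eG'] := SP G'.
have -> : left_deriv i sigma = fun x => \sum_p \sum_q S p q x * G' p q.
  apply/funext => x; apply: is_qderE.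
  rewrite (_ : (fun r => _) = fun t => \sum_p \sum_q S p q x * G t p q); last first.
    by apply/funext => t; rewrite GE.
  apply: is_qder_sum => p; apply: is_qder_sum => q.
  apply: is_qder_eq.
    apply: is_qderM (is_qder_cst _ _) _.
    rewrite (_ : (fun t => _) = fun t => tpow_mx (rep_coef (sp_exp i t))
        (fun p' => g p' (weight (first_ones k q))) (first_ones k p)); last first.
      by apply/funext => t; rewrite /G act_gamma_wtens.
    apply: is_qder_tpow => a b; last exact: is_qder_rep.
    by rewrite sp_exp0 rep_coef1.
  by rewrite mul0r add0r !weight_first_ones // -ltnS.
by [].
Qed.
End Transport.

(** * The transported Dirac operator *)

Section TransportedDirac.
Variables (R : realType) (k : nat).
Local Notation C := R[i].
Local Notation H := (quat R).
Local Notation htens := (htens R k).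
Local Notation V := (@Vspace R k).
Implicit Types (g : nat -> nat -> H) (sigma : Sp1 R -> H).

(** The weight coordinates of the Dirac operator. It couples only the component
    e0 at weight p with the component e2 at weight p - 1. *)
Definition dirac_block g (p q : nat) : H :=
  ((2 * p%:R - k%:R - 3 / 2)%:C%C * hcoord (g p q) false -
   (2 * p%:R)%:C%C * hcoord (g p.-1 q) true) *: qe R 0 +
  ((k%:R - 2 * p%:R - 3 / 2)%:C%C * hcoord (g p q) true -
   (2 * (k%:R - p%:R))%:C%C * hcoord (g p.+1 q) false) *: qe R 2.

Lemma dirac_blockE g p q :
  \sum_(i < 3) tpow_diff k p (rep_diff R i) (fun p' => g p' q) * - qe R i.+1 +
    g p q * qreal (- (3 / 2)) = dirac_block g p q.
Proof.
rewrite !big_ord_recl big_ord0 addr0 /dirac_block /tpow_diff /rep_diff /=.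
move: (g p q) (g p.-1 q) (g p.+1 q) (k%:R) (p%:R) => [a0 a1 a2 a3] [b0 b1 b2 b3]
  [c0 c1 c2 c3] r s.
by apply: quat_eqP => /=; field.
Qed.

Lemma Phi_dirac (Phi : (Sp1 R -> H) -> htens) sigma g :
  intertwining_isometry Phi -> V sigma -> Phi sigma = wtens k g ->
  V (dirac_op sigma) /\ Phi (dirac_op sigma) = wtens k (dirac_block g).
Proof.
move=> iPhi Vs e.
have d (i : 'I_3) := Phi_left_deriv iPhi i Vs e.
have Vd (i : 'I_3) : V (fun x => left_deriv i sigma x * - qe R i.+1).
  by apply: Vspace_mulr; case: (d i).
have [Vsum esum] := Phi_sum iPhi Vd.
have Vm := Vspace_mulr (qreal (- (3 / 2))) Vs.
rewrite (_ : dirac_op sigma = fun x =>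
  \sum_(i < 3) left_deriv i sigma x * - qe R i.+1 + sigma x * qreal (- (3 / 2))).
  split; first exact: VspaceD.
  rewrite (phi_add iPhi) // esum (phi_mulr iPhi) // e.
  apply/ffunP => K; rewrite !ffunE -dirac_blockE sum_ffunE; congr (_ + _).
  apply: eq_bigr => i _; have [V' e'] := d i.
  by rewrite (phi_mulr iPhi) // e' !ffunE.
apply/funext => x; rewrite Defs.diracE -sumrN; congr (_ + _).
  by apply: eq_bigr => i _; rewrite mulrN.
by case: (sigma x) => a b c u; apply: quat_eqP => /=; ring.
Qed.
End TransportedDirac.

Section KetTensors.
Variables (R : realType) (k : nat).

Lemma sum_weight_ind d : \sum_(J : midx k) weight_ind R k d J = 'C(k, d)%:R.
Proof.
under eq_bigr do rewrite ffunE.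
elim: k d => [|j IH] d.
  rewrite (bigD1 [ffun=> false]) //= big1 ?addr0.
    by rewrite /weight big_ord0 bin0n eq_sym.
  by move=> J /eqP; case; apply/ffunP => -[].
rewrite sum_fcons big_bool /=.
under eq_bigr do rewrite weight_fcons.
under [X in _ + X]eq_bigr do rewrite weight_fcons.
rewrite IH; case: d => [|d].
  by rewrite bin0 big1 ?add0r ?bin0 // => J _; rewrite add1n.
rewrite binS natrD addrC; congr (_ + _); rewrite -IH.
by apply: eq_bigr => J _; rewrite add1n eqSS.
Qed.

Lemma ket_sym d : sym_tensor (ket R k d).
Proof.
move=> s J; rewrite /ket !ffunE; congr (_ * _); rewrite !sum_ffunE.
rewrite [LHS](reindex_inj (mulgI s)); apply: eq_bigr => u _; rewrite !ffunE.
rewrite [RHS](reindex_inj (@perm_inj _ s)); apply: eq_bigr => i _.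
by rewrite !ffunE permM.
Qed.

Lemma pure_ket (d : nat) (u : 'S_k) (J : midx k) :
  pure (fun i => if (u i < k - d)%N then qe R 0 else qe R 2) J =
  (J == [ffun i => ~~ first_ones k (k - d) (u i)])%:R.
Proof.
rewrite -pure_basisE /pure_basis; congr ((pure _) J); apply/funext => i.
by rewrite !ffunE /hbasis; case: ltnP.
Qed.

Lemma weight_lastones d (u : 'S_k) : (d <= k)%N ->
  weight [ffun i => ~~ first_ones k (k - d) (u i)] = d.
Proof.
move=> dk.
have := weight_perm [ffun i => ~~ first_ones k (k - d) i] u.
rewrite (_ : [ffun i => [ffun _ => _] (u i)] =
  [ffun i => ~~ first_ones k (k - d) (u i)]); last by apply/ffunP => i; rewrite !ffunE.
move=> ->; have := weight_first_ones (leq_subr d k).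
have : (weight (first_ones k (k - d)) +
        weight [ffun i => ~~ first_ones k (k - d) i] = k)%N.
  rewrite /weight -big_split /= -[RHS](card_ord k) -sum1_card.
  by apply: eq_bigr => i _; rewrite !ffunE; case: ltnP.
by move=> e1 e2; rewrite e2 in e1; lia.
Qed.

(** The nonzero coefficients of |d> add up to 1; they are all equal, and their
    number is a binomial coefficient. *)
Lemma ketE d : (d <= k)%N -> ket R k d = 'C(k, d)%:R^-1 *: weight_ind R k d.
Proof.
move=> dk; pose c := ket R k d (first_ones k d).
have kJ J : ket R k d J = c * weight_ind R k d J.
  rewrite [weight_ind _ _ _ J]ffunE; have [wJ|wJ] := eqVneq (weight J) d.
    rewrite mulr1; apply: sym_tensor_weight (ket_sym d) _.
    by rewrite weight_first_ones.
  rewrite mulr0 /ket ffunE sum_ffunE big1 ?scaler0 // => u _; rewrite pure_ket.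
  by case: eqP => // JE; move: wJ; rewrite JE weight_lastones ?eqxx.
have kc : ket R k d = c *: weight_ind R k d.
  by apply/ffunP => J; rewrite kJ [RHS]ffunE.
have : \sum_J ket R k d J = 1.
  transitivity (k`!%:R^-1 * \sum_J \sum_(u : 'S_k)
      pure (fun i => if (u i < k - d)%N then qe R 0 else qe R 2) J).
    by rewrite mulr_sumr; apply: eq_bigr => J _; rewrite /ket ffunE sum_ffunE.
  rewrite exchange_big /=.
  under eq_bigr => u _.
    under eq_bigr => J _ do rewrite pure_ket.
    rewrite (bigD1 [ffun i => ~~ first_ones k (k - d) (u i)]) //= eqxx.
    rewrite [X in _ + X]big1 ?addr0; last by move=> J /negPf ->.
    over.
  rewrite sumr_const card_Sn mulVf // pnatr_eq0 -lt0n fact_gt0 //.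
under eq_bigr do rewrite kJ.
rewrite -mulr_sumr sum_weight_ind kc => e.
congr (_ *: _); apply: (mulIf (_ : 'C(k, d)%:R != 0)).
  by rewrite pnatr_eq0 -lt0n bin_gt0.
by rewrite mulVf ?e // pnatr_eq0 -lt0n bin_gt0.
Qed.

End KetTensors.

(** * Orthogonality and the two-dimensional blocks *)

Section HermitianProduct.
Variables (R : realType) (k : nat).
Local Notation C := R[i].
Local Notation htens := (htens R k).
Implicit Types (u v w : htens) (X : seq htens).

Lemma hdotPr u v w c : hdot u (c *: v + w) = c * hdot u v + hdot u w.
Proof.
rewrite /hdot mulr_sumr -big_split /=; apply: eq_bigr => K _.
rewrite mulr_sumr -big_split /=; apply: eq_bigr => b _.
by rewrite !ffunE hcoordD hcoordZ mulrDr mulrCA.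
Qed.

Lemma hdotC u v : hdot v u = (hdot u v)^*%C.
Proof.
rewrite /hdot (rmorph_sum (@conjc R)); apply: eq_bigr => K _.
rewrite (rmorph_sum (@conjc R)); apply: eq_bigr => b _.
by rewrite (rmorphM (@conjc R)) /= conjcK mulrC.
Qed.

Lemma hdot0r u : hdot u 0 = 0.
Proof. by have := hdotPr u 0 0 (-1); rewrite scaler0 addr0 mulN1r addNr. Qed.

Lemma hdotPl u v w c : hdot (c *: v + w) u = c^*%C * hdot v u + hdot w u.
Proof.
rewrite hdotC hdotPr (rmorphD (@conjc R)) (rmorphM (@conjc R)) /=.
by rewrite -!hdotC.
Qed.

Lemma hdotDr u v w : hdot u (v + w) = hdot u v + hdot u w.
Proof. by rewrite -[v]scale1r hdotPr mul1r scale1r. Qed.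

Lemma hdotZr u v c : hdot u (c *: v) = c * hdot u v.
Proof. by rewrite -[c *: v]addr0 hdotPr hdot0r addr0. Qed.

Lemma hdotDl u v w : hdot (v + w) u = hdot v u + hdot w u.
Proof. by rewrite -[v]scale1r hdotPl conjc1 mul1r scale1r. Qed.

Lemma hdotZl u v c : hdot (c *: v) u = c^*%C * hdot v u.
Proof. by rewrite hdotC hdotZr (rmorphM (@conjc R)) /= -hdotC. Qed.

Lemma hdot_comb (a b a' b' : C) u v u' v' :
  hdot (a *: u + b *: v) (a' *: u' + b' *: v') =
  a^*%C * (a' * hdot u u') + a^*%C * (b' * hdot u v') +
  (b^*%C * (a' * hdot v u') + b^*%C * (b' * hdot v v')).
Proof. by rewrite hdotDl !hdotZl !hdotDr !hdotZr !mulrDr. Qed.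

Lemma span_ind X (Q : htens -> Prop) : Q 0 ->
  (forall c v w, Q v -> Q w -> Q (c *: v + w)) ->
  {in X, forall v, Q v} -> {in <<X>>%VS, forall v, Q v}.
Proof.
move=> Q0 QP; elim: X => [_ v|x X IH QX v].
  by rewrite span_nil memv0 => /eqP ->.
rewrite span_cons => /memv_addP[y /vlineP[c ->] [z zX ->]].
apply: QP; first by apply: QX; rewrite inE eqxx.
by apply: IH zX => w wX; apply: QX; rewrite inE wX orbT.
Qed.

Lemma orthogonal_free X : pairwise (fun v w => hdot v w == 0) X ->
  {in X, forall v, hdot v v != 0} -> free X.
Proof.
elim: X => [|x X IH] /=; first by rewrite nil_free.
move=> /andP[/allP ox oX] n0; rewrite free_cons IH ?andbT //; last first.
  by move=> v vX; apply: n0; rewrite inE vX orbT.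
apply/negP => xX; have /negP := n0 x (mem_head _ _); apply; apply/eqP.
move: xX; apply: (@span_ind X (fun v => hdot x v = 0)).
- exact: hdot0r.
- by move=> c v w v0 w0; rewrite hdotPr v0 w0 mulr0 addr0.
- by move=> v /ox /eqP.
Qed.
End HermitianProduct.

Section Eigenvectors.
Variables (R : realType) (k : nat).
Local Notation C := R[i].
Local Notation H := (quat R).
Local Notation htens := (htens R k).
Local Notation W := (@Wspace R k).
Implicit Types (g h : nat -> nat -> H) (a b : C).

(** The squared norm of |p>. *)
Definition kappa p : C := 'C(k, p)%:R^-1.

Lemma kappa_neq0 p : (p <= k)%N -> kappa p != 0.
Proof. by move=> pk; rewrite invr_eq0 pnatr_eq0 -lt0n bin_gt0. Qed.

Lemma kappaS p : (p < k)%N -> (k%:R - p%:R) * kappa p.+1 = p.+1%:R * kappa p.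
Proof.
move=> pk; rewrite -natrB ?(ltnW pk) //.
have n0 j : (j <= k)%N -> 'C(k, j)%:R != 0 :> C.
  by move=> jk; rewrite pnatr_eq0 -lt0n bin_gt0.
have n1 := n0 _ pk; have n2 := n0 _ (ltnW pk).
have := mul_bin_left k p => /(congr1 (fun n => n%:R : C)); rewrite !natrM /kappa.
move: ('C(k, p.+1)%:R) ('C(k, p)%:R) n1 n2 => x y x0 y0 e.
apply: (mulIf x0); apply: (mulIf y0).
by rewrite mulfVK // mulrAC mulfVK.
Qed.

Lemma eq_wtens g h : (forall p q, (p <= k)%N -> (q <= k)%N -> g p q = h p q) ->
  wtens k g = wtens k h.
Proof. by move=> e; apply/ffunP => K; rewrite !ffunE e ?weight_le. Qed.

Lemma wtensP2 a b g h :
  wtens k (fun p q => a *: g p q + b *: h p q) = a *: wtens k g + b *: wtens k h.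
Proof. by apply/ffunP => K; rewrite !ffunE. Qed.

Definition blockv a b p q : htens :=
  a *: ket_tens k (qe R 0) p q + b *: ket_tens k (qe R 2) p.-1 q.

(** The weight coordinates of blockv; the factors kappa come from ketE. *)
Definition blockv_coef a b p q (p' q' : nat) : H :=
  (a * (kappa p * kappa q) * ((p' == p) && (q' == q))%:R) *: qe R 0 +
  (b * (kappa p.-1 * kappa q) * ((p' == p.-1) && (q' == q))%:R) *: qe R 2.

Lemma ket_coef d (J : midx k) : (d <= k)%N ->
  ket R k d J = kappa d * (weight J == d)%:R.
Proof. by move=> dk; rewrite ketE // ffunE; congr (_ * _); rewrite ffunE. Qed.

Lemma ket_tensE (y : H) p q : (p <= k)%N -> (q <= k)%N -> ket_tens k y p q =
  wtens k (fun p' q' => (kappa p * kappa q * ((p' == p) && (q' == q))%:R) *: y).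
Proof.
move=> pk qk; apply/ffunP => K; rewrite /ket_tens tensE tens2E.
rewrite [RHS]ffunE; congr (_ *: _).
apply: (etrans (congr2 *%R (ket_coef K.1 pk) (ket_coef K.2 qk))).
by rewrite -mulnb natrM mulrACA.
Qed.

(** The block of p and q is a line for p = 0 and for p = k + 1, where |p - 1>,
    respectively |p>, does not exist; the coefficient of that term must be 0. *)
Definition in_block a b p q :=
  [/\ (q <= k)%N, (p <= k.+1)%N, p = k.+1 -> a = 0 & p = 0 -> b = 0].

Lemma blockvE a b p q : in_block a b p q -> blockv a b p q = wtens k (blockv_coef a b p q).
Proof.
move=> [qk pk a0 b0]; rewrite /blockv (ket_tensE (qe R 2)) //; last by case: p pk {a0 b0}.
have [pE|pk'] := eqVneq p k.+1.
  rewrite (a0 pE) scale0r add0r; apply/ffunP => K.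
  rewrite [LHS]ffunE [wtens _ _ _]ffunE [RHS]ffunE /blockv_coef !mul0r scale0r add0r.
  by rewrite scalerA mulrA.
rewrite ket_tensE //; last by rewrite -ltnS ltn_neqAle pk'.
by rewrite -wtensP2; apply: eq_wtens => p' q' _ _; rewrite /blockv_coef !scalerA !mulrA.
Qed.

Lemma Wspace_blockv a b p q : in_block a b p q -> W (blockv a b p q).
Proof. by move=> v; apply/WspaceP; exists (blockv_coef a b p q); exact: blockvE. Qed.

Lemma hermitian_tens2 (u v u' v' : tpow R k) :
  Defs.hermitian (tens2 u v) (tens2 u' v') = Defs.hermitian u u' * Defs.hermitian v v'.
Proof.
rewrite /Defs.hermitian mulr_suml.
under eq_bigr => K _ do
  rewrite (tens2E u) (tens2E u') (rmorphM (@conjc R)) mulrACA.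
rewrite -(pair_bigA _ (fun I J : midx k => ((u I)^*%C * u' I) * ((v J)^*%C * v' J))).
by apply: eq_bigr => I _; rewrite mulr_sumr.
Qed.

Lemma hermitian_weight (u v : tpow R k) (c c' : C) d e :
  (forall J, u J = c * (weight J == d)%:R) ->
  (forall J, v J = c' * (weight J == e)%:R) ->
  Defs.hermitian u v = c^*%C * c' * 'C(k, d)%:R * (d == e)%:R.
Proof.
move=> uE vE; rewrite /Defs.hermitian.
under eq_bigr => J _ do rewrite uE vE (rmorphM (@conjc R)) /= conjc_nat.
have [<-|de] := eqVneq d e.
  rewrite mulr1 -sum_weight_ind mulr_sumr; apply: eq_bigr => J _.
  by rewrite [weight_ind _ _ _ _]ffunE; case: (_ == _); rewrite ?mulr0 ?mulr1.
rewrite mulr0 big1 // => J _.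
by have [->|_] := eqVneq (weight J) d; rewrite ?(negPf de) ?mulr0 ?mul0r.
Qed.

Lemma hermitian_ket d e : (d <= k)%N -> (e <= k)%N ->
  Defs.hermitian (ket R k d) (ket R k e) = kappa d * (d == e)%:R.
Proof.
move=> dk ek.
rewrite (hermitian_weight (fun J => ket_coef J dk) (fun J => ket_coef J ek)).
have [<-|_] := eqVneq d e; last by rewrite !mulr0.
rewrite !mulr1 /kappa conjc_inv conjc_nat mulfVK //.
by rewrite pnatr_eq0 -lt0n bin_gt0.
Qed.

Lemma hdot_ket_tens (y z : H) p q p' q' :
  (p <= k)%N -> (q <= k)%N -> (p' <= k)%N -> (q' <= k)%N ->
  hdot (ket_tens k y p q) (ket_tens k z p' q') =
  (\sum_b (hcoord y b)^*%C * hcoord z b) *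
    ((kappa p * (p == p')%:R) * (kappa q * (q == q')%:R)).
Proof.
move=> pk qk pk' qk'; rewrite hdot_tens hermitian_tens2.
exact: (congr1 _ (congr2 *%R (hermitian_ket pk pk') (hermitian_ket qk qk'))).
Qed.

Lemma hdot_blockv a b p q a' b' p' q' : in_block a b p q -> in_block a' b' p' q' ->
  hdot (blockv a b p q) (blockv a' b' p' q') =
  (a^*%C * a' * kappa p + b^*%C * b' * kappa p.-1) * kappa q *
    ((p == p') && (q == q'))%:R.
Proof.
move=> [qk pk a0 b0] [qk' pk' a0' b0'].
have pred n : (n <= k.+1)%N -> (n.-1 <= k)%N by case: n.
have D (y z : H) c d n m : (n <= k.+1)%N -> (m <= k.+1)%N ->
    (n = k.+1 -> c = 0) -> (m = k.+1 -> d = 0) ->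
    c^*%C * (d * hdot (ket_tens k y n q) (ket_tens k z m q')) =
    c^*%C * d * ((\sum_j (hcoord y j)^*%C * hcoord z j) *
      ((kappa n * (n == m)%:R) * (kappa q * (q == q')%:R))).
  move=> nk mk c0 d0.
  have [nE|nN] := eqVneq n k.+1; first by rewrite c0 // conjc0 !mul0r.
  have [mE|mN] := eqVneq m k.+1; first by rewrite (d0 mE) !(mul0r, mulr0).
  by rewrite hdot_ket_tens ?mulrA // -ltnS ltn_neqAle ?nN ?mN.
have hb : [/\ \sum_j (hcoord (qe R 0) j)^*%C * hcoord (qe R 0) j = 1,
    \sum_j (hcoord (qe R 2) j)^*%C * hcoord (qe R 2) j = 1,
    \sum_j (hcoord (qe R 0) j)^*%C * hcoord (qe R 2) j = 0 &
    \sum_j (hcoord (qe R 2) j)^*%C * hcoord (qe R 0) j = 0].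
  by split; rewrite big_bool; apply/eqP; rewrite eq_complex /=; apply/andP;
     split; apply/eqP => /=; ring.
have [h00 h22 h02 h20] := hb.
have predN n : n.-1 = k.+1 -> (n <= k.+1)%N -> False by case: n => //= n ->; rewrite ltnn.
rewrite /blockv hdot_comb.
have pk1 : (p.-1 <= k.+1)%N by rewrite leqW ?pred.
have pk1' : (p'.-1 <= k.+1)%N by rewrite leqW ?pred.
rewrite (D _ _ a a' p p') // (D _ _ a b' p p'.-1) //; last by move/predN => /(_ pk').
rewrite (D _ _ b a' p.-1 p') //; last by move/predN => /(_ pk).
rewrite (D _ _ b b' p.-1 p'.-1) //; try by move/predN => n1; case: n1.
rewrite h00 h22 h02 h20 !mul0r !mulr0 addr0 add0r !mul1r -mulnb natrM.
have [<-|pp'] := eqVneq p p'; first by rewrite eqxx /=; ring.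
have [e|_] := eqVneq p.-1 p'.-1; last by rewrite /= !(mulr0, mul0r, addr0).
have [p0|/b0 ->] : p' = 0%N \/ p = 0%N.
  by case: p p' e pp' {b0 b0' pk pk' pk1 pk1' a0 a0'} => [|n] [|m] //= e;
     rewrite ?e ?eqxx //; [right|left].
  by rewrite (b0' p0) /= !(mulr0, mul0r, addr0).
by rewrite conjc0 /= !(mulr0, mul0r, addr0).
Qed.

Lemma hcoord_blockv_coef a b p q p' q' j : hcoord (blockv_coef a b p q p' q') j =
  if j then b * (kappa p.-1 * kappa q) * ((p' == p.-1) && (q' == q))%:R
  else a * (kappa p * kappa q) * ((p' == p) && (q' == q))%:R.
Proof.
rewrite /blockv_coef hcoordD !hcoordZ.
have e0 i : hcoord (qe R 0) i = (~~ i)%:R by case: i.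
have e2 i : hcoord (qe R 2) i = i%:R by case: i.
by rewrite e0 e2; case: j; rewrite /= mulr0 mulr1 ?add0r ?addr0.
Qed.

Lemma hcoord_dirac_gen g p q j : hcoord (dirac_block k g p q) j =
  if j then (k%:R - 2 * p%:R - 3 / 2) * hcoord (g p q) true -
            2 * (k%:R - p%:R) * hcoord (g p.+1 q) false
  else (2 * p%:R - k%:R - 3 / 2) * hcoord (g p q) false -
       2 * p%:R * hcoord (g p.-1 q) true.
Proof.
rewrite /dirac_block hcoordD !hcoordZ.
have e0 i : hcoord (qe R 0) i = (~~ i)%:R by case: i.
have e2 i : hcoord (qe R 2) i = i%:R by case: i.
rewrite e0 e2.
by case: j; rewrite /= mulr0 mulr1 ?add0r ?addr0; congr (_ * _ - _ * _);
  rewrite -[LHS]/(real_complex R _) !(rmorphB, rmorphM, fmorphV, rmorph_nat).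
Qed.

Section Spectrum.
Variable Phi : (Sp1 R -> H) -> htens.
Hypothesis iPhi : intertwining_isometry Phi.

(** The spinor picked by the partial inverse lies in V_k and is mapped to
    wtens k g, which is all that Phi_dirac asks for. *)
Lemma dirac_transportE g : dirac_transport Phi (wtens k g) = wtens k (dirac_block k g).
Proof.
have Wg : W (wtens k g) by apply/WspaceP; exists g.
have [_ _ surj] := phi_bij iPhi.
rewrite /dirac_transport; set s := pinv_ _ _ _ _.
have Vs : (@Vspace R k) s.
  by apply: (surjpinv_image_sub surj); exists (wtens k g).
have es : Phi s = wtens k g by exact: (surjpK (fun=> (fun=> 0)) surj (mem_set Wg)).
by have [] := Phi_dirac iPhi Vs es.
Qed.

Lemma dirac_transport_linear c w w' : W w -> W w' ->
  dirac_transport Phi (c *: w + w') =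
  c *: dirac_transport Phi w + dirac_transport Phi w'.
Proof.
move=> /WspaceP[g ->] /WspaceP[h ->]; rewrite -wtensP !dirac_transportE -wtensP.
apply: eq_wtens => p q _ _; apply: hcoordP => b.
rewrite [LHS]hcoord_dirac_gen [RHS]hcoordD [X in _ = X + _]hcoordZ.
rewrite (hcoord_dirac_gen g) (hcoord_dirac_gen h) !hcoordD !hcoordZ.
by case: b; ring.
Qed.

(** The two linear relations say that the vector is an eigenvector of the 2 by 2
    block of the operator that couples e0 (x) |p> with e2 (x) |p-1>. *)
Lemma blockv_eigen a b p q (l : C) : in_block a b p q ->
  ((p <= k)%N -> (2 * p%:R - k%:R - 3 / 2 - l) * (a * kappa p) =
     2 * p%:R * (b * kappa p.-1)) ->
  ((0 < p)%N -> (k%:R - 2 * p.-1%:R - 3 / 2 - l) * (b * kappa p.-1) =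
     2 * (k%:R - p.-1%:R) * (a * kappa p)) ->
  dirac_transport Phi (blockv a b p q) = l *: blockv a b p q.
Proof.
move=> v e1 e2; have [qk pk a0 b0] := v.
rewrite blockvE // dirac_transportE.
have -> : l *: wtens k (blockv_coef a b p q) = wtens k (fun p' q' => l *: blockv_coef a b p q p' q').
  by apply/ffunP => K; rewrite !ffunE.
apply: eq_wtens => p' q' pk' qk'; apply: hcoordP => j.
rewrite [LHS]hcoord_dirac_gen [RHS]hcoordZ !hcoord_blockv_coef; have [_|_] := eqVneq q' q; last first.
  by case: j; rewrite !andbF !mulr0 subr0.
rewrite !andbT; case: j.
  have [p'E|p'N] := eqVneq p' p.-1.
    have [p0|p_gt0] := posnP p.
      by rewrite p0 (b0 p0) /= !mul0r !mulr0 subr0.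
    rewrite p'E prednK // eqxx !mulr1.
    have := e2 p_gt0; move: (k%:R) (p.-1%:R) (kappa p) (kappa p.-1) (kappa q).
    move=> r s u w x e.
    have -> : 2 * (r - s) * (a * (u * x)) = 2 * (r - s) * (a * u) * x by ring.
    by rewrite -e; ring.
  rewrite (_ : (p'.+1 == p) = false) ?mulr0 ?subr0 //.
  by apply/negbTE; apply: contra p'N => /eqP <-.
have [p'E|p'N] := eqVneq p' p.
  rewrite p'E eqxx !mulr1; have pk1 : (p <= k)%N by rewrite -p'E.
  have := e1 pk1; move: (k%:R) (p%:R) (kappa p) (kappa p.-1) (kappa q).
  move=> r s u w x e.
  have -> : 2 * s * (b * (w * x)) = 2 * s * (b * w) * x by ring.
  by rewrite -e; ring.
have [p'0|p'_gt0] := posnP p'; first by rewrite p'0 !(mulr0, mul0r, subr0).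
have [p0|p_gt0] := posnP p; first by rewrite (b0 p0) !(mulr0, mul0r, subr0).
rewrite (_ : (p'.-1 == p.-1) = false) ?mulr0 ?subr0 //.
by apply/negbTE; apply: contra p'N => /eqP e; rewrite -(prednK p'_gt0) e prednK.
Qed.
End Spectrum.
End Eigenvectors.

(** * The eigenbasis *)

Section Eigenbasis.
Variables (R : realType) (k : nat).
Local Notation C := R[i].
Local Notation htens := (htens R k).
Local Notation kappa := (kappa R k).
Implicit Types (l : bool * nat * nat).

(** An eigenvector has a label (s, p, q), where s tells whether the eigenvalue is
    the upper one. The lower eigenvalue takes p from 0 to k + 1: the two extreme
    values give e0 (x) |0>|q> and e2 (x) |k>|q>. *)
Definition ecoef (s : bool) (p : nat) : C * C :=
  if s then (1, -1) else
  if p == 0%N then (1, 0) else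
  if p == k.+1 then (0, 1) else (p%:R - k%:R - 1, - p%:R).

Definition eigvec l : htens := blockv k (ecoef l.1.1 l.1.2).1 (ecoef l.1.1 l.1.2).2 l.1.2 l.2.

Definition upper_labels : seq (bool * nat * nat) :=
  [seq (true, p, q) | p <- iota 1 k, q <- iota 0 k.+1].

Definition lower_labels : seq (bool * nat * nat) :=
  [seq (false, p, q) | p <- iota 1 k, q <- iota 0 k.+1] ++
  [seq (false, 0%N, q) | q <- iota 0 k.+1] ++
  [seq (false, k.+1, q) | q <- iota 0 k.+1].

Definition labels := upper_labels ++ lower_labels.

Definition label_ok l :=
  [&& (l.2 <= k)%N, (l.1.2 <= k.+1)%N & l.1.1 ==> (0 < l.1.2 <= k)%N].

Lemma labels_valid : {in labels, forall l, label_ok l}.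
Proof.
move=> l; rewrite !mem_cat => /or4P[].
- case/allpairsPdep => p [q []]; rewrite !mem_iota => pP qP ->.
  by rewrite /label_ok /=; lia.
- case/allpairsPdep => p [q []]; rewrite !mem_iota => pP qP ->.
  by rewrite /label_ok /=; lia.
- by case/mapP => q; rewrite mem_iota => qP ->; rewrite /label_ok /=; lia.
- by case/mapP => q; rewrite mem_iota => qP ->; rewrite /label_ok /=; lia.
Qed.

Lemma lower_labelsP : {in lower_labels, forall l, l.1.1 = false}.
Proof.
move=> l; rewrite !mem_cat => /or3P[|/mapP[q _ ->]|/mapP[q _ ->]] //.
by case/allpairsPdep => p [q [_ _ ->]].
Qed.

Lemma uniq_labels : uniq labels.
Proof.
have up (s : bool) : uniq [seq (s, p, q) | p <- iota 1 k, q <- iota 0 k.+1].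
  by apply: allpairs_uniq; rewrite ?iota_uniq // => -[p q] [p' q'] _ _ /= [-> ->].
have um (p : nat) : uniq [seq (false, p, q) | q <- iota 0 k.+1].
  by rewrite map_inj_uniq ?iota_uniq // => q q' [].
rewrite /labels /upper_labels /lower_labels !cat_uniq !up !um !(andbT, andTb) -!all_predC; apply/and3P; split.
- apply/allP => l; rewrite !mem_cat => /or3P[].
  + by case/allpairsPdep => p [q [_ _ ->]]; apply/negP => /allpairsPdep[? [? [_ _ []]]].
  + by case/mapP => q _ ->; apply/negP => /allpairsPdep[? [? [_ _ []]]].
  + by case/mapP => q _ ->; apply/negP => /allpairsPdep[? [? [_ _ []]]].
- apply/allP => l; rewrite !mem_cat => /orP[].
  + case/mapP => q _ ->; apply/negP => /allpairsPdep[p [q' []]].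
    by rewrite mem_iota => pP _ [pE _]; lia.
  + case/mapP => q _ ->; apply/negP => /allpairsPdep[p [q' []]].
    by rewrite mem_iota => pP _ [pE _]; lia.
- apply/allP => l; case/mapP => q _ ->; apply/negP => /mapP[q' _ []] //.
Qed.

Lemma ecoef_mid p : (0 < p <= k)%N -> ecoef false p = (p%:R - k%:R - 1, - p%:R).
Proof.
by move=> pk; rewrite /ecoef /= !ifN //; apply/eqP => pE; move: pk; rewrite pE; lia.
Qed.

Lemma upper_eigenvectorsE : upper_eigenvectors R k = map eigvec upper_labels.
Proof.
rewrite /upper_eigenvectors /upper_labels map_allpairs.
by apply/eq_in_allpairs => p q _ _; rewrite /eigvec /= /blockv scale1r scaleN1r.
Qed.

Lemma lower_eigenvectorsE : lower_eigenvectors R k = map eigvec lower_labels.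
Proof.
rewrite /lower_eigenvectors /lower_labels !map_cat map_allpairs -!map_comp.
congr (_ ++ (_ ++ _)).
- apply/eq_in_allpairs => p q; rewrite mem_iota => pP _.
  by rewrite /eigvec [ecoef _ _]ecoef_mid /= ?/blockv ?scaleNr //; lia.
- by apply: eq_map => q; rewrite /eigvec /= /blockv scale1r scale0r addr0.
- apply: eq_map => q; rewrite /eigvec /= /ecoef /= eqxx.
  by rewrite /blockv scale1r scale0r add0r.
Qed.

Lemma eigenvectorsE :
  upper_eigenvectors R k ++ lower_eigenvectors R k = map eigvec labels.
Proof. by rewrite upper_eigenvectorsE lower_eigenvectorsE -map_cat. Qed.

Lemma eigvec_block l : label_ok l ->
  in_block k (ecoef l.1.1 l.1.2).1 (ecoef l.1.1 l.1.2).2 l.1.2 l.2.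
Proof.
case: l => -[s p] q /and3P[/= qk pk sp]; split=> // pE; rewrite /ecoef pE.
  by case: s sp => //= sp; [lia|rewrite eqxx].
by case: s sp => //= sp; lia.
Qed.

(** The orthogonality of the two eigenvectors of a block; it also makes both of
    them eigenvectors. *)
Lemma kappa_rel p : (0 < p <= k)%N -> (p%:R - k%:R - 1) * kappa p = - (p%:R * kappa p.-1).
Proof.
case: p => // n nk; rewrite /= -kappaS; last by lia.
by rewrite -natr1; ring.
Qed.

Lemma conj_natB p : (p%:R - k%:R - 1 : C)^*%C = p%:R - k%:R - 1.
Proof. by rewrite !(rmorphB (@conjc R)) !(rmorph_nat (@conjc R)) (rmorph1 (@conjc R)). Qed.

Lemma eigvec_orthogonal l l' : label_ok l -> label_ok l' -> l != l' ->
  hdot (eigvec l) (eigvec l') = 0.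
Proof.
move=> vl vl' ll'; rewrite (hdot_blockv (eigvec_block vl) (eigvec_block vl')).
case: eqP => [e|_]; last by rewrite mulr0.
case: eqP => [e'|_]; last by rewrite mulr0.
case: l l' vl vl' ll' e e' => [[s p] q] [[s' p'] q'] /= vl vl' ll' pE qE; subst p' q'.
have [sp|sp] : (s && ~~ s' \/ ~~ s && s') by case: s s' ll' {vl vl'} => [] []; rewrite ?eqxx; auto.
  case: s s' sp vl vl' ll' => [] [] // _ /and3P[_ _ pk] _ _.
  rewrite (ecoef_mid pk).
  change ((1^*%C * (p%:R - k%:R - 1) * kappa p + (-1)^*%C * - p%:R * kappa p.-1) *
    kappa q * 1 = 0 :> C).
  transitivity (((p%:R - k%:R - 1) * kappa p + p%:R * kappa p.-1) * kappa q).
    by rewrite (rmorphN (@conjc R)) (rmorph1 (@conjc R)); ring.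
  by rewrite kappa_rel // addNr mul0r.
case: s s' sp vl vl' ll' => [] [] // _ _ /and3P[_ _ pk] _.
rewrite (ecoef_mid pk).
change (((p%:R - k%:R - 1)^*%C * 1 * kappa p + (- p%:R)^*%C * -1 * kappa p.-1) *
  kappa q * 1 = 0 :> C).
transitivity (((p%:R - k%:R - 1) * kappa p + p%:R * kappa p.-1) * kappa q).
  by rewrite conj_natB (rmorphN (@conjc R)) (rmorph_nat (@conjc R)); ring.
by rewrite kappa_rel // addNr mul0r.
Qed.

Lemma conj_mul_ge0 (a : C) : 0 <= a^*%C * a.
Proof.
case: a => x y; rewrite lecE /=; apply/andP; split; first by apply/eqP; ring.
by rewrite (_ : _ - _ = x ^+ 2 + y ^+ 2) ?addr_ge0 ?sqr_ge0 //; ring.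
Qed.

Lemma conj_mul_gt0 (a : C) : a != 0 -> 0 < a^*%C * a.
Proof.
by move=> a0; rewrite lt_def conj_mul_ge0 andbT mulf_neq0 // conjc_eq0.
Qed.

Lemma kappa_ge0 p : 0 <= kappa p.
Proof. by rewrite invr_ge0 ler0n. Qed.

Lemma kappa_gt0 p : (p <= k)%N -> 0 < kappa p.
Proof. by move=> pk; rewrite invr_gt0 ltr0n bin_gt0. Qed.

Lemma eigvec_neq0 l : label_ok l -> hdot (eigvec l) (eigvec l) != 0.
Proof.
move=> vl; rewrite (hdot_blockv (eigvec_block vl) (eigvec_block vl)) !eqxx mulr1.
case: l vl => [[s p] q] /= vl; have /and3P[/= qk pk sp] := vl.
rewrite mulf_neq0 ?kappa_neq0 // gt_eqF //.
have [p0|p_gt0] := posnP p.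
  rewrite p0; have -> : s = false by case: s sp {vl}; rewrite // p0.
  apply: ltr_wpDr; first by rewrite mulr_ge0 ?conj_mul_ge0 ?kappa_ge0.
  by rewrite mulr_gt0 ?kappa_gt0 // conj_mul_gt0 // oner_neq0.
apply: ltr_wpDl; first by rewrite mulr_ge0 ?conj_mul_ge0 ?kappa_ge0.
rewrite mulr_gt0 ?kappa_gt0 //; last by case: p pk {vl sp p_gt0}.
apply: conj_mul_gt0; rewrite /ecoef; case: s {vl sp}.
  by rewrite /= oppr_eq0 oner_eq0.
rewrite (gtn_eqF p_gt0); case: ifP => _ /=; first by rewrite oner_eq0.
by rewrite oppr_eq0 pnatr_eq0 -lt0n.
Qed.
End Eigenbasis.

Section Main.
Variables (R : realType) (k : nat).
Local Notation C := R[i].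
Local Notation H := (quat R).
Local Notation htens := (htens R k).
Local Notation W := (@Wspace R k).
Local Notation kappa := (kappa R k).

(** In a block with 0 < p <= k, the second eigenvector minus p times the first
    is - (k + 1) e0 (x) |p>|q>, and then e2 (x) |p - 1>|q> follows. *)
Lemma span_eigenvectors (w : htens) : W w <-> w \in <<map (@eigvec R k) (labels k)>>%VS.
Proof.
split; last first.
  apply: (span_ind (Wspace0 R k)) => [c v u|v /mapP[l lL ->]].
    exact: Wspace_lin.
  exact: Wspace_blockv (eigvec_block R (labels_valid lL)).
move=> /WspaceP[g ->]; set S := <<_>>%VS.
have SL s p q : (s, p, q) \in labels k -> eigvec R k (s, p, q) \in S.
  by move=> lL; apply: memv_span; apply: map_f.
have mid p q : (0 < p <= k)%N -> (q <= k)%N ->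
    ket_tens k (qe R 0) p q \in S /\ ket_tens k (qe R 2) p.-1 q \in S.
  move=> pk qk.
  have u : ket_tens k (qe R 0) p q - ket_tens k (qe R 2) p.-1 q \in S.
    have := SL true p q; rewrite /eigvec /= /blockv scale1r scaleN1r; apply.
    rewrite mem_cat; apply/orP; left; apply/allpairsPdep; exists p, q.
    by rewrite !mem_iota; split=> //; lia.
  have l : (p%:R - k%:R - 1) *: ket_tens k (qe R 0) p q -
      p%:R *: ket_tens k (qe R 2) p.-1 q \in S.
    have := SL false p q.
    rewrite /eigvec [ecoef _ _ _ _]ecoef_mid // /blockv scaleNr; apply.
    rewrite !mem_cat; apply/orP; right; apply/orP; left.
    by apply/allpairsPdep; exists p, q; rewrite !mem_iota; split=> //; lia.
  have e : ket_tens k (qe R 0) p q \in S.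
    have k1 : k.+1%:R != 0 :> C by rewrite pnatr_eq0.
    move: u l; move: (ket_tens k (qe R 0) p q) (ket_tens k (qe R 2) p.-1 q) => E F u l.
    suff -> : E = k.+1%:R^-1 *: (p%:R *: (E - F) - ((p%:R - k%:R - 1) *: E - p%:R *: F)).
      by rewrite rpredZ // rpredB // rpredZ.
    rewrite [p%:R *: (E - F)]scalerBr opprB addrA subrK -scalerBl scalerA.
    rewrite (_ : p%:R - (p%:R - k%:R - 1) = k.+1%:R) ?mulVf ?scale1r //.
    by rewrite -natr1; ring.
  split=> //; rewrite -[ket_tens k (qe R 2) p.-1 q](subKr (ket_tens k (qe R 0) p q)).
  exact: rpredB.
have S0 p q : (p <= k)%N -> (q <= k)%N -> ket_tens k (qe R 0) p q \in S.
  case: p => [_ qk|p pk qk]; last by case: (mid p.+1 q pk qk).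
  have := SL false 0%N q; rewrite /eigvec /= /blockv scale1r scale0r addr0; apply.
  rewrite !mem_cat; apply/orP; right; apply/orP; right; apply/orP; left.
  by apply/mapP; exists q => //; rewrite mem_iota; lia.
have S2 p q : (p <= k)%N -> (q <= k)%N -> ket_tens k (qe R 2) p q \in S.
  move=> pk qk; have [pE|pN] := eqVneq p k.
    have := SL false k.+1 q.
    rewrite /eigvec /ecoef /= eqxx /= /blockv scale1r scale0r add0r pE; apply.
    rewrite !mem_cat; apply/orP; right; apply/orP; right; apply/orP; right.
    by apply/mapP; exists q => //; rewrite mem_iota; lia.
  have pk1 : (0 < p.+1 <= k)%N by rewrite /= ltn_neqAle pN.
  by case: (mid p.+1 q pk1 qk).
rewrite wtensE; apply: rpred_sum => p _; apply: rpred_sum => q _.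
have pk : (p <= k)%N by rewrite -ltnS.
have qk : (q <= k)%N by rewrite -ltnS.
suff -> : tens (g p q) (tens2 (weight_ind R k p) (weight_ind R k q)) =
    (hcoord (g p q) false / (kappa p * kappa q)) *: ket_tens k (qe R 0) p q +
    (hcoord (g p q) true / (kappa p * kappa q)) *: ket_tens k (qe R 2) p q.
  by rewrite rpredD // rpredZ // ?S0 ?S2.
have n0 : kappa p * kappa q != 0 by rewrite mulf_neq0 ?kappa_neq0.
rewrite !ket_tensE // -wtensP2; apply/ffunP => K.
rewrite tensE tens2E [RHS]ffunE [weight_ind _ _ _ _]ffunE [weight_ind _ _ _ K.2]ffunE.
rewrite -natrM mulnb; case: (_ && _); last by rewrite !(mulr0, scale0r, scaler0) addr0.
rewrite !mulr1 scale1r !scalerA !mulfVK //.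
by rewrite [LHS]hbasis_sum big_bool addrC.
Qed.

Lemma dirac_transport_upper (Phi : (Sp1 R -> H) -> htens) p q :
  intertwining_isometry Phi -> (0 < p <= k)%N -> (q <= k)%N ->
  dirac_transport Phi (eigvec R k (true, p, q)) = (k%:R + 1 / 2) *: eigvec R k (true, p, q).
Proof.
move=> iPhi pk qk; have vl : label_ok k (true, p, q).
  by rewrite /label_ok /=; lia.
have := kappa_rel R pk; case: p pk vl => // n nk vl K.
apply: (blockv_eigen iPhi (eigvec_block R vl)) => _; rewrite /ecoef /=.
  transitivity (2 * ((n.+1%:R - k%:R - 1) * kappa n.+1)); first by field.
  by rewrite K /=; ring.
transitivity (- 2 * ((n.+1%:R - k%:R - 1) * kappa n.+1)).
  by rewrite K -(natr1 n) /=; field.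
by rewrite -(natr1 n); ring.
Qed.

Lemma dirac_transport_lower (Phi : (Sp1 R -> H) -> htens) p q :
  intertwining_isometry Phi -> (p <= k.+1)%N -> (q <= k)%N ->
  dirac_transport Phi (eigvec R k (false, p, q)) =
    (- k%:R - 3 / 2) *: eigvec R k (false, p, q).
Proof.
move=> iPhi pk qk; have vl : label_ok k (false, p, q).
  by rewrite /label_ok /= pk qk.
apply: (blockv_eigen iPhi (eigvec_block R vl)) => [pk'|p0]; rewrite /ecoef /=.
  have [pE|p_gt0] := posnP p; first by rewrite pE /=; ring.
  rewrite (_ : (p == k.+1) = false) /=; last by apply: ltn_eqF.
  have := @kappa_rel R k p; rewrite p_gt0 => /(_ pk') K.
  by rewrite K; ring.
rewrite (gtn_eqF p0); have [pE|pN] := eqVneq p k.+1.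
  by rewrite pE /=; ring.
have pk' : (0 < p <= k)%N by rewrite p0 -ltnS ltn_neqAle pN.
case: p p0 pk' {vl pk pN} => // n _ nk /=.
by have /= -> := kappa_rel R nk; rewrite -(natr1 n); ring.
Qed.
End Main.

Theorem mainTheorem1 (R : realType) (k : nat) :
  [/\ forall sigma : Sp1 R -> quat R,
        Vspace k sigma -> Vspace k (dirac_op sigma),
      exists Phi : (Sp1 R -> quat R) -> htens R k, intertwining_isometry Phi &
      forall Phi : (Sp1 R -> quat R) -> htens R k, intertwining_isometry Phi ->
      let A := dirac_transport Phi in
      let upper := upper_eigenvectors R k in
      let lower := lower_eigenvectors R k in
      [/\ forall (c : R[i]) (w w' : htens R k), Wspace w -> Wspace w' ->
            A (c *: w + w') = c *: A w + A w',
          {in upper, forall v, A v = (k%:R + 1 / 2) *: v},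
          {in lower, forall v, A v = (- k%:R - 3 / 2) *: v} &
          [/\ free (upper ++ lower),
              forall w : htens R k, Wspace w <-> w \in <<upper ++ lower>>%VS &
              pairwise (fun v w => hdot v w == 0) (upper ++ lower)]]].
Proof.
split; last 2 first.
- exact: exists_intertwining_isometry.
- move=> Phi iPhi A upper lower.
  have orth : pairwise (fun v w => hdot v w == 0) (upper ++ lower).
    rewrite /upper /lower eigenvectorsE pairwise_map.
    apply: (sub_in_pairwise (P := [in labels k]) (r := fun l l' => l != l')).
    + move=> l l' /labels_valid vl /labels_valid vl' ll'.
      by apply/eqP; exact: eigvec_orthogonal.
    + exact/allP.
    + by rewrite -uniq_pairwise uniq_labels.
  split.
  + by move=> c w w'; exact: dirac_transport_linear.
  + move=> v vU; have /mapP[l lU ->] : v \in map (@eigvec R k) (upper_labels k).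
      by rewrite -upper_eigenvectorsE.
    case/allpairsPdep: lU => p [q [pP qP ->]].
    by apply: dirac_transport_upper => //; move: pP qP; rewrite !mem_iota; lia.
  + move=> v vL; have /mapP[l lL ->] : v \in map (@eigvec R k) (lower_labels k).
      by rewrite -lower_eigenvectorsE.
    have /labels_valid/and3P[qk pk _] : l \in labels k by rewrite mem_cat lL orbT.
    have := lower_labelsP lL; case: l {lL} qk pk => [[s p] q] /= qk pk ->.
    exact: dirac_transport_lower.
  + split=> //.
      apply: orthogonal_free => // v; rewrite eigenvectorsE => /mapP[l lL ->].
      exact: eigvec_neq0 (labels_valid lL).
    by move=> w; rewrite /upper /lower eigenvectorsE; exact: span_eigenvectors.
move=> sigma Vs; have [Phi iPhi] := exists_intertwining_isometry R k.
have [fW _ _] := phi_bij iPhi.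
have /WspaceP[g gE] := fW _ Vs.
by have [] := Phi_dirac iPhi Vs gE.
Qed.
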